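(* The map $\Psi\colon(\mathbb X_{pt},\tau_{\rm pmG})\to\mathbb X_1^{\mathbb Z}\times\mathbb R^{\mathbb Z}$ defined as $$\Psi(\mathcal X):=\bigg(\big({\sf j}(\mathcal X^k)\big)_{k\in\mathbb Z},\Big(\log\int\eta_k(\mathsf d(p,\cdot))\,{\rm d}\mathfrak m\Big)_{k\in\mathbb Z}\bigg)\quad\text{ for every }\mathcal X=[{\rm X},\mathsf d,\mathfrak m,p]\in\mathbb X_{pt},$$ where $\mathbb X_1$ is equipped with the box topology and $\mathbb X_1^{\mathbb Z}\times\mathbb R^{\mathbb Z}$ with the product topology, is a topological embedding (i.e. a homeomorphism onto its image).
   Context: ''Isometry'' means distance-preserving map (not necessarily surjective). A metric measure space $({\rm X},\mathsf d,\mathfrak m)$ is a complete separable metric space with a Borel measure $\mathfrak m$ that is finite on bounded Borel sets; it is normalised if $\mathfrak m$ is a probability measure. Two metric measure spaces are isomorphic if there is an isometric bijection $\phi\colon{\rm spt}(\mathfrak m_{\rm X})\to{\rm spt}(\mathfrak m_{\rm Y})$ with $\phi_\#\mathfrak m_{\rm X}=\mathfrak m_{\rm Y}$. $\mathbb X_1$ is the collection of isomorphism classes $[{\rm X},\mathsf d,\mathfrak m]$ of normalised metric measure spaces. A pointed metric measure space $({\rm X},\mathsf d,\mathfrak m,p)$ is a metric measure space with a point $p\in{\rm spt}(\mathfrak m)$; two pointed metric measure spaces $({\rm X},\mathsf d_{\rm X},\mathfrak m_{\rm X},p_{\rm X})$ and $({\rm Y},\mathsf d_{\rm Y},\mathfrak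 m_{\rm Y},p_{\rm Y})$ are isomorphic if there is an isometric bijection $\phi\colon{\rm spt}(\mathfrak m_{\rm X})\to{\rm spt}(\mathfrak m_{\rm Y})$ with $\phi_\#\mathfrak m_{\rm X}=\mathfrak m_{\rm Y}$ and $\phi(p_{\rm X})=p_{\rm Y}$. $\mathbb X_{pt}$ is the collection of isomorphism classes $[{\rm X},\mathsf d,\mathfrak m,p]$ of pointed metric measure spaces, and $\mathbb X_{1,pt}\subseteq\mathbb X_{pt}$ consists of those with $\mathfrak m$ a probability measure. pmG-convergence: $[{\rm X}_n,\mathsf d_n,\mathfrak m_n,p_n]$ pmG-converges to $[{\rm X}_\infty,\mathsf d_\infty,\mathfrak m_\infty,p_\infty]$ in $\mathbb X_{pt}$ if there exist a complete separable metric space $({\rm Y},\mathsf d_{\rm Y})$ and isometries $\iota_n\colon{\rm X}_n\to{\rm Y}$ ($n\in\mathbb N\cup\{\infty\}$) with $\iota_n(p_n)\to\iota_\infty(p_\infty)$ and $\int f\,{\rm d}(\iota_n)_\#\mathfrak m_n\to\int f\,{\rm d}(\iota_\infty)_\#\mathfrak m_\infty$ for every bounded continuous $f\colon{\rm Y}\to\mathbb R$ with bounded support. $\tau_{\rm pmG}$ is the metrisable topology on $\mathbb X_{pt}$ whose convergent sequences are exactly the pmG-convergent ones (its existence is a theorem of Gigli, Mondino and Savaré). For $k\in\mathbb Z$, $\eta_k\colon[0,+\infty)\to[0,1]$ is $\eta_k(t):=(2-2^{-k}t)^+\wedge 1$. For $\mathcal X=[{\rm X},\mathsf d,\mathfrak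 m,p]\in\mathbb X_{pt}$ and $k\in\mathbb Z$, $\mathcal X^k:=[{\rm X},\mathsf d,\mathfrak m^{p,k},p]\in\mathbb X_{1,pt}$, where $\mathfrak m^{p,k}:=\big(\int\eta_k(\mathsf d(p,\cdot))\,{\rm d}\mathfrak m\big)^{-1}\eta_k(\mathsf d(p,\cdot))\,\mathfrak m$. The map ${\sf j}\colon\mathbb X_{1,pt}\to\mathbb X_1$ is ${\sf j}([{\rm X},\mathsf d,\mathfrak m,p]):=[{\rm X},\mathsf d,(\mathfrak m+2\delta_p)/3]$. Box topology: the topology on $\mathbb X_1$ induced by the box distance $\square$. Let $\mathscr L_1$ be Lebesgue measure on $[0,1)$; a parameter of a probability $\mathfrak m$ on ${\rm X}$ is a Borel map $q\colon[0,1)\to{\rm X}$ with $q_\#\mathscr L_1=\mathfrak m$. For pseudodistances $\delta_1,\delta_2$ on $[0,1)$, $\square(\delta_1,\delta_2)$ is the infimum of $\varepsilon\in[0,1]$ for which there is a Borel $I_\varepsilon\subseteq[0,1)$ with $\mathscr L_1(I_\varepsilon)\geq1-\varepsilon$ and $|\delta_1(t,s)-\delta_2(t,s)|\leq\varepsilon$ for all $t,s\in I_\varepsilon$. Then $\square([{\rm X},\mathsf d_{\rm X},\mathfrak m_{\rm X}],[{\rm Y},\mathsf d_{\rm Y},\mathfrak m_{\rm Y}]):=\inf\square(q_{\rm X}^*\mathsf d_{\rm X},q_{\rm Y}^*\mathsf d_{\rm Y})$ over all parameters $q_{\rm X},q_{\rm Y}$ of $\mathfrak m_{\rm X},\mathfrak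 m_{\rm Y}$, where $(q^*\mathsf d)(t,s):=\mathsf d(q(t),q(s))$. *)

(* Defs.v *)
From HB Require Import structures.
From mathcomp Require Import all_boot all_order all_algebra.
From mathcomp Require Import all_classical all_reals all_analysis.
From mathcomp Require Import measurable_realfun lra.
Set Implicit Arguments.
Unset Strict Implicit.
Unset Printing Implicit Defensive.
Import Order.TTheory GRing.Theory Num.Theory.
Import numFieldNormedType.Exports.
Local Open Scope classical_set_scope.
Local Open Scope ring_scope.

(* [Complete] includes [Pointed], so these are the nonempty complete metric
   spaces with an arbitrary default point.  The default point plays no role: it
   is there because measurable types are pointed, and a space that carries a
   probability measure or a point of the support is nonempty anyway. *)
#[short(type="completeMetricType")]
HB.structure Definition CompleteMetric (R : numDomainType) :=
  {T of Metric R T & Complete T}.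

Notation borel T := (g_sigma_algebraType (@open T)).

Section metric_spaces.
Context {R : realType}.
Implicit Types X Y Z : completeMetricType R.

Definition separable X := exists2 D : set X, countable D & dense D.

Definition bounded_subset X (B : set X) :=
  exists M : R, forall x y, B x -> B y -> mdist x y <= M.

Definition isometry X Y (f : X -> Y) :=
  forall x y, mdist (f x) (f y) = mdist x y.

Definition spt X (m : set X -> \bar R) : set X :=
  [set x | forall U, open U -> U x -> (0 < m U)%E].

(* An isomorphism is a map between the supports; it is represented by a map
   defined on all of [X] whose values outside [spt mX] are irrelevant. *)
Definition isomorphism_on X Y (mX : {measure set (borel X) -> \bar R})
    (mY : {measure set (borel Y) -> \bar R}) (phi : X -> Y) :=
  [/\ set_bij (spt mX) (spt mY) phi,
      forall x y, spt mX x -> spt mX y -> mdist (phi x) (phi y) = mdist x y &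
      forall B : set (borel Y), measurable B ->
        mY B = mX (spt mX `&` phi @^-1` B)].

Lemma borel_open X (U : set X) : open U -> measurable (U : set (borel X)).
Proof. exact: sub_sigma_algebra. Qed.

Lemma borel_closed X (F : set X) : closed F -> measurable (F : set (borel X)).
Proof.
move=> cF; rewrite -(setCK F); apply: measurableC.
by apply: borel_open; exact: closed_openC.
Qed.

Lemma open_mball X (x : X) (r : R) : open (ball x r).
Proof.
rewrite openE => y /=; rewrite ballEmdist /= => xy.
rewrite /interior -nbhs_ballE; exists (r - mdist x y) => /=.
  by rewrite subr_gt0.
move=> z; rewrite !ballEmdist /= => yz.
by apply: (le_lt_trans (metric_triangle x y z)); rewrite addrC -ltrBrDr.
Qed.

Lemma open_local X (U : set X) :
  (forall x, U x -> exists2 V : set X, open V /\ V x & V `<=` U) -> open U.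
Proof.
move=> h; rewrite openE => x /h[V [oV Vx] VU].
by rewrite /interior nbhsE; exists V.
Qed.

Lemma sptP X (m : {measure set (borel X) -> \bar R}) (x : X) :
  spt m x <-> forall r : R, 0 < r -> (0 < m (ball x r))%E.
Proof.
split=> [sx r r0|h U oU Ux].
  by apply: sx; [exact: open_mball|exact: ballxx].
have : nbhs x U by exact: open_nbhs_nbhs.
rewrite -nbhs_ballE => -[r /= r0 rU].
apply: (lt_le_trans (h r r0)); apply: le_measure => //; rewrite inE.
  apply: borel_open; exact: open_mball.
exact: borel_open.
Qed.

Lemma spt_closed X (m : {measure set (borel X) -> \bar R}) : closed (spt m).
Proof.
rewrite -[spt m]setCK; apply: open_closedC; apply: open_local => x nx.
have [U [oU Ux mU]] : exists U, [/\ open U, U x & ~ (0 < m U)%E].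
  apply: contrapT => h; apply: nx => U oU Ux.
  by apply: contrapT => mU; apply: h; exists U.
by exists U => //= y Uy sy; exact/mU/sy.
Qed.

Lemma measurable_spt X (m : {measure set (borel X) -> \bar R}) :
  measurable (spt m : set (borel X)).
Proof. apply: borel_closed; exact: spt_closed. Qed.

Lemma separable_seq X : separable X -> exists u : nat -> X, dense (range u).
Proof.
move=> [D /pfcard_geP[D0|[f]] dD].
  by have [] := dD setT; [exists point|exact: openT|move=> x; rewrite D0 => -[]].
by exists f; rewrite (_ : range f = D)//; exact: image_eq.
Qed.

Lemma spt_full X (m : {measure set (borel X) -> \bar R}) :
  separable X -> m (~` spt m) = 0%E.
Proof.
move=> /separable_seq[u du].
pose Q i n := asbool (m (ball (u i) (n.+1%:R^-1 : R)) = 0%E).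
pose B i n : set (borel X) := if Q i n then ball (u i) (n.+1%:R^-1 : R) else set0.
have mB i n : measurable (B i n).
  by rewrite /B; case: ifP => // _; apply: borel_open; exact: open_mball.
have B0 : m.-negligible (\bigcup_i \bigcup_n B i n).
  apply: negligible_bigcup => i; apply: negligible_bigcup => n.
  exists (B i n); split => //.
  by rewrite /B; case: ifPn => [/asboolP//|_]; exact: measure0.
apply: measure_negligible.
  apply: measurableC; exact: measurable_spt.
apply: negligibleS B0 => x /= /sptP /existsNP[r /not_implyP[r0 mr]].
have [n nr] : exists n, n.+1%:R^-1 < r / 2.
  have := near_infty_natSinv_lt (PosNum (divr_gt0 r0 (@ltr0n R 2))).
  by move=> [n _ /(_ n (leqnn n))] /= ?; exists n.
have [] := du (ball x (n.+1%:R^-1)); [|exact: open_mball|].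
  by exists x; apply: ballxx; rewrite invr_gt0 ltr0n.
move=> z [xz [i _ uz]]; subst z.
have xBi : B i n x.
  rewrite /B; case: ifPn => [_|/asboolP []]; first exact: ball_sym.
  apply/eqP; rewrite eq_le measure_ge0 andbT.
  apply: (@le_trans _ _ (m (ball x r))); last by rewrite leNgt; apply/negP.
  apply: le_measure; rewrite ?inE.
  - by apply: borel_open; exact: open_mball.
  - by apply: borel_open; exact: open_mball.
  move=> y uy; rewrite [r]splitr; apply: (@ball_triangle _ _ (u i)).
    exact: le_ball (ltW nr) _ xz.
  exact: le_ball (ltW nr) _ uy.
by exists i => //; exists n.
Qed.

Lemma measurable_isometry_on X Y (S : set X) (phi : X -> Y) : closed S ->
  (forall x y, S x -> S y -> mdist (phi x) (phi y) = mdist x y) ->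
  measurable_fun (S : set (borel X)) (phi : borel X -> borel Y).
Proof.
move=> cS iso; apply: (@measurability _ _ (borel X) (borel Y) _ _ (@open Y)) => //.
move=> _ [U oU <-].
pose V := \bigcup_(p in [set p : X * R | S p.1 /\ ball (phi p.1) p.2 `<=` U])
  ball p.1 p.2.
have -> : S `&` phi @^-1` U = S `&` V.
  apply/seteqP; split => [x [Sx Ux]|x [Sx [[y r] [/= Sy yU] yx]]].
    split=> //; have : nbhs (phi x) U by exact: open_nbhs_nbhs.
    rewrite -nbhs_ballE => -[r /= r0 rU].
    by exists (x, r) => //=; exact: ballxx.
  split=> //=; apply: yU; move: yx; rewrite !ballEmdist /=.
  by rewrite iso.
apply: (@measurableI _ (borel X)); first exact: borel_closed.
by apply: borel_open; apply: bigcup_open => -[y r] _; exact: open_mball.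
Qed.

Lemma measurable_preimage_on X Y (S : set X) (phi : X -> Y)
    (B : set (borel Y)) : closed S ->
  (forall x y, S x -> S y -> mdist (phi x) (phi y) = mdist x y) ->
  measurable B -> measurable (S `&` phi @^-1` B : set (borel X)).
Proof.
move=> cS iso mB; apply: (measurable_isometry_on cS iso) => //.
exact: borel_closed.
Qed.

Definition extend_from X Y (S : set X) (phi : X -> Y) : X -> Y :=
  fun x => if asbool (S x) then phi x else point.

Lemma preimage_extend X Y (S : set X) (phi : X -> Y) (B : set Y) :
  extend_from S phi @^-1` B =
  (S `&` phi @^-1` B) `|` (~` S `&` (cst (point : Y)) @^-1` B).
Proof.
rewrite /extend_from; apply/seteqP; split => x /=.
  by case: asboolP => [Sx Bx|nSx Bx]; [left|right].
by case=> -[Sx Bx]; case: asboolP.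
Qed.

Lemma measurable_extend X Y (S : set X) (phi : X -> Y) : closed S ->
  (forall x y, S x -> S y -> mdist (phi x) (phi y) = mdist x y) ->
  measurable_fun setT (extend_from S phi : borel X -> borel Y).
Proof.
move=> cS iso _ B mB; rewrite setTI preimage_extend.
apply: (@measurableU _ (borel X)).
  exact: measurable_preimage_on cS iso mB.
apply: (@measurableI _ (borel X)).
  by apply: (@measurableC _ (borel X)); exact: borel_closed.
rewrite -[X in measurable X]setTI.
exact: (@measurable_cst _ _ (borel X) (borel Y)).
Qed.

Lemma measure_setI X (m : {measure set (borel X) -> \bar R}) (S : set X)
    (B : set (borel X)) : closed S -> m (~` S) = 0%E -> measurable B ->
  m (S `&` B) = m B.
Proof.
move=> cS S0 mB; have mS : measurable (S : set (borel X)) by exact: borel_closed.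
rewrite [RHS](@measureDI _ _ _ m _ S)// [X in (_ = X + _)%E](_ : _ = 0%E).
  by rewrite add0e setIC.
apply: (subset_measure0 _ _ _ S0) => //; first exact: measurableD.
  exact: measurableC.
Qed.

Lemma measure_preimage_extend X Y (m : {measure set (borel X) -> \bar R})
    (S : set X) (phi : X -> Y) (B : set (borel Y)) : closed S ->
  (forall x y, S x -> S y -> mdist (phi x) (phi y) = mdist x y) ->
  m (~` S) = 0%E -> measurable B ->
  m (extend_from S phi @^-1` B) = m (S `&` phi @^-1` B).
Proof.
move=> cS iso S0 mB; rewrite -(measure_setI cS S0); last first.
  by rewrite -[X in measurable X]setTI; exact: measurable_extend.
congr (m _); apply/seteqP; split=> x [Sx]; rewrite /extend_from /=;
  by case: asboolP.
Qed.

Lemma spt_sub X (m : {measure set (borel X) -> \bar R}) (S : set X) :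
  closed S -> m (~` S) = 0%E -> spt m `<=` S.
Proof.
move=> cS S0 x sx; apply: contrapT => Sx.
by have := sx (~` S) (closed_openC cS) Sx; rewrite S0 ltxx.
Qed.

Lemma transfer_isomorphism X Y (S : set X) (T : set Y) (phi : X -> Y)
    (nX : {measure set (borel X) -> \bar R})
    (nY : {measure set (borel Y) -> \bar R}) :
  separable X -> closed S -> closed T -> set_bij S T phi ->
  (forall x y, S x -> S y -> mdist (phi x) (phi y) = mdist x y) ->
  nX (~` S) = 0%E -> nY (~` T) = 0%E ->
  (forall B : set (borel Y), measurable B -> nY B = nX (S `&` phi @^-1` B)) ->
  isomorphism_on nX nY phi.
Proof.
move=> sX cS cT [ST injS surS] iso S0 T0 push.
have subS := spt_sub cS S0; have subT := spt_sub cT T0.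
have sptE x : S x -> spt nX x <-> spt nY (phi x).
  move=> Sx; have h r : nY (ball (phi x) r) = nX (ball x r).
    rewrite push; last by apply: borel_open; exact: open_mball.
    rewrite -[RHS](measure_setI cS S0); last first.
      by apply: borel_open; exact: open_mball.
    congr (nX _); apply/seteqP; split => y [Sy]; rewrite !ballEmdist /= iso //.
  by split=> /sptP h1; apply/sptP => r /h1; rewrite h.
have mS : measurable (S : set (borel X)) by exact: borel_closed.
split.
- split.
  + by move=> x sx; apply/(sptE x) => //; exact: subS.
  + move=> x y /set_mem sx /set_mem sy; apply: injS; apply/mem_set; exact: subS.
  + move=> y sy; have [x Sx xy] := surS y (subT _ sy).
    by exists x => //; apply/(sptE x) => //; rewrite xy.
- by move=> x y sx sy; apply: iso; exact: subS.
- move=> B mB; rewrite push //.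
  rewrite -(measure_setI (@spt_closed _ nX) (spt_full nX sX)); last first.
    exact: measurable_preimage_on cS iso mB.
  congr (nX _); apply/seteqP; split => x /=; first by move=> [? []].
  by move=> [sx Bx]; split => //; split=> //; exact: subS.
Qed.

Lemma isomorphism_refl X (m : {measure set (borel X) -> \bar R}) :
  separable X -> isomorphism_on m m id.
Proof.
move=> sX; split => //; first by split=> // x sx; exists x.
by move=> B mB; rewrite measure_setI//; [exact: spt_closed|exact: spt_full].
Qed.

Lemma isomorphism_sym X Y (mX : {measure set (borel X) -> \bar R})
    (mY : {measure set (borel Y) -> \bar R}) (phi : X -> Y) :
  separable X -> isomorphism_on mX mY phi ->
  exists2 psi : Y -> X, isomorphism_on mY mX psi &
    forall x, spt mX x -> psi (phi x) = x.
Proof.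
move=> sX [[fphi iphi sphi] iso push].
pose psi y := xget (point : X) [set x | spt mX x /\ phi x = y].
have psiP y : spt mY y -> spt mX (psi y) /\ phi (psi y) = y.
  move=> /sphi[x sx xy].
  by rewrite /psi; case: xgetP => [z _//|/(_ x)[]].
have psiK x : spt mX x -> psi (phi x) = x.
  move=> sx; have [sy e] := psiP _ (fphi _ sx).
  by apply: iphi => //; exact/mem_set.
exists psi => //; split.
- split.
  + by move=> y /psiP[].
  + by move=> y z /set_mem /psiP[_ yE] /set_mem /psiP[_ zE] yz; rewrite -yE yz.
  + by move=> x sx; exists (phi x); [exact: fphi|exact: psiK].
- by move=> y z /psiP[sy yE] /psiP[sz zE]; rewrite -iso// yE zE.
- have psiiso y z : spt mY y -> spt mY z -> mdist (psi y) (psi z) = mdist y z.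
    by move=> /psiP[sy yE] /psiP[sz zE]; rewrite -iso// yE zE.
  move=> B mB; rewrite push; last first.
    exact: measurable_preimage_on (@spt_closed _ mY) psiiso mB.
  rewrite -[LHS](measure_setI (@spt_closed _ mX) (spt_full mX sX) mB).
  congr (mX _); apply/seteqP; split=> x /= [sx].
    by move=> Bx; split=> //; split; [exact: fphi|rewrite psiK].
  by move=> [_]; rewrite psiK.
Qed.

Lemma isomorphism_trans X Y Z (mX : {measure set (borel X) -> \bar R})
    (mY : {measure set (borel Y) -> \bar R})
    (mZ : {measure set (borel Z) -> \bar R}) (phi : X -> Y) (psi : Y -> Z) :
  isomorphism_on mX mY phi -> isomorphism_on mY mZ psi ->
  isomorphism_on mX mZ (psi \o phi).
Proof.
move=> [bphi isophi pushphi] [bpsi isopsi pushpsi].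
have fphi : set_fun (spt mX) (spt mY) phi by case: bphi.
split.
- exact: set_bij_comp bphi bpsi.
- by move=> x y sx sy /=; rewrite isopsi ?isophi//; exact: fphi.
- move=> B mB; rewrite pushpsi// pushphi; last first.
    exact: measurable_preimage_on (@spt_closed _ mY) isopsi mB.
  congr (mX _); apply/seteqP; split=> x /= [sx]; first by case.
  by move=> Bx; split=> //; split=> //; exact: fphi.
Qed.

End metric_spaces.

Record mms (R : realType) := MMS {
  mms_space :> completeMetricType R;
  mms_measure : {measure set (borel mms_space) -> \bar R};
  mms_separable : separable mms_space;
  mms_finite_bounded : forall B : set (borel mms_space),
    measurable B -> @bounded_subset R mms_space B -> (mms_measure B < +oo)%E
}.

Record nmms (R : realType) := NMMS {
  nmms_mms :> mms R;
  nmms_mass1 : mms_measure nmms_mms setT = 1%E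
}.

Record pmms (R : realType) := PMMS {
  pmms_mms :> mms R;
  pmms_pt : pmms_mms;
  pmms_pt_spt : spt (mms_measure pmms_mms) pmms_pt
}.

HB.instance Definition _ R := gen_eqMixin (nmms R).
HB.instance Definition _ R := gen_choiceMixin (nmms R).
HB.instance Definition _ R := gen_eqMixin (pmms R).
HB.instance Definition _ R := gen_choiceMixin (pmms R).

Section isomorphism_classes.
Context {R : realType}.

Definition nmms_iso (X Y : nmms R) :=
  exists phi, isomorphism_on (mms_measure X) (mms_measure Y) phi.

Definition pmms_iso (X Y : pmms R) :=
  exists2 phi, isomorphism_on (mms_measure X) (mms_measure Y) phi &
    phi (pmms_pt X) = pmms_pt Y.

Let nmms_isob X Y := `[< nmms_iso X Y >].
Let pmms_isob X Y := `[< pmms_iso X Y >].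

Lemma nmms_isob_equiv : equiv_class_of nmms_isob.
Proof.
split.
- by move=> X; apply/asboolP; exists id; exact/isomorphism_refl/mms_separable.
- have sym X Y : nmms_iso X Y -> nmms_iso Y X.
    by move=> [phi /(isomorphism_sym (mms_separable X))[psi ? _]]; exists psi.
  by move=> X Y; apply/asboolP/asboolP; exact: sym.
- move=> Y X Z /asboolP[phi hphi] /asboolP[psi hpsi]; apply/asboolP.
  by exists (psi \o phi); exact: isomorphism_trans hphi hpsi.
Qed.

Lemma pmms_isob_equiv : equiv_class_of pmms_isob.
Proof.
split.
- move=> X; apply/asboolP; exists id => //.
  exact/isomorphism_refl/mms_separable.
- have sym X Y : pmms_iso X Y -> pmms_iso Y X.
    move=> [phi /(isomorphism_sym (mms_separable X))[psi ? K] phip].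
    by exists psi => //; rewrite -phip K//; exact: pmms_pt_spt.
  by move=> X Y; apply/asboolP/asboolP; exact: sym.
- move=> Y X Z /asboolP[phi hphi phip] /asboolP[psi hpsi psip]; apply/asboolP.
  exists (psi \o phi); first exact: isomorphism_trans hphi hpsi.
  by rewrite /= phip.
Qed.

Canonical nmms_iso_equiv := EquivRelPack nmms_isob_equiv.
Canonical pmms_iso_equiv := EquivRelPack pmms_isob_equiv.
End isomorphism_classes.

Definition X1 (R : realType) := {eq_quot (@nmms_iso_equiv R)}%qT.
HB.instance Definition _ R := EqQuotient.on (X1 R).
HB.instance Definition _ R := Choice.on (X1 R).

Definition Xpt (R : realType) := {eq_quot (@pmms_iso_equiv R)}%qT.
HB.instance Definition _ R := EqQuotient.on (Xpt R).
HB.instance Definition _ R := Choice.on (Xpt R).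

Section classes.
Context {R : realType}.
Definition class1 (X : nmms R) : X1 R := \pi_(X1 R)%qT X.
Definition class_pt (X : pmms R) : Xpt R := \pi_(Xpt R)%qT X.

Lemma class1P (X Y : nmms R) : class1 X = class1 Y <-> nmms_iso X Y.
Proof. by split=> [/eqmodP/asboolP|h]; [|apply/eqmodP/asboolP]. Qed.

Lemma class_ptP (X Y : pmms R) : class_pt X = class_pt Y <-> pmms_iso X Y.
Proof. by split=> [/eqmodP/asboolP|h]; [|apply/eqmodP/asboolP]. Qed.
End classes.

Definition eta {R : realType} (k : int) (t : R) : R :=
  Num.min (Num.max (2 - 2 ^ (- k) * t) 0) 1.

Section cutoff.
Context {R : realType}.
Implicit Types (X Y : pmms R) (k : int) (t : R).

Lemma eta_ge0 k t : 0 <= eta k t.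
Proof. by rewrite /eta le_min ler01 le_max lexx orbT. Qed.

Lemma eta_le1 k t : eta k t <= 1.
Proof. by rewrite /eta ge_min lexx orbT. Qed.

Lemma eta_near k t : t < 2 ^ k -> eta k t = 1.
Proof.
move=> tk; have k0 : 0 < 2 ^ k :> R by exact: exprz_gt0.
apply/min_idPr; rewrite le_max; apply/orP; left.
suff: 2 ^ (- k) * t <= 1 by lra.
by rewrite -invr_expz mulrC ler_pdivrMr// mul1r ltW.
Qed.

Lemma eta_far k t : 2 * 2 ^ k <= t -> eta k t = 0.
Proof.
move=> tk; have k0 : 0 < 2 ^ k :> R by exact: exprz_gt0.
have h : 2 <= 2 ^ (- k) * t by rewrite -invr_expz mulrC ler_pdivlMr.
by rewrite /eta (max_idPr _) ?(min_idPl _)//; lra.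
Qed.

Definition eta_dist X k (x : X) : R := eta k (mdist (pmms_pt X) x).

Lemma measurable_mdist (X : completeMetricType R) (p : X) :
  measurable_fun setT (mdist p : borel X -> R).
Proof.
apply: (measurability _ (RGenCInfty.measurableE R)) => //.
move=> _ [_ [r ->] <-]; rewrite setTI.
have -> : mdist p @^-1` `[r, +oo[%classic = ~` ball p r.
  apply/seteqP; split=> x /=; rewrite in_itv/= andbT ballEmdist/= leNgt.
    by move/negP.
  by move=> ?; apply/negP.
apply: (@measurableC _ (borel X)); apply: borel_open; exact: open_mball.
Qed.

Lemma measurable_eta_dist X k :
  measurable_fun setT (eta_dist k : borel X -> R).
Proof.
apply: measurable_minr => //; apply: measurable_maxr => //.
apply: measurable_funB => //; apply: measurable_funM => //.
exact: measurable_mdist.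
Qed.

Lemma measurable_eta_distE X k (D : set (borel X)) :
  measurable_fun D (fun x => (eta_dist k x)%:E).
Proof.
by apply/measurable_EFinP; apply: measurable_funTS; exact: measurable_eta_dist.
Qed.

Definition eta_mass X k : R := \int[mms_measure X]_x eta_dist k x.

Definition eta_measure X k (B : set (borel X)) : \bar R :=
  (\int[mms_measure X]_(x in B) (eta_dist k x)%:E)%E.

Section eta_measure_instance.
Variables (X : pmms R) (k : int).
Let eta_measure0 : eta_measure k (set0 : set (borel X)) = 0%E.
Proof. exact: integral_set0. Qed.
Let eta_measure_ge0 (B : set (borel X)) : (0 <= eta_measure k B)%E.
Proof. by apply: integral_ge0 => x _; rewrite lee_fin eta_ge0. Qed.
Let eta_measure_sigma_additive : semi_sigma_additive (@eta_measure X k).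
Proof.
apply: semi_sigma_additive_nng_induced; first exact: measurable_eta_distE.
by move=> x; rewrite lee_fin eta_ge0.
Qed.
HB.instance Definition _ := isMeasure.Build _ _ _ (@eta_measure X k)
  eta_measure0 eta_measure_ge0 eta_measure_sigma_additive.
End eta_measure_instance.

Lemma mms_ball_finite (X : mms R) (x : X) (r : R) :
  (mms_measure X (ball x r) < +oo)%E.
Proof.
apply: mms_finite_bounded; first by apply: borel_open; exact: open_mball.
exists (r + r) => y z; rewrite !ballEmdist/= => xy xz.
by rewrite (le_trans (metric_triangle y x z))// lerD// ltW// metric_sym.
Qed.

Lemma eta_measure_setT_fin X k : (@eta_measure X k setT < +oo)%E.
Proof.
pose B : set X := ball (pmms_pt X) (2 * 2 ^ k).
have mB : measurable (B : set (borel X)).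
  by apply: borel_open; exact: open_mball.
apply: (le_lt_trans _ (mms_ball_finite (pmms_pt X) (2 * 2 ^ k))).
rewrite -[leRHS]/(mms_measure X B) -[B]setIT -integral_indic//.
apply: ge0_le_integral => //.
- by move=> x _; rewrite lee_fin eta_ge0.
- exact: measurable_eta_distE.
- by apply/measurable_EFinP; exact: measurable_indic.
- move=> x _; rewrite lee_fin indicE.
  have [Bx|/negP Bx] := boolP (x \in B); first exact: eta_le1.
  rewrite /eta_dist eta_far// leNgt; apply/negP => h; apply: Bx.
  by apply/mem_set; rewrite /B ballEmdist.
Qed.

Lemma eta_measure_setT X k : @eta_measure X k setT = (eta_mass X k)%:E.
Proof.
rewrite /eta_mass /Rintegral fineK// ge0_fin_numE.
  exact: eta_measure_setT_fin.
by apply: integral_ge0 => x _; rewrite lee_fin eta_ge0.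
Qed.

Lemma eta_mass_gt0 X k : 0 < eta_mass X k.
Proof.
pose B : set X := ball (pmms_pt X) (2 ^ k).
have mB : measurable (B : set (borel X)).
  by apply: borel_open; exact: open_mball.
rewrite -lte_fin -eta_measure_setT.
have /sptP/(_ (2 ^ k)) := @pmms_pt_spt _ X.
rewrite exprz_gt0// => /(_ isT) h; apply: (lt_le_trans h).
rewrite -[leLHS]/(mms_measure X B) -[B]setIT -integral_indic//.
apply: ge0_le_integral => //.
- by apply/measurable_EFinP; exact: measurable_indic.
- exact: measurable_eta_distE.
- move=> x _; rewrite lee_fin indicE.
  have [/set_mem Bx|_] := boolP (x \in B); last exact: eta_ge0.
  by rewrite /eta_dist eta_near//; move: Bx; rewrite /B ballEmdist.
Qed.

Lemma eta_massV_ge0 X k : 0 <= (eta_mass X k)^-1.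
Proof. by rewrite invr_ge0 ltW// eta_mass_gt0. Qed.

Definition cut_measure X k : {measure set (borel X) -> \bar R} :=
  mscale (NngNum (eta_massV_ge0 X k)) (@eta_measure X k).

Lemma cut_measureE X k (B : set (borel X)) :
  cut_measure X k B = ((eta_mass X k)^-1%:E * eta_measure k B)%E.
Proof. by []. Qed.

Lemma cut_measure_setT X k : cut_measure X k setT = 1%E.
Proof.
by rewrite cut_measureE eta_measure_setT -EFinM mulVf// gt_eqF// eta_mass_gt0.
Qed.

Lemma mass1_finite_bounded (X : completeMetricType R)
    (m : {measure set (borel X) -> \bar R}) : m setT = 1%E ->
  forall B : set (borel X), measurable B -> @bounded_subset R X B ->
    (m B < +oo)%E.
Proof.
move=> m1 B mB _; rewrite (@le_lt_trans _ _ 1%E) ?ltry// -m1.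
by apply: le_measure; rewrite ?inE.
Qed.

Definition cut_mms X k : mms R :=
  MMS (mms_separable X) (mass1_finite_bounded (cut_measure_setT X k)).

Lemma cut_pt_spt X k : spt (mms_measure (cut_mms X k)) (pmms_pt X).
Proof.
apply/sptP => r r0; rewrite /= cut_measureE mule_gt0//.
  by rewrite lte_fin invr_gt0 eta_mass_gt0.
pose s : R := Num.min r (2 ^ k).
pose B : set X := ball (pmms_pt X) s.
have s0 : 0 < s by rewrite lt_min r0 exprz_gt0.
have mB : measurable (B : set (borel X)).
  by apply: borel_open; exact: open_mball.
have mBr : measurable (ball (pmms_pt X) r : set (borel X)).
  by apply: borel_open; exact: open_mball.
have BE : eta_measure k B = mms_measure X B.
  rewrite /eta_measure -[RHS]mul1e -integral_cst//; apply: eq_integral => x.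
  rewrite inE /B ballEmdist /= lt_min => /andP[_ h].
  by rewrite /eta_dist eta_near.
apply: (@lt_le_trans _ _ (eta_measure k B)).
  by rewrite BE; have /sptP/(_ _ s0) := @pmms_pt_spt _ X.
apply: le_measure; rewrite ?inE//.
by move=> x; rewrite /B !ballEmdist /= lt_min => /andP[].
Qed.

Definition cut_pmms X k : pmms R :=
  @PMMS R (cut_mms X k) (pmms_pt X) (@cut_pt_spt X k).

Definition j_measure X : {measure set (borel X) -> \bar R} :=
  mscale (3^-1)%:nng (measure_add (mms_measure X)
    (mscale 2%:nng (dirac (pmms_pt X : borel X)))).

Lemma j_measureE X (B : set (borel X)) :
  j_measure X B = (3^-1%:E * (mms_measure X B + 2%:E * \d_(pmms_pt X : borel X) B))%E.
Proof.
exact: (congr1 (fun y => (3^-1%:E * y)%E) (measure_addE (mms_measure X)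
  (mscale 2%:nng (dirac (pmms_pt X : borel X))) B)).
Qed.

Lemma j_measure_setT X : mms_measure X setT = 1%E -> j_measure X setT = 1%E.
Proof.
move=> m1; rewrite j_measureE m1 diracT mule1 -EFinD -EFinM.
by congr _%:E; lra.
Qed.

Definition j_nmms X (m1 : mms_measure X setT = 1%E) : nmms R :=
  @NMMS R (MMS (mms_separable X) (mass1_finite_bounded (j_measure_setT m1)))
    (j_measure_setT m1).

End cutoff.

Section invariance.
Context {R : realType}.
Implicit Types (X Y : pmms R) (k : int).

Lemma iso_mass X Y : pmms_iso X Y ->
  mms_measure Y setT = mms_measure X setT.
Proof.
move=> [phi [_ _ push] _]; rewrite push// preimage_setT measure_setI//.
  exact: spt_closed.
exact/spt_full/mms_separable.
Qed.

Lemma eta_measure_iso X Y k phi :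
  isomorphism_on (mms_measure X) (mms_measure Y) phi ->
  phi (pmms_pt X) = pmms_pt Y ->
  forall B : set (borel Y), measurable B ->
    eta_measure k B = @eta_measure _ X k (spt (mms_measure X) `&` phi @^-1` B).
Proof.
move=> [_ iso push] phip B mB.
set S := spt (mms_measure X).
have cS : closed S by exact: spt_closed.
have S0 : mms_measure X (~` S) = 0%E by exact/spt_full/mms_separable.
have me := measurable_extend cS iso.
have meB : measurable (extend_from S phi @^-1` B : set (borel X)).
  by rewrite -[X in measurable X]setTI; exact: me.
pose e : borel X -> borel Y := extend_from S phi.
rewrite {1}/eta_measure
  (@eq_measure_integral _ _ _ B (pushforward (mms_measure X) e)); last first.
  by move=> A mA _; rewrite push// -(measure_preimage_extend cS iso S0).
rewrite ge0_integral_pushforward//; last 2 first.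
- exact: measurable_eta_distE.
- by move=> y _; rewrite lee_fin eta_ge0.
rewrite (@ge0_negligible_integral _ _ _ _ _ (~` S : set (borel X)))//.
- rewrite setDE setCK /eta_measure.
  have -> : e @^-1` B `&` S = S `&` phi @^-1` B.
    apply/seteqP; split=> x [] /=; rewrite /e /extend_from.
      by move=> + Sx; case: asboolP.
    by move=> Sx Bx; case: asboolP.
  apply: eq_integral => x; rewrite inE => -[Sx _] /=.
  rewrite /e /extend_from; case: asboolP => // _.
  by rewrite /eta_dist -phip iso//; exact: pmms_pt_spt.
- by apply: (@measurableC _ (borel X)); exact: borel_closed.
- apply: (@measurable_comp _ _ _ _ _ _ (setT : set (borel Y))) => //.
    exact: measurable_eta_distE.
  exact: measurable_funS me.
- by move=> x _; rewrite lee_fin eta_ge0.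
Qed.

Lemma eta_measure_null X k (N : set (borel X)) : measurable N ->
  mms_measure X N = 0%E -> eta_measure k N = 0%E.
Proof.
by move=> mN N0; apply: null_set_integral => //; exact: measurable_eta_distE.
Qed.

Lemma eta_mass_iso X Y k : pmms_iso X Y -> eta_mass Y k = eta_mass X k.
Proof.
move=> [phi iso phip]; apply: EFin_inj; rewrite -!eta_measure_setT.
rewrite (eta_measure_iso k iso phip)// preimage_setT setIT.
have cS : closed (spt (mms_measure X)) by exact: spt_closed.
rewrite -[in RHS](setIT (setT : set (borel X))) -[RHS](measure_setI cS)//.
  by rewrite !setIT.
  apply: eta_measure_null; first by apply: measurableC; exact: borel_closed.
  exact/spt_full/mms_separable.
by rewrite setIT.
Qed.

Lemma cut_iso X Y k : pmms_iso X Y -> pmms_iso (cut_pmms X k) (cut_pmms Y k).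
Proof.
move=> isoXY; have := eta_mass_iso k isoXY; case: isoXY => phi iphi phip mE.
exists phi => //; have [bij iso _] := iphi.
have null (Z : pmms R) : eta_measure k (~` spt (mms_measure Z) : set (borel Z)) = 0%E.
  apply: eta_measure_null; first by apply: measurableC; exact: measurable_spt.
  exact/spt_full/mms_separable.
apply: (transfer_isomorphism (mms_separable X)
  (@spt_closed _ _ (mms_measure X)) (@spt_closed _ _ (mms_measure Y)) bij iso).
- by rewrite /= cut_measureE null mule0.
- by rewrite /= cut_measureE null mule0.
- by move=> B mB; rewrite /= !cut_measureE mE (eta_measure_iso k iphi phip).
Qed.

Lemma j_iso X Y (mX : mms_measure X setT = 1%E) (mY : mms_measure Y setT = 1%E) :
  pmms_iso X Y -> nmms_iso (j_nmms mX) (j_nmms mY).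
Proof.
move=> [phi [bij iso push] phip]; exists phi.
have null (Z : pmms R) : j_measure Z (~` spt (mms_measure Z) : set (borel Z)) = 0%E.
  rewrite j_measureE (spt_full _ (mms_separable Z)) add0e diracE memNset.
    by rewrite !mule0.
  by apply; exact: pmms_pt_spt.
apply: (transfer_isomorphism (mms_separable X)
  (@spt_closed _ _ (mms_measure X)) (@spt_closed _ _ (mms_measure Y)) bij iso).
- exact: null.
- exact: null.
- move=> B mB; rewrite /= !j_measureE push//; congr (_ * (_ + _ * _))%E.
  rewrite !diracE; congr (_%:R%:E); congr nat_of_bool.
  apply/idP/idP => /set_mem h; apply/mem_set.
    by split; [exact: pmms_pt_spt|rewrite /= phip].
  by rewrite -phip; case: h.
Qed.

End invariance.

Section embedding_map.
Context {R : realType}.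

Definition X1pt_set : set (Xpt R) :=
  [set class_pt X | X in [set X : pmms R | mms_measure X setT = 1%E]].

Definition X1pt := set_type X1pt_set.

Lemma class_pt_repr (x : Xpt R) : class_pt (repr x) = x.
Proof. exact: reprK. Qed.

Lemma pmms_iso_repr (X : pmms R) : pmms_iso (repr (class_pt X)) X.
Proof. by apply/class_ptP; rewrite class_pt_repr. Qed.

Lemma X1pt_mass1 (x : X1pt) : mms_measure (repr (\val x)) setT = 1%E.
Proof.
have [X X1 xE] := set_valP x.
rewrite -X1; apply: iso_mass; apply/class_ptP.
by rewrite class_pt_repr xE.
Qed.

Lemma cut_X1pt (X : pmms R) (k : int) : X1pt_set (class_pt (cut_pmms X k)).
Proof. by exists (cut_pmms X k) => //; exact: cut_measure_setT. Qed.

(* The maps below are defined through representatives; [cutE], [jE] and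
   [log_massE] show that the choice of representatives does not matter. *)
Definition cut (k : int) (x : Xpt R) : X1pt :=
  SigSub (mem_set (cut_X1pt (repr x) k)).

Lemma cutE k (X : pmms R) : \val (cut k (class_pt X)) = class_pt (cut_pmms X k).
Proof.
by apply/class_ptP; apply: cut_iso; exact: pmms_iso_repr.
Qed.

Definition j (x : X1pt) : X1 R := class1 (j_nmms (X1pt_mass1 x)).

Lemma jE (x : X1pt) (X : pmms R) (m1 : mms_measure X setT = 1%E) :
  \val x = class_pt X -> j x = class1 (j_nmms m1).
Proof.
by move=> xX; apply/class1P; apply: j_iso; apply/class_ptP; rewrite class_pt_repr.
Qed.

Definition log_mass (k : int) (x : Xpt R) : R := ln (eta_mass (repr x) k).

Lemma log_massE k (X : pmms R) : log_mass k (class_pt X) = ln (eta_mass X k).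
Proof. by congr ln; apply/esym/eta_mass_iso/pmms_iso_repr. Qed.

End embedding_map.

Section box_distance.
Context {R : realType}.

(* A parameter is a map on [0, 1); it is represented by a map on [R] whose
   values outside [0, 1) are irrelevant. *)
Definition parameter (X : mms R) (q : R -> X) :=
  measurable_fun (`[0, 1[ : set (measurableTypeR R))
    (q : measurableTypeR R -> borel X) /\
  forall B : set (borel X), measurable B ->
    mms_measure X B = lebesgue_measure (`[0, 1[ `&` q @^-1` B).

Definition box_pseudo (d1 d2 : R -> R -> R) : R :=
  inf [set e : R | 0 <= e <= 1 /\ exists I : set (measurableTypeR R),
    [/\ measurable I, I `<=` `[0, 1[, ((1 - e)%:E <= lebesgue_measure I)%E &
        forall t s, I t -> I s -> `|d1 t s - d2 t s| <= e]].

(* The set of values is never empty, since every Borel probability measure on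
   a Polish space has a parameter, and it is bounded below by 0. *)
Definition box_rep (X Y : nmms R) : R :=
  inf [set b | exists qX : R -> X, exists qY : R -> Y,
    [/\ parameter qX, parameter qY &
        b = box_pseudo (fun t s => mdist (qX t) (qX s))
                       (fun t s => mdist (qY t) (qY s))]].

(* [boxE] shows that the choice of representatives does not matter. *)
Definition box (x y : X1 R) : R := box_rep (repr x) (repr y).

Lemma box_pseudo_sym d1 d2 : box_pseudo d1 d2 = box_pseudo d2 d1.
Proof.
rewrite /box_pseudo; congr inf; apply/seteqP; split=> e [e01 [I [mI I1 le h]]];
  by split=> //; exists I; split=> // t s It Is; rewrite distrC; exact: h.
Qed.

Lemma box_rep_sym X Y : box_rep X Y = box_rep Y X.
Proof.
rewrite /box_rep; congr inf; apply/seteqP; split=> b [q1 [q2 [p1 p2 ->]]];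
  by exists q2, q1; split=> //; exact: box_pseudo_sym.
Qed.

Lemma box_pseudo_ae (N : set (measurableTypeR R)) d1 d1' d2 :
  measurable N -> lebesgue_measure N = 0%E ->
  (forall t s, t \in `[0, 1[ -> s \in `[0, 1[ -> ~ N t -> ~ N s ->
    d1 t s = d1' t s) ->
  box_pseudo d1 d2 = box_pseudo d1' d2.
Proof.
move=> mN N0 dd.
suff H (a b : R -> R -> R) e : (forall t s, t \in `[0, 1[ -> s \in `[0, 1[ ->
    ~ N t -> ~ N s -> a t s = b t s) ->
  (exists I : set (measurableTypeR R),
    [/\ measurable I, I `<=` `[0, 1[, ((1 - e)%:E <= lebesgue_measure I)%E &
        forall t s, I t -> I s -> `|a t s - d2 t s| <= e]) ->
  (exists I : set (measurableTypeR R),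
    [/\ measurable I, I `<=` `[0, 1[, ((1 - e)%:E <= lebesgue_measure I)%E &
        forall t s, I t -> I s -> `|b t s - d2 t s| <= e]).
  rewrite /box_pseudo; congr inf; apply/seteqP; split=> e [e01 h];
    split=> //; [exact: (H d1 d1')|apply: (H d1' d1) => // t s *].
  by apply/esym/dd.
move=> ab [I [mI I1 le h]]; exists (I `\` N); split.
- exact: measurableD.
- by move=> t [/I1].
- rewrite (le_trans le)// (@measureDI _ _ _ lebesgue_measure I N)//.
  rewrite [X in (_ + X)%E](_ : _ = 0%E) ?adde0//.
  by apply: (subset_measure0 _ _ _ N0) => //; exact: measurableI.
- move=> t s [It Nt] [Is Ns]; rewrite -ab//; first exact: h.
    exact: I1.
  exact: I1.
Qed.

Lemma parameter_iso (X Y : nmms R) (q : R -> X) : nmms_iso X Y ->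
  parameter q -> exists2 q' : R -> Y, parameter q' &
    forall d, box_pseudo (fun t s => mdist (q t) (q s)) d =
              box_pseudo (fun t s => mdist (q' t) (q' s)) d.
Proof.
move=> [phi [_ iso push]] [mq pq]; set S := spt (mms_measure X).
have cS : closed S by exact: spt_closed.
have S0 : mms_measure X (~` S) = 0%E by exact/spt_full/mms_separable.
have mSC : measurable (~` S : set (borel X)).
  by apply: measurableC; exact: borel_closed.
have me := measurable_extend cS iso.
have m01 : measurable (`[0, 1[ : set (measurableTypeR R)).
  exact: measurable_itv.
exists (extend_from S phi \o q).
  split.
    apply: (@measurable_comp _ _ _ _ _ _ (setT : set (borel X))) => //.
  move=> B mB; rewrite push// -(measure_preimage_extend cS iso S0 mB) pq//.
  by rewrite -[X in measurable X]setTI; exact: me.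
move=> d; apply: (@box_pseudo_ae (`[0, 1[ `&` q @^-1` (~` S))).
- exact: mq.
- by rewrite -pq.
- move=> t s t01 s01 Nt Ns.
  have St : S (q t) by apply: contrapT => St; apply: Nt.
  have Ss : S (q s) by apply: contrapT => Ss; apply: Ns.
  rewrite /= /extend_from; case: asboolP => // _; case: asboolP => // _.
  by rewrite iso.
Qed.

Lemma box_rep_iso (X Y Z : nmms R) : nmms_iso X Y -> box_rep X Z = box_rep Y Z.
Proof.
move=> XY; have YX : nmms_iso Y X.
  by apply/class1P; apply/esym/class1P.
rewrite /box_rep; congr inf; apply/seteqP; split=> b [q1 [q2 [p1 p2 ->]]].
  by have [q' pq' qE] := parameter_iso XY p1; exists q', q2.
by have [q' pq' qE] := parameter_iso YX p1; exists q', q2.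
Qed.

Lemma boxE (X Y : nmms R) : box (class1 X) (class1 Y) = box_rep X Y.
Proof.
have h (Z : nmms R) : nmms_iso (repr (class1 Z)) Z.
  by apply/class1P; rewrite /class1 reprK.
by rewrite /box (box_rep_iso _ (h X)) box_rep_sym (box_rep_iso _ (h Y)) box_rep_sym.
Qed.

End box_distance.

(* The family [metric_open d] is a topology for any [d], so the topology induced
   by [box] can be formed before [box] is known to be a distance. *)
Definition metric_open (R : realType) (T : Type) (d : T -> T -> R) (U : set T) :=
  forall x, U x -> exists2 e : R, 0 < e & forall y, d x y < e -> U y.

Lemma metric_openT (R : realType) (T : Type) (d : T -> T -> R) :
  metric_open d setT.
Proof. by move=> x _; exists 1. Qed.

Lemma metric_openI (R : realType) (T : Type) (d : T -> T -> R) :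
  setI_closed (metric_open d).
Proof.
move=> U V oU oV x [/oU[e e0 eU] /oV[f f0 fV]].
exists (Num.min e f); first by rewrite lt_min e0.
by move=> y; rewrite lt_min => /andP[/eU ? /fV].
Qed.

Lemma metric_open_bigU (R : realType) (T : Type) (d : T -> T -> R) (I : Type)
    (f : I -> set T) : (forall i, metric_open d (f i)) ->
  metric_open d (\bigcup_i f i).
Proof.
move=> of_ x [i _ /of_[e e0 ef]]; exists e => // y /ef ?.
by exists i.
Qed.

HB.instance Definition _ (R : realType) := isOpenTopological.Build (X1 R)
  (@metric_openT _ _ (@box R)) (@metric_openI _ _ (@box R))
  (@metric_open_bigU _ _ (@box R)).

Record topology (T : Type) := Topology {
  topology_open : set (set T);
  topology_openT : topology_open setT;
  topology_openI : setI_closed topology_open;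
  topology_open_bigU : forall (I : Type) (f : I -> set T),
    (forall i, topology_open (f i)) -> topology_open (\bigcup_i f i)
}.

Definition topologized (T : Type) (tau : topology T) : Type := T.

HB.instance Definition _ (T : choiceType) (tau : topology T) :=
  Choice.on (topologized tau).
HB.instance Definition _ (T : choiceType) (tau : topology T) :=
  isOpenTopological.Build (topologized tau) (topology_openT tau)
    (@topology_openI _ tau) (@topology_open_bigU _ tau).

Definition is_metric (R : realType) (T : Type) (d : T -> T -> R) :=
  [/\ forall x y, 0 <= d x y, forall x y, d x y = 0 <-> x = y,
      forall x y, d x y = d y x & forall x y z, d x z <= d x y + d y z].

Definition metrizable (R : realType) (T : topologicalType) :=
  exists2 d : T -> T -> R, is_metric d &
    forall U : set T, open U <-> metric_open d U.

Section pmG.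
Context {R : realType}.

Definition pmG_cvg_rep (X : nat -> pmms R) (X_oo : pmms R) :=
  exists (Y : completeMetricType R) (iota : forall n, X n -> Y)
      (iota_oo : X_oo -> Y),
    [/\ separable Y, forall n, isometry (iota n), isometry iota_oo,
        (fun n => iota n (pmms_pt (X n))) @ \oo --> iota_oo (pmms_pt X_oo) &
        forall f : Y -> R, continuous f ->
          (exists M, forall y, `|f y| <= M) ->
          @bounded_subset R Y (closure [set y | f y != 0]) ->
          (fun n => (\int[pushforward (mms_measure (X n))
              (iota n : borel (X n) -> borel Y)]_y (f y)%:E)%E) @ \oo -->
          (\int[pushforward (mms_measure X_oo)
              (iota_oo : borel X_oo -> borel Y)]_y (f y)%:E)%E].

Definition pmG_cvg (x : nat -> Xpt R) (x_oo : Xpt R) :=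
  exists (X : nat -> pmms R) (X_oo : pmms R),
    [/\ forall n, class_pt (X n) = x n, class_pt X_oo = x_oo &
        pmG_cvg_rep X X_oo].

(* A metrizable topology is determined by its convergent sequences, so at most
   one topology satisfies this; one exists by a theorem of Gigli, Mondino and
   Savare. *)
Definition is_pmG_topology (tau : topology (Xpt R)) :=
  metrizable R (topologized tau) /\
  forall (x : nat -> Xpt R) (x_oo : Xpt R),
    (x : nat -> topologized tau) @ \oo --> (x_oo : topologized tau) <->
    pmG_cvg x x_oo.

End pmG.

Definition homeomorphism (T U : topologicalType) (h : T -> U) :=
  continuous h /\ exists g : U -> T, [/\ continuous g, cancel h g & cancel g h].

Definition topological_embedding (T U : topologicalType) (f : T -> U) :=
  exists2 h : T -> set_type (range f), (forall x, \val (h x) = f x) &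
    homeomorphism h.

Definition Psi {R : realType} (x : Xpt R) :
    ({ptws int -> X1 R} * {ptws int -> R})%type :=
  (fun k => j (cut k x), fun k => log_mass k x).

Lemma PsiE (R : realType) (X : pmms R) :
  Psi (class_pt X) =
  (fun k => class1 (@j_nmms R (cut_pmms X k) (cut_measure_setT X k)),
   fun k => ln (\int[mms_measure X]_x eta k (mdist (pmms_pt X) x))).
Proof.
congr (_, _); apply/funext => k; last exact: log_massE.
by apply: jE; exact: cutE.
Qed.

(* Main.v *)
(* Both topologies are handled through convergent sequences; box balls are
   neighbourhoods because the box distance satisfies the triangle inequality.

   pmG to box.  In the common space take a partition of unity into functions of
   small support.  The integrals of these functions against the measures
   (m^{p,k} + 2 delta_p)/3 converge, so each of these measures and its limit
   split into pieces of almost equal mass carried by the same small sets;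
   parametrizing matching pieces over the same interval gives parameters that are
   close on most of [0, 1).  The triangle inequality for the box distance uses
   the same device to align two parameters of the middle measure.

   Box to pmG.  A good pair of parameters of (m_n^{p_n,k} + 2 delta_{p_n})/3 and
   (m^{p,k} + 2 delta_p)/3 is a relation of small distortion between X_n and X,
   and it matches the base points because these carry mass at least 2/3.  Each
   X_n is glued to X along such a relation, with k = k(n) tending slowly to
   infinity, and all these gluings are glued together along X.  The integrals of
   a Lipschitz function with bounded support then converge, by a bound that
   remains small after multiplication by the normalising constants, and such
   functions determine the convergence. *)
From HB Require Import structures.
From mathcomp Require Import all_boot all_order all_algebra.
From mathcomp Require Import all_classical all_reals all_analysis.
From mathcomp Require Import measurable_realfun lra.
Require Import Defs.
Set Implicit Arguments.
Unset Strict Implicit.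
Unset Printing Implicit Defensive.
Import Order.TTheory GRing.Theory Num.Theory.
Import numFieldNormedType.Exports.
Local Open Scope classical_set_scope.
Local Open Scope ring_scope.

(** The two directions face opposite obstacles. pmG convergence provides one space in which
    everything is compared, but the cut-off of each [X_n] is centred at its own moving base point;
    the Lipschitz bound on [eta] and a wider cut-off absorb the displacement. Box convergence is
    given for each [k] separately and without a common space, while pmG convergence asks for one
    embedding per [n] that serves all test functions. A relation obtained at scale [k] only controls
    integrals of functions supported where the cut-off is 1, so one scale is selected for each [n]
    by a diagonal argument, and every bounded support is eventually inside the controlled ball.
    Undoing the normalisation multiplies the error by the mass of the limit cut-off at that scale,
    so the tolerance at scale [k] is fixed beforehand against this mass.

    Parameters exist because a Polish space can be coded in the line by a Borel map with a Borel
    left inverse, and on the line quantile functions do the work. *)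

(** * Parameters of finite measures *)

(* The measure structure of [pushforward m f] depends on the proof [mf], which
   cannot be inferred from [pushforward m f]. *)
Definition push_measure d d' (T1 : measurableType d) (T2 : measurableType d')
    (R : realFieldType) (m : {measure set T1 -> \bar R}) (f : T1 -> T2)
    (mf : measurable_fun setT f) : {measure set T2 -> \bar R} :=
  measure_function_pushforward__canonical__measure_function_Measure m mf.

(** Both the starting point [s] and the mass [c] are free, because pieces of a measure are later
    parametrized over consecutive intervals and the maps are concatenated. *)
Definition parametrizable (R : realType) d (T : measurableType d) :=
  forall (m : {measure set T -> \bar R}) (s c : R), m setT = c%:E ->
  exists2 q : measurableTypeR R -> T, measurable_fun setT q &
    forall B, measurable B -> m B = lebesgue_measure (`[s, (s + c)[ `&` q @^-1` B).

(** * Quantile functions of finite measures on the line *)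

Section quantile.
Context {R : realType}.
Notation leb := (@lebesgue_measure R).

Lemma lebesgue_itvco_oo (a b : R) (A : set (measurableTypeR R)) : measurable A ->
  leb (`[a, b[ `&` A) = leb (`]a, b[ `&` A).
Proof.
move=> mA; apply/eqP; rewrite eq_le; apply/andP; split; last first.
  apply: le_measure; rewrite ?inE; [exact: measurableI..|].
  by apply: setSI => x /=; rewrite !in_itv/= => /andP[/ltW -> ->].
rewrite -[leRHS]adde0 -[X in (_ + X)%E](lebesgue_measure_set1 a).
apply: (le_trans _ (measureU2 _ _ _)) => //; last exact: measurableI.
apply: le_measure; rewrite ?inE.

- exact: measurableI.
- by apply: measurableU => //; exact: measurableI.
- move=> x []; rewrite /= !in_itv/= le_eqVlt => /andP[/orP[/eqP<-|ax] xb] Ax.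
    by right.
  by left; split => //; apply/andP.
Qed.

Variables (m : {measure set (measurableTypeR R) -> \bar R}) (s c : R).
Hypothesis mT : m setT = c%:E.

Let c0 : 0 <= c. Proof. by rewrite -lee_fin -mT. Qed.

Let F (x : R) : R := fine (m `]-oo, x]%classic).

Let mle (B : set (measurableTypeR R)) : measurable B -> (m B <= c%:E)%E.
Proof. by move=> mB; rewrite -mT; apply: le_measure; rewrite ?inE. Qed.

Let FE x : m `]-oo, x]%classic = (F x)%:E.
Proof. by rewrite /F fineK// ge0_fin_numE// (le_lt_trans (mle _)) ?ltry. Qed.

Let F_ge0 x : 0 <= F x. Proof. by rewrite -lee_fin -FE. Qed.
Let F_lec x : F x <= c. Proof. by rewrite -lee_fin -FE mle. Qed.

Let F_nd x y : x <= y -> F x <= F y.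
Proof.
move=> xy; rewrite -lee_fin -!FE; apply: le_measure; rewrite ?inE//.
by move=> z /=; rewrite !in_itv/= => /le_trans; exact.
Qed.

Let natP (x : R) : exists n : nat, x < n%:R.
Proof. by exists (Num.truncn x).+1; exact: Num.Theory.truncnS_gt. Qed.

Let F_small e : 0 < e -> exists x, F x < e.
Proof.
move=> e0; pose A n : set (measurableTypeR R) := `]-oo, (- n%:R)]%classic.
have mA n : measurable (A n) by exact: measurable_itv.
have : (m \o A) x @[x --> \oo] --> m (\bigcap_n A n).
  apply: nonincreasing_cvg_mu => //.
  - by rewrite (le_lt_trans (mle (mA _))) ?ltry.
  - exact: bigcapT_measurable.
  - move=> i j ij; apply/subsetPset => x; rewrite /A /= !in_itv/= => /le_trans; apply.
    by rewrite lerN2 ler_nat.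
have -> : \bigcap_n A n = set0.
  apply/seteqP; split => // x Ax; have [n xn] := natP (- x).
  have := Ax n Logic.I; rewrite /A/= in_itv/= lerNr => h.
  by have := le_lt_trans h xn; rewrite ltxx.
rewrite measure0 => h.
have {h} : F (- n%:R) @[n --> \oo] --> (0 : R).
  apply: fine_cvg => /=; exact: h.
move=> /cvgrPdist_lt /(_ _ e0)[n _ /(_ n (leqnn n))] /=.
by rewrite sub0r normrN ger0_norm// => ?; exists (- n%:R).
Qed.

Let F_large e : 0 < e -> exists x, c - e < F x.
Proof.
move=> e0; pose A n : set (measurableTypeR R) := `]-oo, n%:R]%classic.
have mA n : measurable (A n) by exact: measurable_itv.
have : (m \o A) x @[x --> \oo] --> m (\bigcup_n A n).
  apply: nondecreasing_cvg_mu => //.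
  - exact: bigcupT_measurable.
  - move=> i j ij; apply/subsetPset => x; rewrite /A /= !in_itv/= => /le_trans; apply.
    by rewrite ler_nat.
have -> : \bigcup_n A n = setT.
  apply/seteqP; split => // x _; have [n xn] := natP x.
  by exists n => //; rewrite /A/= in_itv/= ltW.
rewrite mT => h.
have {h} : F n%:R @[n --> \oo] --> c.
  apply: fine_cvg => /=; exact: h.
move=> /cvgrPdist_lt /(_ _ e0)[n _ /(_ n (leqnn n))] /=.
rewrite ger0_norm ?subr_ge0// => ?; exists n%:R.
by rewrite ltrBlDr addrC -ltrBlDr.
Qed.

Let F_rcont x y : (forall e, 0 < e -> y <= F (x + e)) -> y <= F x.
Proof.
move=> h; pose A n : set (measurableTypeR R) := `]-oo, x + n.+1%:R^-1]%classic.
have mA n : measurable (A n) by exact: measurable_itv.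
have : (m \o A) x @[x --> \oo] --> m (\bigcap_n A n).
  apply: nonincreasing_cvg_mu => //.
  - by rewrite (le_lt_trans (mle (mA _))) ?ltry.
  - exact: bigcapT_measurable.
  - move=> i j ij; apply/subsetPset => z; rewrite /A /= !in_itv/= => /le_trans; apply.
    by rewrite lerD2l lef_pV2 ?posrE// ler_nat.
have -> : \bigcap_n A n = `]-oo, x]%classic.
  apply/seteqP; split => z /=.
    move=> Az; rewrite in_itv/=; apply/ler_addgt0Pr => e e0.
    have [n ne] := natP e^-1; have := Az n Logic.I.
    rewrite /A/= in_itv/= => /le_trans; apply; rewrite lerD2l.
    rewrite -[leRHS]invrK lef_pV2 ?posrE ?invr_gt0//.
    by rewrite ltW// (lt_le_trans ne)// ler_nat.
  by rewrite /A => zx n _ /=; move: zx; rewrite !in_itv/= => /le_trans; apply; rewrite lerDl.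
rewrite FE => h1.
have {h1} : F (x + n.+1%:R^-1) @[n --> \oo] --> F x.
  apply: fine_cvg => /=; exact: h1.
move=> h1; have := cvgP _ h1 => c1; rewrite -(cvg_lim _ h1)//.
by apply: limr_ge => //; apply: nearW => n; apply: h.
Qed.

Let Q t : R := inf [set x | t <= s + F x].

(** The quantile and distribution functions form a Galois connection because right continuity makes
    the infimum attained. The inequalities on [t] are strict: at [t = s] the set is the whole line,
    at [t = s + c] it may be empty. *)
Let Q_le t x : s < t < s + c -> (Q t <= x) = (t <= s + F x).
Proof.
move=> /andP[st tc]; have ts0 : 0 < t - s by rewrite subr_gt0.
have [a Fa] := F_small ts0.
have /F_large[b Fb] : 0 < s + c - t by rewrite subr_gt0.
have ne : [set x | t <= s + F x] !=set0 by exists b => /=; lra.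
have lb : lbound [set x | t <= s + F x] a.
  by move=> y /= ty; rewrite leNgt; apply/negP => /ltW /F_nd ?; lra.
apply/idP/idP => [Qx|tx]; last by apply: ge_inf => //; exists a.
rewrite -lerBlDl; apply: F_rcont => e e0.
have : Q t < x + e by lra.
move=> /(inf_lt ne)[].
by move=> y /= ty /ltW /F_nd ?; lra.
Qed.

Lemma quantile_measure : exists2 q : measurableTypeR R -> measurableTypeR R,
  measurable_fun setT q &
  forall B, measurable B -> m B = leb (`[s, (s + c)[ `&` q @^-1` B).
Proof.
pose I : set (measurableTypeR R) := `]s, (s + c)[%classic.
have mI : measurable I by exact: measurable_itv.
pose q t := if t \in `]s, (s + c)[ then Q t else 0.
(* Off the interval [q] is 0, so the complement belongs to this preimage exactly when [x < 0]. *)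
have qE x : q @^-1` `]x, +oo[ =
    (I `&` `]s + F x, +oo[) `|` (~` I `&` (if x < 0 then setT else set0)).
  rewrite /I; apply/seteqP; split => t /=.
    rewrite /q; have [ti|ti] := boolP (t \in _).
      rewrite in_itv/= andbT ltNge Q_le// -ltNge => ?; left; split => //.
      by rewrite in_itv/= andbT.
    by rewrite in_itv/= andbT => x0; right; split; [exact/negP|rewrite x0].
  case=> [[ti]|[/negP ti]]; rewrite /q ?ti ?(negbTE ti).
    by rewrite !in_itv/= !andbT => h; rewrite ltNge Q_le// -ltNge.
  by rewrite in_itv/= andbT; case: ifP.
have mq : measurable_fun setT (q : measurableTypeR R -> measurableTypeR R).
  apply: (measurability _ (RGenOInfty.measurableE R)).
  move=> _ [_ [x ->] <-]; rewrite setTI qE; apply: measurableU.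
    exact: measurableI.
  by apply: measurableI; [exact: measurableC|case: ifP].
exists q => //.
have mJ : measurable (`[s, (s + c)[%classic : set (measurableTypeR R)) by exact: measurable_itv.
pose m2 := push_measure (mrestr leb mJ) mq.
suff E B : measurable B -> m B = m2 B.
  by move=> B mB; rewrite E//= /m2/= /pushforward/= /mrestr setIC.
have m2E x : m2 `]x, +oo[%classic = (c - F x)%:E.
  rewrite /m2/= /pushforward/= /mrestr setIC lebesgue_itvco_oo; last first.
    by rewrite -[X in measurable X]setTI; exact: (mq measurableT).
  have -> : `]s, (s + c)[ `&` q @^-1` `]x, +oo[ = `](s + F x), (s + c)[%classic.
    rewrite qE /I; apply/seteqP; split => t /=.
      by case=> ti [[_]|[]//]; move: ti; rewrite !in_itv/= => /andP[_ ->] /andP[->].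
    rewrite !in_itv/= => /andP[t1 t2]; have st : s < t by rewrite (le_lt_trans _ t1)// lerDl.
    by rewrite st t2; split=> //; left; rewrite ?t1.
  rewrite lebesgue_measure_itv/= lte_fin ltrD2l.
  case: ltP => [_|cF]; first by rewrite -EFinB; congr _%:E; lra.
  by congr _%:E; have := F_lec x; lra.
apply: (@measure_unique _ _ (measurableTypeR R) (@RGenOInfty.G R)
  (fun n => `](- n%:R), +oo[%classic)) => //.
- exact: RGenOInfty.measurableE.
- move=> _ _ [x ->] [y ->]; exists (Num.max x y).
  by apply/seteqP; split => z /=; rewrite !in_itv/= !andbT gt_max => /andP.
- by move=> n; exists (- n%:R).
- apply/seteqP; split=> // x _; have [n xn] := natP (- x); exists n => //=.
  by rewrite in_itv/= andbT ltrNl.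
- move=> _ [x ->]; rewrite m2E.
  rewrite -setCitvl -setTD measureD//= ?setTI ?mT ?FE ?ltry//.
- by move=> n; rewrite (le_lt_trans (mle _)) ?ltry.
Qed.

End quantile.

Lemma parametrizable_real (R : realType) :
  parametrizable R (measurableTypeR R : measurableType _).
Proof. by move=> m s c mT; exact: quantile_measure. Qed.

Lemma measurable_if_set_in d d' (T : measurableType d) (T' : measurableType d')
    (A : set T) (f g : T -> T') : measurable A ->
  measurable_fun A f -> measurable_fun setT g ->
  measurable_fun setT (fun t => if `[< A t >] then f t else g t).
Proof.
move=> mA mf mg _ Y mY; rewrite setTI.
have -> : (fun t => if `[< A t >] then f t else g t) @^-1` Y =
    (A `&` f @^-1` Y) `|` (~` A `&` g @^-1` Y).
  apply/seteqP; split => t /=; case: asboolP => // At; try by [left|right].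
    by case=> -[].
  by case=> -[].
apply: measurableU; first exact: mf.
apply: measurableI; first exact: measurableC.
by rewrite -[X in measurable X]setTI; exact: mg.
Qed.

Lemma measurable_if_set d d' (T : measurableType d) (T' : measurableType d')
    (A : set T) (f g : T -> T') : measurable A ->
  measurable_fun setT f -> measurable_fun setT g ->
  measurable_fun setT (fun t => if `[< A t >] then f t else g t).
Proof.
by move=> mA mf; apply: measurable_if_set_in => //; exact: measurable_funTS.
Qed.

Lemma measurable_preimage d d' (T : measurableType d) (T' : measurableType d')
    (f : T -> T') (B : set T') : measurable_fun setT f -> measurable B ->
  measurable (f @^-1` B).
Proof. by move=> mf mB; rewrite -[X in measurable X]setTI; exact: mf. Qed.

Lemma measurable_le_set d (T : measurableType d) (R : realType) (f g : T -> R) :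
  measurable_fun setT f -> measurable_fun setT g ->
  measurable [set t | f t <= g t].
Proof.
by move=> mf mg; rewrite -[X in measurable X]setTI; exact: measurable_fun_le.
Qed.

Lemma measurable_lt_set d (T : measurableType d) (R : realType) (f g : T -> R) :
  measurable_fun setT f -> measurable_fun setT g ->
  measurable [set t | f t < g t].
Proof.
move=> mf mg; have -> : [set t | f t < g t] = ~` [set t | g t <= f t].
  by apply/seteqP; split => t /=; rewrite ltNge => /negP.
by apply: measurableC; exact: measurable_le_set.
Qed.

(* The sets [B m] are recovered from the base-3 digits of a real-valued map. *)
Section digit_coding.
Context d (T : measurableType d) (R : realType) (B : nat -> set T).
Hypothesis mB : forall n, measurable (B n).

Let wt m : R := 3^-1 ^+ m.+1.
Let wt_gt0 m : 0 < wt m. Proof. by rewrite exprn_gt0// invr_gt0. Qed.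
Let wtS m : wt m = 3 * wt m.+1.
Proof. by rewrite /wt [in RHS]exprS mulrA divff ?mul1r// pnatr_eq0. Qed.

Let b m y : R := if `[< B m y >] then wt m else 0.
Let S n y : R := \sum_(j < n) b j y.

Let b_ge0 m y : 0 <= b m y. Proof. by rewrite /b; case: ifP => // _; exact: ltW. Qed.
Let b_le m y : b m y <= wt m. Proof. by rewrite /b; case: ifP => // _; exact: ltW. Qed.

Let SS n y : S n.+1 y = S n y + b n y. Proof. by rewrite /S big_ord_recr. Qed.

Let S_nd y : {homo S^~ y : n m / (n <= m)%N >-> n <= m}.
Proof.
move=> n m /subnKC <-; elim: (m - n)%N => [|k IH]; first by rewrite addn0.
by rewrite addnS SS (le_trans IH)// lerDl.
Qed.

(** [wt n * 3 / 2] is the geometric tail of the weights from [n] on, so a partial sum plus the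
    largest possible remainder can only decrease. *)
Let S_ub m k y : S (m + k)%N y + wt (m + k)%N * 3 / 2 <= S m y + wt m * 3 / 2.
Proof.
elim: k => [|k IH]; first by rewrite addn0.
rewrite addnS SS; apply: le_trans IH.
have := b_le (m + k)%N y; have := wtS (m + k)%N; lra.
Qed.

Let S_ub' m n y : S n y <= S m y + wt m * 3 / 2.
Proof.
have w0 := wt_gt0; have [mn|nm] := leqP m n.
  apply: le_trans (S_ub m (n - m)%N y); rewrite subnKC// lerDl.
  by have := w0 n; lra.
by apply: (le_trans (S_nd y (ltnW nm))); rewrite lerDl; have := w0 m; lra.
Qed.

Let S_cvg y : cvgn (S^~ y).
Proof.
apply: nondecreasing_is_cvgn; first exact: S_nd.
by exists (S 0%N y + wt 0%N * 3 / 2) => _ [n _ <-]; exact: S_ub'.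
Qed.

Let Phi y : R := limn (S^~ y).

Let mPhi : measurable_fun setT (Phi : T -> measurableTypeR R).
Proof.
apply: (@measurable_fun_cvg _ _ _ _ (fun n => S n)) => [n|y _]; last exact: S_cvg.
apply: measurable_sum => i; apply: measurable_if_set => //.
Qed.

Fixpoint digit_sum m (t : R) : R :=
  if m is n.+1 then
    digit_sum n t + (if `[< wt n <= t - digit_sum n t >] then wt n else 0)
  else 0.

Let mdigit_sum m : measurable_fun setT (digit_sum m : measurableTypeR R -> R).
Proof.
elim: m => [|m IH] /=; first exact: measurable_cst.
apply: measurable_funD => //; apply: measurable_if_set => //.
apply: measurable_le_set => //.
exact: measurable_funB.
Qed.

(** In base 3 all digits after position [m] amount to at most half of [wt m], so comparing the
    remainder with [wt m] decides digit [m]; in base 2 the tail could equal a full digit. *)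
Let PhiP m y : S m y + b m y <= Phi y <= S m y + b m y + wt m / 2.
Proof.
rewrite -SS; apply/andP; split; first exact: (nondecreasing_cvgn_le (@S_nd y)).
apply: limr_le => //; apply: nearW => n; apply: (le_trans (S_ub' m.+1 n y)).
by rewrite lerD2l; have := wtS m; lra.
Qed.

Let digitE m y : (wt m <= Phi y - S m y) <-> B m y.
Proof.
have /andP[] := PhiP m y; have := wt_gt0 m; rewrite /b.
by case: asboolP => // h; split=> //; [lra|move=> ?; exfalso; lra].
Qed.

Let digit_sumE m y : digit_sum m (Phi y) = S m y.
Proof.
elim: m => [|m IH] /=; first by rewrite /S big_ord0.
by rewrite IH SS /b (asbool_equiv_eq (digitE m y)).
Qed.

Lemma digit_coding : exists2 phi : T -> measurableTypeR R, measurable_fun setT phi &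
  exists2 E : nat -> set (measurableTypeR R), forall m, measurable (E m) &
    forall m y, E m (phi y) <-> B m y.
Proof.
exists Phi => //; exists (fun m => [set t | wt m <= t - digit_sum m t]).
  move=> m; apply: measurable_le_set => //.
  exact: measurable_funB.
by move=> m y /=; rewrite digit_sumE; exact: digitE.
Qed.

End digit_coding.

(** * Convergence and measurability through distances *)

Section metric_facts.
Context {R : realType}.
Implicit Types X : completeMetricType R.

Lemma ler_dist_mdist (X : metricType R) (y a b : X) :
  `|mdist y a - mdist y b| <= mdist a b.
Proof.
have := metric_triangle y a b; have := metric_triangle y b a.
rewrite (metric_sym b a) ler_distl => h1 h2; apply/andP; split; lra.
Qed.

Lemma mdist_cvgP (X : metricType R) (a : nat -> X) (x : X) :
  a @ \oo --> x <->
  forall e : R, 0 < e -> exists N, forall n, (N <= n)%N -> mdist x (a n) < e.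
Proof.
split=> [/metricType_numDomainType.cvgrPdist_lt h e /h[N _ Nh]|h].
  by exists N => n /Nh.
by apply/metricType_numDomainType.cvgrPdist_lt => e /h[N Nh]; exists N.
Qed.

Lemma continuous_mdist (X : metricType R) (y : X) : continuous (mdist y : X -> R).
Proof.
move=> x; apply/cvgrPdist_lt => e e0; near=> z.
apply: (le_lt_trans (ler_dist_mdist y x z)).
by near: z; apply: metricType_numDomainType.cvgr_dist_lt e0.
Unshelve. all: by end_near. Qed.

Lemma natSinv_lt (e : R) : 0 < e -> exists n : nat, n.+1%:R^-1 < e.
Proof.
move=> e0; have := near_infty_natSinv_lt (PosNum e0).
by move=> [n _ /(_ n (leqnn n))] /= ?; exists n.
Qed.

Lemma mdist_cauchy_cvg X (a : nat -> X) (C : R) :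
  (forall k l, (k <= l)%N -> mdist (a k) (a l) <= C / k.+1%:R) ->
  exists x : X, a @ \oo --> x.
Proof.
move=> h; suff : cvg (a @ \oo) by move=> /cvg_ex[x]; exists x.
apply: cauchy_cvg; apply: cauchy_exP => e e0.
have C0 : 0 < `|C| + 1 by rewrite ltr_wpDl.
have [k ke] := natSinv_lt (divr_gt0 e0 C0).
exists (a k); exists k => // l /= kl; rewrite ballEmdist /=.
apply: (le_lt_trans (h _ _ kl)); rewrite mulrC.
rewrite ltr_pdivlMr// in ke; apply: le_lt_trans ke.
by rewrite ler_pM2l// (le_trans (ler_norm C))// lerDl.
Qed.

Lemma dense_mdist X (u : nat -> X) (x : X) (e : R) : dense (range u) -> 0 < e ->
  exists i, mdist (u i) x < e.
Proof.
move=> du e0; have [|y [/= xy [i _ uy]]] := du (ball x e) _ (open_mball x e).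
  by exists x; exact: ballxx.
by exists i; move: xy; rewrite ballEmdist /= uy metric_sym.
Qed.

(** An open set is a countable union of balls centred in the dense sequence with radii [1/(k+1)], so
    the distances to the dense points decide measurability. *)
Lemma measurable_mdistP d (T : measurableType d) X (u : nat -> X) (h : T -> X) :
  dense (range u) ->
  (forall i, measurable_fun setT ((fun t => mdist (u i) (h t)) : T -> R)) ->
  measurable_fun setT (h : T -> borel X).
Proof.
move=> du mh; apply: (@measurability _ _ T (borel X) _ _ (@open X)) => //.
move=> _ [U oU <-]; rewrite setTI.
have -> : h @^-1` U = \bigcup_i \bigcup_k
    (if `[< ball (u i) (k.+1%:R^-1 : R) `<=` U >]
     then [set t | mdist (u i) (h t) < k.+1%:R^-1] else set0).
  apply/seteqP; split => t /=; last first.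
    move=> [i _ [k _]]; case: asboolP => // iU /= ht; apply: iU.
    by rewrite ballEmdist.
  move=> Ut; have : nbhs (h t) U by exact: open_nbhs_nbhs.
  rewrite -nbhs_ballE => -[e /= e0 eU].
  have [k ke] : exists k : nat, k.+1%:R^-1 < e / 2 by apply: natSinv_lt; lra.
  have k0 : 0 < k.+1%:R^-1 :> R by rewrite invr_gt0.
  have [i ik] := dense_mdist (h t) du k0.
  exists i => //; exists k => //; case: asboolP => //= nU; exfalso; apply: nU => z.
  rewrite ballEmdist /= => iz; apply: eU; rewrite ballEmdist /=.
  apply: (le_lt_trans (metric_triangle (h t) (u i) z)).
  by rewrite (metric_sym (h t)) [e]splitr ltrD// (lt_trans _ ke).
apply: bigcupT_measurable => i; apply: bigcupT_measurable => k.
by case: ifP => // _; exact: measurable_lt_set.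
Qed.

End metric_facts.

(* The points of a dense sequence nearest to [y] are read off the digits of a
   code of [y], and they converge to [y]. *)
Section polish.
Context {R : realType} (X : completeMetricType R) (u : nat -> X).
Hypothesis du : dense (range u).

Let B (n : nat) : set X :=
  if @unpickle (nat * nat)%type n is Some ik then ball (u ik.1) (ik.2.+1%:R^-1 : R) else set0.

Variables (phi : borel X -> measurableTypeR R) (E : nat -> set (measurableTypeR R)).
Hypotheses (mE : forall m, measurable (E m)) (EP : forall m y, E m (phi y) <-> B m y).

(** On the code of a point, [i] is the least index with [u i] within [1/(k+1)] of it; minimality
    makes the sets disjoint in [i]. They are subsets of the line because the selection has to be
    Borel in the code. *)
Let A (k i : nat) : set (measurableTypeR R) :=
  E (pickle (i, k)) `&` \bigcap_(j in [set j | (j < i)%N]) ~` E (pickle (j, k)).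

Let mA k i : measurable (A k i).
Proof.
apply: measurableI => //; apply: bigcap_measurableType => j _.
exact: measurableC.
Qed.

Let sel k t : nat := xget 0%N [set i | A k i t].

Let sel_uniq k t i : A k i t -> sel k t = i.
Proof.
move=> Ai; apply: xget_unique => // j [Ej Aj]; have [Ei {}Ai] := Ai.
by have [ji|ij|//] := ltngtP j i; [have := Ai _ ji|have := Aj _ ij].
Qed.

Let msel k i : measurable (sel k @^-1` [set i]).
Proof.
(* The second part accounts for the default index 0, taken where no index is selected. *)
have -> : sel k @^-1` [set i] = A k i `|`
    ((\bigcap_j ~` A k j) `&` (if i == 0%N then setT else set0)).
  apply/seteqP; split => t /=; last first.
    case=> [/sel_uniq//|[nA]]; case: eqP => // -> _; apply: xgetPN => j.
    exact: nA.
  have [[j Aj] selE|nA selE] := pselect (exists j, A k j t).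
    by left; rewrite -selE (sel_uniq Aj).
  right; split; first by move=> j _ Aj; apply: nA; exists j.
  by case: eqP => // i0; apply: i0; rewrite -selE /sel xgetPN// => j Aj; apply: nA; exists j.
apply: measurableU => //; apply: measurableI; last by case: ifP.
by apply: bigcapT_measurable => j; exact: measurableC.
Qed.

Let z k t : X := u (sel k t).

Let mdist_z k l : measurable_fun setT ((fun t => mdist (z k t) (z l t)) : measurableTypeR R -> R).
Proof.
move=> _ Y mY; rewrite setTI.
have -> : (fun t => mdist (z k t) (z l t)) @^-1` Y = \bigcup_i \bigcup_j
    (if `[< Y (mdist (u i) (u j)) >]
     then sel k @^-1` [set i] `&` sel l @^-1` [set j] else set0).
  apply/seteqP; split => t /=.
    by move=> Yt; exists (sel k t) => //; exists (sel l t) => //; case: asboolP.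
  by move=> [i _ [j _]]; case: asboolP => // ? [ki lj]; rewrite /z ki lj.
apply: bigcupT_measurable => i; apply: bigcupT_measurable => j.
by case: ifP => // _; apply: measurableI.
Qed.

Let mdist_uz i k : measurable_fun setT ((fun t => mdist (u i) (z k t)) : measurableTypeR R -> R).
Proof.
move=> _ Y mY; rewrite setTI.
have -> : (fun t => mdist (u i) (z k t)) @^-1` Y = \bigcup_j
    (if `[< Y (mdist (u i) (u j)) >] then sel k @^-1` [set j] else set0).
  apply/seteqP; split => t /=.
    by move=> Yt; exists (sel k t) => //; case: asboolP.
  by move=> [j _]; case: asboolP => // ? kj; rewrite /z kj.
by apply: bigcupT_measurable => i'; case: ifP.
Qed.

(** A real number that codes no point may select a divergent sequence, so the limit is taken only on
    this Borel set. The rate [2/(k+1)] is what the triangle inequality gives on codes of points. *)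
Let G : set (measurableTypeR R) := \bigcap_k \bigcap_l
  (if (k <= l)%N then [set t | mdist (z k t) (z l t) <= 2 / k.+1%:R] else setT).

Let mG : measurable G.
Proof.
apply: bigcapT_measurable => k; apply: bigcapT_measurable => l; case: ifP => // _.
by apply: measurable_le_set.
Qed.

Let G_cvg t : G t -> exists x : X, z ^~ t @ \oo --> x.
Proof.
move=> Gt; apply: (@mdist_cauchy_cvg _ _ _ 2) => k l kl.
by have := Gt k Logic.I l Logic.I; rewrite kl.
Qed.

Let g t : X := if `[< G t >] then lim (z ^~ t @ \oo) else point.

Let mg : measurable_fun setT (g : measurableTypeR R -> borel X).
Proof.
apply: (measurable_mdistP du) => i.
apply: (@measurable_fun_cvg _ _ _ _ (fun k t =>
    if `[< G t >] then mdist (u i) (z k t) else mdist (u i) point)).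
  by move=> k; apply: measurable_if_set.
move=> t _; rewrite /g; case: asboolP => [Gt|_]; last exact: cvg_cst.
have [x zx] := G_cvg Gt; rewrite (cvg_lim _ zx); last exact: metric_hausdorff.
exact: (continuous_cvg _ (@continuous_mdist _ _ (u i) x) zx).
Qed.

Let z_near k y : mdist (z k (phi y)) y < k.+1%:R^-1.
Proof.
have k0 : 0 < k.+1%:R^-1 :> R by rewrite invr_gt0.
have EE i : E (pickle (i, k)) (phi y) <-> mdist (u i) y < k.+1%:R^-1.
  by rewrite EP /B pickleK /= ballEmdist.
have ex : exists i, `[< mdist (u i) y < k.+1%:R^-1 >].
  by have [i ?] := dense_mdist y du k0; exists i; apply/asboolP.
have [i /asboolP Ei imin] := ex_minnP ex.
suff Ai : A k i (phi y) by rewrite /z (sel_uniq Ai).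
split; first exact/EE.
by move=> j /= ji /EE Ej; have := imin j; rewrite leqNgt ji => /(_ (asboolT Ej)).
Qed.

Let phiK y : g (phi y) = y.
Proof.
have zy k l : (k <= l)%N -> mdist y (z l (phi y)) < k.+1%:R^-1.
  move=> kl; rewrite metric_sym (lt_le_trans (z_near l y))//.
  by rewrite lef_pV2 ?posrE// ler_nat.
rewrite /g; case: asboolP => [_|nG].
  apply: cvg_lim; first exact: metric_hausdorff.
  apply/mdist_cvgP => e /natSinv_lt[k ke]; exists k => n kn.
  exact: lt_trans (zy _ _ kn) ke.
exfalso; apply: nG => k _ l _; case: ifP => // kl /=.
rewrite (le_trans (metric_triangle _ y _))// mulrDl mul1r lerD//.
  by rewrite metric_sym ltW// zy.
by rewrite ltW// zy.
Qed.

Lemma code_left_inverse : exists2 g : measurableTypeR R -> borel X,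
  measurable_fun setT g & cancel phi g.
Proof. by exists g. Qed.

End polish.

(** The measure is pushed to the line by the code, parametrized there by a quantile function, and
    brought back by the left inverse. *)
Lemma parametrizable_polish (R : realType) (X : completeMetricType R) :
  separable X -> parametrizable R (borel X).
Proof.
move=> /separable_seq[u du] m s c mT.
pose B (n : nat) : set X :=
  if @unpickle (nat * nat)%type n is Some ik then ball (u ik.1) (ik.2.+1%:R^-1 : R) else set0.
have mB n : measurable (B n : set (borel X)).
  by rewrite /B; case: unpickle => // ik; apply: borel_open; exact: open_mball.
have [phi mphi [E mE EP]] := @digit_coding _ (borel X) R B mB.
have [g mg phiK] := code_left_inverse du mE EP.
have [|q mq qE] := @parametrizable_real R (push_measure m mphi) s c.
  by rewrite /= /pushforward preimage_setT.
exists (g \o q) => [|C mC]; first exact: measurableT_comp.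
rewrite comp_preimage -qE; last exact: measurable_preimage.
rewrite /= /pushforward -comp_preimage (_ : g \o phi = id)//.
by apply/funext => y /=; rewrite phiK.
Qed.

(** * Measures given by a density *)

Section density.
Context d (T : measurableType d) (R : realType) (m : {measure set T -> \bar R}).
Variables (w : T -> R) (mw : measurable_fun setT w) (w0 : forall x, 0 <= w x).

(** The proofs are arguments so that the measure structure can be inferred from the term. *)
Definition density (mw : measurable_fun setT w) (w0 : forall x, 0 <= w x)
  (B : set T) : \bar R := (\int[m]_(x in B) (w x)%:E)%E.

Let density0 : density mw w0 set0 = 0%E.
Proof. exact: integral_set0. Qed.
Let density_ge0 B : (0 <= density mw w0 B)%E.
Proof. by apply: integral_ge0 => x _; rewrite lee_fin. Qed.
Let density_sigma_additive : semi_sigma_additive (density mw w0).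
Proof.
apply: semi_sigma_additive_nng_induced; first exact/measurable_EFinP.
by move=> x; rewrite lee_fin.
Qed.
HB.instance Definition _ := isMeasure.Build _ _ _ (density mw w0)
  density0 density_ge0 density_sigma_additive.
End density.

Section integral_density.
Context d (T : measurableType d) (R : realType).
Import HBNNSimple.

Lemma ge0_integral_density (m n : {measure set T -> \bar R}) (w f : T -> R) :
  measurable_fun setT w -> (forall x, 0 <= w x) ->
  (forall B, measurable B -> n B = (\int[m]_(x in B) (w x)%:E)%E) ->
  measurable_fun setT f -> (forall x, 0 <= f x) ->
  (\int[n]_x (f x)%:E = \int[m]_x (f x * w x)%:E)%E.
Proof.
move=> mw w0 nE mf f0.
have mfE : measurable_fun setT (EFin \o f) by exact/measurable_EFinP.
pose h := nnsfun_approx measurableT mfE.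
have hf x : (EFin \o h k) x @[k --> \oo] --> (f x)%:E.
  by apply: cvg_nnsfun_approx => // y _; rewrite lee_fin.
have -> : (\int[n]_x (f x)%:E = lim (\int[n]_x (EFin \o h k) x @[k --> \oo]))%E.
  under eq_integral => x _ do rewrite -(cvg_lim _ (hf x))//.
  apply: monotone_convergence => //.
  - by move=> k; apply/measurable_EFinP; exact/measurable_funP.
  - by move=> k x _ /=; rewrite lee_fin.
  - by move=> x _ a b ab; rewrite lee_fin; exact/lefP/nd_nnsfun_approx.
have hfw x : ((EFin \o h k) x * (w x)%:E)%E @[k --> \oo] --> (f x * w x)%:E.
  by rewrite EFinM; apply: cvgeZr.
have -> : (\int[m]_x (f x * w x)%:E =
    lim (\int[m]_x ((EFin \o h k) x * (w x)%:E) @[k --> \oo]))%E.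
  under eq_integral => x _ do rewrite -(cvg_lim _ (hfw x))//.
  apply: monotone_convergence => //.
  - move=> k; apply/emeasurable_funM; apply/measurable_EFinP => //.
  - by move=> k x _ /=; rewrite mule_ge0 ?lee_fin.
  - by move=> x _ a b ab /=; rewrite lee_wpmul2r ?lee_fin//; exact/lefP/nd_nnsfun_approx.
congr (lim (_ @ \oo)); apply/funext => k.
transitivity (\int[n]_x
   (\sum_(y \in range (h k)) (y * \1_(h k @^-1` [set y]) x)%:E))%E.
  by apply: eq_integral => t _; rewrite /= fimfunE -fsumEFin.
have indich r : measurable_fun setT (fun x => (r * \1_(h k @^-1` [set r]) x)%:E).
  by apply/measurable_EFinP; exact: measurable_funM.
rewrite ge0_integral_fsum//; last by move=> r x _; exact: nnfun_muleindic_ge0.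
transitivity (\int[m]_x (\sum_(y \in range (h k))
    (y * \1_(h k @^-1` [set y]) x)%:E * (w x)%:E))%E; last first.
  apply: eq_integral => x _.
  rewrite -ge0_mule_fsuml => [|y]; last exact: nnfun_muleindic_ge0.
  by rewrite fsumEFin// -(fimfunE _ x).
rewrite ge0_integral_fsum//; last 2 first.
- move=> y; apply: emeasurable_funM => //; exact/measurable_EFinP.
- move=> y x _; apply: mule_ge0; last by rewrite lee_fin.
  exact: nnfun_muleindic_ge0.
apply: eq_fsbigr => r rh.
under eq_integral do rewrite EFinM.
rewrite integralZl_indic_nnsfun//.
under [RHS]eq_integral do rewrite EFinM -muleA.
have mh : measurable (h k @^-1` [set r]) by exact: measurable_preimage.
rewrite ge0_integralZl//.
- rewrite integral_indic// setIT nE//; congr (_ * _)%E.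
  rewrite integral_mkcond; apply: eq_integral => x _.
  by rewrite patchE indicE; case: ifP => _; rewrite ?mul1e ?mul0e.
- apply: emeasurable_funM; first exact/measurable_EFinP/measurable_indic.
  exact/measurable_EFinP.
- by move=> t _; rewrite mule_ge0 ?lee_fin.
- by move: rh; rewrite inE => -[t _ <-]; rewrite lee_fin.
Qed.
End integral_density.

(** * Couplings along pieces of equal mass *)

Section concatenation.
Context {R : realType}.
Notation leb := (@lebesgue_measure R).

Definition partial_sum (c : nat -> R) n := \sum_(i < n) c i.

Lemma partial_sumS c n : partial_sum c n.+1 = partial_sum c n + c n.
Proof. by rewrite /partial_sum big_ord_recr. Qed.

Lemma partial_sum_nd c : (forall i, 0 <= c i) ->
  {homo partial_sum c : n m / (n <= m)%N >-> n <= m}.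
Proof.
move=> c0 n m /subnKC <-; elim: (m - n)%N => [|k IH]; first by rewrite addn0.
by rewrite addnS partial_sumS (le_trans IH)// lerDl.
Qed.

Lemma in_partial_sum c n t : 0 <= t < partial_sum c n ->
  exists2 i, (i < n)%N & partial_sum c i <= t < partial_sum c i.+1.
Proof.
elim: n => [|n IH].
  by rewrite /partial_sum big_ord0 => /andP[/le_lt_trans /[apply]]; rewrite ltxx.
move=> /andP[t0 tn]; have [tn'|nt] := ltP t (partial_sum c n).
  have [|i ii it] := IH; first by rewrite t0.
  by exists i => //; exact: ltnW.
by exists n => //; rewrite nt.
Qed.

Lemma lebesgue_partial_sum c n (A : set (measurableTypeR R)) :
  (forall i, 0 <= c i) -> measurable A ->
  leb (`[0, partial_sum c n[ `&` A) =
  (\sum_(i < n) leb (`[(partial_sum c i), (partial_sum c i.+1)[ `&` A))%E.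
Proof.
move=> c0 mA; elim: n => [|n IH].
  by rewrite big_ord0 {1}/partial_sum big_ord0 set_itv_ge ?set0I ?measure0// bnd_simp ltxx.
rewrite big_ord_recr /= -IH -measureU; first last.
- apply/seteqP; split => // t [] [+ _] [+ _]; rewrite /= !in_itv/= => /andP[_ h] /andP[+ _].
  by rewrite leNgt h.
- exact: measurableI.
- exact: measurableI.
congr (leb _); rewrite -setIUl; congr (_ `&` _); apply/seteqP; split => t /=.
  rewrite !in_itv/= => /andP[-> ->]; rewrite andbT /=.
  by case: (ltP t (partial_sum c n)) => [_|_]; [left|right].
rewrite !in_itv/= => -[] /andP[h1 h2].
  by rewrite h1 (lt_le_trans h2)// partial_sum_nd.
rewrite h2 (le_trans _ h1)// -[leLHS](_ : partial_sum c 0 = 0) ?partial_sum_nd//.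
by rewrite /partial_sum big_ord0.
Qed.

(** If the weights sum to 1, the law of [q] over the union of the intervals is [m] itself, while
    each interval carries the part of [m] selected by one weight; this is what lets parts of two
    different measures be matched. *)
Lemma concat_parameters d (T : measurableType d) (m : {measure set T -> \bar R})
    (w : nat -> T -> R) (c : nat -> R) (n : nat) :
  parametrizable R T ->
  (forall i, measurable_fun setT (w i)) -> (forall i x, 0 <= w i x) ->
  (forall i, (\int[m]_x (w i x)%:E)%E = (c i)%:E) ->
  exists2 q : measurableTypeR R -> T, measurable_fun setT q &
    forall i B, (i < n)%N -> measurable B ->
    leb (`[(partial_sum c i), (partial_sum c i.+1)[ `&` q @^-1` B) =
    (\int[m]_(x in B) (w i x)%:E)%E.
Proof.
move=> pT mw w0 wc.
have c0 i : 0 <= c i.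
  by rewrite -lee_fin -wc; apply: integral_ge0 => x _; rewrite lee_fin.
elim: n => [|n [q mq qE]].
  by exists (cst point) => [|//]; exact: measurable_cst.
have [p mp pE] := pT (density m (mw n) (w0 n)) (partial_sum c n) (c n) (wc n).
exists (fun t => if `[< t < partial_sum c n >] then q t else p t).
  apply: measurable_if_set => //; exact: measurable_lt_set.
move=> i B; rewrite ltnS leq_eqVlt => /orP[/eqP->|ii] mB.
  rewrite -[RHS]/(density m (mw n) (w0 n) B) pE// partial_sumS; congr (leb _).
  by apply/seteqP; split => t [] ti Bt; split => //; move: ti Bt;
    rewrite /= in_itv/= => /andP[/le_gtF ti _]; rewrite asboolb ti.
rewrite -qE//; congr (leb _); have h := partial_sum_nd c0 ii.
by apply/seteqP; split => t [] ti Bt; split => //; move: ti Bt;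
  rewrite /= in_itv/= => /andP[_ /lt_le_trans/(_ h) ti]; rewrite asboolb ti.
Qed.

(* Splitting both measures into pieces of equal mass and parametrizing matching
   pieces over the same interval couples them along the pieces. *)
Lemma aligned_parameters dS dT (S : measurableType dS) (T : measurableType dT)
    (P : {measure set S -> \bar R}) (Q : {measure set T -> \bar R})
    (f : nat -> S -> R) (g : nat -> T -> R) (a b : nat -> R) (n : nat) :
  parametrizable R S -> parametrizable R T ->
  P setT = 1%E -> Q setT = 1%E ->
  (forall i, measurable_fun setT (f i)) -> (forall i, measurable_fun setT (g i)) ->
  (forall i x, 0 <= f i x) -> (forall i x, 0 <= g i x) ->
  (forall x, \sum_(i < n) f i x <= 1) -> (forall x, \sum_(i < n) g i x <= 1) ->
  (forall i, (\int[P]_x (f i x)%:E)%E = (a i)%:E) ->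
  (forall i, (\int[Q]_x (g i x)%:E)%E = (b i)%:E) ->
  exists (p : measurableTypeR R -> S) (q : measurableTypeR R -> T)
      (J : set (measurableTypeR R)),
    [/\ measurable_fun setT p /\ measurable_fun setT q,
        forall B, measurable B -> P B = leb (`[0, 1[ `&` p @^-1` B),
        forall B, measurable B -> Q B = leb (`[0, 1[ `&` q @^-1` B),
        [/\ measurable J, J `<=` `[0, 1[ &
          ((\sum_(i < n) Num.min (a i) (b i))%:E <= leb J)%E] &
        forall t, J t -> exists i, 0 < f i (p t) /\ 0 < g i (q t)].
Proof.
move=> pS pT P1 Q1 mf mg f0 g0 f1 g1 fa gb.
have a0 i : 0 <= a i.
  by rewrite -lee_fin -fa; apply: integral_ge0 => x _; rewrite lee_fin.
have b0 i : 0 <= b i.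
  by rewrite -lee_fin -gb; apply: integral_ge0 => x _; rewrite lee_fin.
pose c' i := Num.min (a i) (b i).
have c'0 i : 0 <= c' i by rewrite /c' le_min a0 b0.
pose C := \sum_(i < n) c' i.
(* Piece [n] is the remainder, of the same mass [1 - C] on both sides; it fills up [[0, 1)] and
   stays outside [J]. *)
pose c i := if (i < n)%N then c' i else if i == n then 1 - C else 0.
have side d (U : measurableType d) (M : {measure set U -> \bar R})
    (h : nat -> U -> R) (k : nat -> R) : parametrizable R U -> M setT = 1%E ->
    (forall i, measurable_fun setT (h i)) -> (forall i x, 0 <= h i x) ->
    (forall x, \sum_(i < n) h i x <= 1) ->
    (forall i, (\int[M]_x (h i x)%:E)%E = (k i)%:E) -> (forall i, c' i <= k i) ->
  exists2 p : measurableTypeR R -> U, measurable_fun setT p &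
    (C <= 1 /\ forall B, measurable B -> M B = leb (`[0, 1[ `&` p @^-1` B)) /\
    exists2 Z : set (measurableTypeR R), measurable Z /\ leb Z = 0%E &
      forall t i, (i < n)%N -> partial_sum c i <= t < partial_sum c i.+1 ->
        ~ Z t -> 0 < h i (p t).
  move=> pU M1 mh h0 h1 hk c'k.
  have k0 i : 0 <= k i.
    by rewrite -lee_fin -hk; apply: integral_ge0 => x _; rewrite lee_fin.
  (* Piece [i] is trimmed to the smaller of the two masses. If [k i = 0] the quotient is 0, and so
     is [c' i]. *)
  pose v i x := c' i / k i * h i x.
  have mv i : measurable_fun setT (v i) by exact: measurable_funM.
  have v0 i x : 0 <= v i x by rewrite mulr_ge0// divr_ge0.
  have vh i x : v i x <= h i x.
    rewrite ler_piMl//; have := k0 i; rewrite le_eqVlt => /orP[/eqP<-|ki].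
      by rewrite invr0 mulr0.
    by rewrite ler_pdivrMr// mul1r.
  have vc i : (\int[M]_x (v i x)%:E)%E = (c' i)%:E.
    under eq_integral do rewrite EFinM.
    rewrite ge0_integralZl//=; last 3 first.
    - exact/measurable_EFinP.
    - by move=> x _; rewrite lee_fin.
    - by rewrite lee_fin divr_ge0.
    rewrite hk -EFinM; have := k0 i; rewrite le_eqVlt => /orP[/eqP ki|ki].
      have : c' i <= k i by []; rewrite -ki mulr0 => ?.
      by congr _%:E; apply/eqP; rewrite eq_le c'0.
    by rewrite mulfVK// gt_eqF.
  pose w i x := if (i < n)%N then v i x else
                if i == n then 1 - \sum_(j < n) v j x else 0.
  have sv x : \sum_(j < n) v j x <= 1.
    by apply: le_trans (h1 x); apply: ler_sum.
  have mw i : measurable_fun setT (w i).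
    rewrite /w; case: (i < n)%N; first by [].
    case: (i == n); last exact: measurable_cst.
    by apply: measurable_funB => //; exact: measurable_sum.
  have w0 i x : 0 <= w i x.
    by rewrite /w; case: ifP => // _; case: ifP => // _; rewrite subr_ge0.
  have wE i x : (i < n)%N -> w i x = v i x by rewrite /w => ->.
  have sw x : \sum_(i < n.+1) w i x = 1.
    rewrite big_ord_recr /= [w n x]/w ltnn eqxx.
    by under eq_bigr => i _ do rewrite wE//; rewrite addrC subrK.
  have swint B : measurable B -> (\sum_(i < n.+1) \int[M]_(x in B) (w i x)%:E = M B)%E.
    move=> mB; rewrite -ge0_integral_sum//; last 2 first.
    - by move=> i; apply/measurable_EFinP; exact: measurable_funTS.
    - by move=> i x _; rewrite lee_fin.
    under eq_integral => x _ do rewrite sumEFin sw.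
    by rewrite integral_cst// mul1e.
  have wc i : (\int[M]_x (w i x)%:E)%E = (c i)%:E.
    have [ii|] := boolP (i < n)%N.
      by rewrite /c ii -vc; apply: eq_integral => x _; rewrite wE.
    rewrite /c /w => /negbTE ->; case: eqP => [_|_]; last by rewrite integral0.
    have := swint _ measurableT; rewrite M1 big_ord_recr/=.
    rewrite (eq_bigr (fun i : 'I_n => (c' i)%:E)); last first.
      by move=> j _; rewrite -vc; apply: eq_integral => x _; rewrite wE.
    rewrite sumEFin -/C /w; under eq_integral do rewrite ltnn eqxx.
    move: (integral _ _ _) => [r|//|//].
    by rewrite -EFinD => -[<-]; congr _%:E; rewrite addrC addKr.
  have [p mp pE] := concat_parameters n.+1 pU mw w0 wc.
  have c0 i : 0 <= c i.
    by rewrite -lee_fin -wc; apply: integral_ge0 => x _; rewrite lee_fin.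
  have c1 : partial_sum c n.+1 = 1.
    rewrite partial_sumS [c n]/c ltnn eqxx /partial_sum (eq_bigr (fun i : 'I_n => c' i)).
      by rewrite addrC subrK.
    by move=> i _; rewrite /c ltn_ord.
  exists p => //; split.
    split; first by have := c0 n; rewrite /c ltnn eqxx subr_ge0.
    move=> B mB; rewrite -c1 lebesgue_partial_sum//; last exact: measurable_preimage.
    by under eq_bigr => i _ do rewrite pE//; rewrite swint.
  (* Over interval [i] the law of [p] has density [w i], which is at most [h i], so the parameters
     sent to points where [h i] vanishes form a null set. *)
  pose Z i : set (measurableTypeR R) := if (i < n)%N then
    `[(partial_sum c i), (partial_sum c i.+1)[ `&` p @^-1` [set x | h i x <= 0] else set0.
  have mhi i : measurable [set x | h i x <= 0] by exact: measurable_le_set.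
  have mZ i : measurable (Z i).
    rewrite /Z; case: ifP => // _; apply: measurableI; first exact: measurable_itv.
    exact: measurable_preimage.
  have Z0 i : leb (Z i) = 0%E.
    rewrite /Z; case: ifP => [ii|_]; last exact: measure0.
    rewrite pE//; last exact: ltnW.
    rewrite integral0_eq// => x /= hx; congr _%:E; apply/eqP.
    by rewrite eq_le w0 wE// andbT (le_trans (vh _ _)).
  exists (\bigcup_i Z i).
    have mU : measurable (\bigcup_i Z i) by exact: bigcupT_measurable.
    split=> //; apply: measure_negligible => //.
    apply: negligible_bigcup => i; apply/negligibleP; [exact: mZ|exact: Z0].
  move=> t i ii it nZ; rewrite ltNge; apply/negP => ht; apply: nZ.
  by exists i => //; rewrite /Z ii; split.
have c'a i : c' i <= a i by rewrite /c' ge_min lexx.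
have c'b i : c' i <= b i by rewrite /c' ge_min lexx orbT.
have [p mp [[C1 pP] [Zp [mZp Zp0] pZ]]] := side _ _ P f a pS P1 mf f0 f1 fa c'a.
have [q mq [[_ qQ] [Zq [mZq Zq0] qZ]]] := side _ _ Q g b pT Q1 mg g0 g1 gb c'b.
have CE : partial_sum c n = C by apply: eq_bigr => i _; rewrite /c ltn_ord.
have C0 : 0 <= C by apply: sumr_ge0.
have mI : measurable (`[0, C[ : set (measurableTypeR R)) by exact: measurable_itv.
have mJ : measurable (`[0, C[ `\` (Zp `|` Zq) : set (measurableTypeR R)).
  by apply: measurableD => //; exact: measurableU.
exists p, q, (`[0, C[ `\` (Zp `|` Zq)); split => //.
- split => //.
    move=> t []; rewrite /= !in_itv/= => /andP[-> tC] _.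
    exact: lt_le_trans C1.
  have <- : leb `[0, C[ = C%:E.
    rewrite lebesgue_measure_itv/= lte_fin; case: ltP; first by rewrite sube0.
    by move=> C0'; congr _%:E; apply/eqP; rewrite eq_le C0.
  rewrite -[leRHS]adde0 -[X in (_ <= _ + X)%E]Zq0 -[X in (_ <= X + _)%E]adde0
    -[X in (_ <= _ + X + _)%E]Zp0.
  have mJp : measurable ((`[0, C[ `\` (Zp `|` Zq)) `|` Zp) by exact: measurableU.
  apply: (@le_trans _ _ (leb ((`[0, C[ `\` (Zp `|` Zq)) `|` Zp `|` Zq))).
    apply: le_measure; rewrite ?inE//; first exact: measurableU.
    move=> t tC; have [zp|nzp] := pselect (Zp t); first by left; right.
    by have [zq|nzq] := pselect (Zq t); [right|left; left; split=> // -[]].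
  by apply: (le_trans (measureU2 _ _ _)) => //; rewrite leeD2r// measureU2.
- move=> t [] + nZ; rewrite /= in_itv/= -CE => /in_partial_sum[i ii it].
  exists i; split; [apply: (pZ t i) => // zt|apply: (qZ t i) => // zt].
    by apply: nZ; left.
  by apply: nZ; right.
Qed.

End concatenation.

Lemma continuous_borel_measurable (R : realType) (X : completeMetricType R) (f : X -> R) :
  continuous f -> measurable_fun setT (f : borel X -> R).
Proof.
move=> /continuousP cf; apply: (measurability _ (RGenOpens.measurableE R)).
move=> _ [_ [a [b ->]] <-]; rewrite setTI; apply: borel_open; apply: cf.
exact: interval_open.
Qed.

Lemma continuous_maxr (R : realType) (X : topologicalType) (f g : X -> R) :
  continuous f -> continuous g -> continuous (fun x => Num.max (f x) (g x)).
Proof. by move=> cf cg x; exact: (continuous_max (cf x) (cg x)). Qed.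

Lemma continuous_minr (R : realType) (X : topologicalType) (f g : X -> R) :
  continuous f -> continuous g -> continuous (fun x => Num.min (f x) (g x)).
Proof. by move=> cf cg x; exact: (continuous_min (cf x) (cg x)). Qed.

(* The increments of the running maximum of the bumps around a dense sequence:
   unlike a normalised partition, they need no division and their partial sums
   are explicit. *)
Section partition_of_unity.
Context {R : realType} (X : completeMetricType R) (u : nat -> X) (e : R).
Hypotheses (du : dense (range u)) (e0 : 0 < e).

Definition bump i (x : X) : R := Num.min 1 (Num.max 0 (2 - mdist (u i) x / e)).

Fixpoint bump_max n (x : X) : R :=
  if n is i.+1 then Num.max (bump_max i x) (bump i x) else 0.

Definition partition_fun i (x : X) : R := bump_max i.+1 x - bump_max i x.

Lemma bump_le1 i x : bump i x <= 1.
Proof. by rewrite /bump ge_min lexx. Qed.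

Lemma bump_max_ge0 n x : 0 <= bump_max n x.
Proof. by elim: n => [//|n IH] /=; rewrite le_max IH. Qed.

Lemma bump_max_le1 n x : bump_max n x <= 1.
Proof. by elim: n => [//|n IH] /=; rewrite ge_max IH bump_le1. Qed.

Lemma bump_max_nd x : {homo bump_max^~ x : n m / (n <= m)%N >-> n <= m}.
Proof.
move=> n m /subnKC <-; elim: (m - n)%N => [|k IH]; first by rewrite addn0.
by rewrite addnS /= le_max IH.
Qed.

Lemma continuous_bump_max n : continuous (bump_max n).
Proof.
elim: n => [|n IH] /=; first by move=> x; exact: cvg_cst.
apply: continuous_maxr => //; apply: continuous_minr; first by move=> x; exact: cvg_cst.
apply: continuous_maxr => [x|x]; first exact: cvg_cst.
by apply: cvgB; [exact: cvg_cst|apply: cvgMl; exact: continuous_mdist].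
Qed.

Lemma continuous_partition_fun i : continuous (partition_fun i).
Proof. by move=> x; apply: cvgB; apply: continuous_bump_max. Qed.

Lemma partition_fun_ge0 i x : 0 <= partition_fun i x.
Proof. by rewrite subr_ge0 bump_max_nd. Qed.

Lemma partition_fun_le1 i x : partition_fun i x <= 1.
Proof.
by have := bump_max_le1 i.+1 x; have := bump_max_ge0 i x; rewrite /partition_fun; lra.
Qed.

Lemma sum_partition_fun n x : \sum_(i < n) partition_fun i x = bump_max n x.
Proof.
elim: n => [|n IH]; first by rewrite big_ord0.
by rewrite big_ord_recr IH /partition_fun /= addrC subrK.
Qed.

Lemma partition_fun_near i x : 0 < partition_fun i x -> mdist (u i) x < 2 * e.
Proof.
rewrite /partition_fun subr_gt0 /= lt_max ltxx /= ltNge => /negP h.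
rewrite ltNge; apply/negP => far; apply: h.
rewrite (le_trans _ (bump_max_ge0 i x))// /bump ge_min ge_max lexx /=.
by apply/orP; right; rewrite subr_le0 ler_pdivlMr.
Qed.

Lemma bump_max1 x : exists n, bump_max n x = 1.
Proof.
have [i ix] := dense_mdist x du e0; exists i.+1; apply/eqP.
rewrite eq_le bump_max_le1 /= le_max; apply/orP; right.
rewrite /bump le_min lexx /= le_max; apply/orP; right.
by rewrite lerBrDl -lerBrDr ler_pdivrMr//; lra.
Qed.

(** The partial sums are the running maxima. They increase to 1 at every point, since the balls of
    radius [e] around a dense sequence cover the space, and monotone convergence applies. *)
Lemma partition_fun_exhaust (m : {measure set (borel X) -> \bar R}) (a : nat -> R) :
  m setT = 1%E -> (forall i, (\int[m]_x (partition_fun i x)%:E)%E = (a i)%:E) ->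
  forall d, 0 < d -> exists n, 1 - d < \sum_(i < n) a i.
Proof.
move=> m1 ma d d0.
have mb n : measurable_fun setT ((fun x => (bump_max n x)%:E) : borel X -> \bar R).
  by apply/measurable_EFinP; apply: continuous_borel_measurable; exact: continuous_bump_max.
have bE n : (\int[m]_x (bump_max n x)%:E)%E = (\sum_(i < n) a i)%:E.
  under eq_integral do rewrite -sum_partition_fun -sumEFin.
  rewrite ge0_integral_sum//.
  - by rewrite -sumEFin; apply: eq_bigr => i _.
  - move=> i; apply/measurable_EFinP; apply: continuous_borel_measurable.
    exact: continuous_partition_fun.
  - by move=> i x _; rewrite lee_fin partition_fun_ge0.
have : (\int[m]_x (bump_max n x)%:E)%E @[n --> \oo] --> (\int[m]_x 1%E)%E.
  have h x : (bump_max n x)%:E @[n --> \oo] --> 1%E.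
    have [k k1] := bump_max1 x; apply: cvg_near_cst; exists k => // n /= kn.
    by congr _%:E; apply/eqP; rewrite eq_le bump_max_le1 -k1 bump_max_nd.
  have -> : (\int[m]_x 1 = \int[m]_x (lim ((bump_max n x)%:E @[n --> \oo])))%E.
    by apply: eq_integral => x _; rewrite (cvg_lim _ (h x)).
  apply: cvg_monotone_convergence => //.
  - by move=> n x _; rewrite lee_fin bump_max_ge0.
  - by move=> x _ i j ij; rewrite lee_fin bump_max_nd.
rewrite integral_cst// mul1e m1; under eq_fun do rewrite bE.
move=> /fine_cvg /= /cvgrPdist_lt /(_ _ d0)[n _ /(_ n (leqnn n))] /=.
by rewrite ltr_distlC => /andP[? _]; exists n.
Qed.

End partition_of_unity.

(** * The box distance *)

Lemma inf_ge0 (R : realType) (S : set R) : (forall x, S x -> 0 <= x) -> 0 <= inf S.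
Proof.
move=> S0; have [->|/set0P ne] := eqVneq S set0; first by rewrite inf0.
exact: lb_le_inf.
Qed.

Section box_facts.
Context {R : realType}.
Notation leb := (@lebesgue_measure R).
Implicit Types X Y Z : nmms R.

Lemma lebesgue_itv01 : leb `[0, 1[ = 1%E.
Proof. by rewrite lebesgue_measure_itv/= lte_fin ltr01 -EFinB subr0. Qed.

Lemma lebesgue_compl01 (L : set (measurableTypeR R)) (c : R) :
  measurable L -> L `<=` `[0, 1[ -> ((1 - c)%:E <= leb L)%E ->
  (leb (`[0%R, 1%R[ `\` L) <= c%:E)%E.
Proof.
move=> mL L1; have E : (1%E = leb (`[0%R, 1%R[ `\` L) + leb L)%E.
  by rewrite -lebesgue_itv01 (@measureDI _ _ _ leb `[0, 1[ L)// (setIidr L1).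
have := measure_ge0 leb (`[0%R, 1%R[ `\` L); move: E.
case: (leb (`[0%R, 1%R[ `\` L)) => [r1| |]; case: (leb L) => [r2| |] //.
by rewrite -EFinD => -[E]; rewrite !lee_fin => _ cL; lra.
Qed.

Definition box_witness (d1 d2 : R -> R -> R) (e : R) := exists I : set (measurableTypeR R),
    [/\ measurable I, I `<=` `[0, 1[, ((1 - e)%:E <= leb I)%E &
        forall t s, I t -> I s -> `|d1 t s - d2 t s| <= e].

Lemma box_pseudo_ge0 (d1 d2 : R -> R -> R) : 0 <= box_pseudo d1 d2.
Proof. by apply: inf_ge0 => //= e [/andP[]]. Qed.

Lemma box_pseudo_ub (d1 d2 : R -> R -> R) e :
  0 <= e -> box_witness d1 d2 e -> box_pseudo d1 d2 <= e.
Proof.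
move=> e0 we; have lb : has_lbound [set e : R | 0 <= e <= 1 /\ box_witness d1 d2 e].
  by exists 0 => x /= [/andP[]].
have [e1|e1] := leP e 1; first by apply: ge_inf => //=; rewrite e0 e1.
(* For [e > 1] the empty set is a witness at the value 1. *)
apply: (@le_trans _ _ 1); last exact: ltW.
apply: ge_inf => //=; split; first by rewrite ler01 lexx.
by exists set0; split => //; rewrite subrr measure0.
Qed.

Lemma box_pseudo_lt (d1 d2 : R -> R -> R) e : box_pseudo d1 d2 < e ->
  exists2 e', 0 <= e' < e & box_witness d1 d2 e'.
Proof.
move=> /inf_lt[|e' [/andP[e0 e1] we] ee']; last by exists e' => //; rewrite e0.
exists 1; split; first by rewrite ler01 lexx.
by exists set0; split => //; rewrite subrr measure0.
Qed.

Lemma box_rep_ge0 X Y : 0 <= box_rep X Y.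
Proof. by apply: inf_ge0 => //= b [qX [qY [_ _ ->]]]; exact: box_pseudo_ge0. Qed.

Lemma box_rep_ub X Y (qX : R -> X) (qY : R -> Y) e :
  parameter qX -> parameter qY -> 0 <= e ->
  box_witness (fun t s => mdist (qX t) (qX s)) (fun t s => mdist (qY t) (qY s)) e ->
  box_rep X Y <= e.
Proof.
move=> pX pY e0 we; apply: le_trans (box_pseudo_ub e0 we); apply: ge_inf.
  by exists 0 => b [? [? [_ _ ->]]]; exact: box_pseudo_ge0.
by exists qX, qY.
Qed.

Lemma parameter_exists X : exists q : R -> X, parameter q.
Proof.
have [q mq qE] := parametrizable_polish (mms_separable X) 0 (nmms_mass1 X).
rewrite add0r in qE; exists q; split => //; exact: measurable_funTS.
Qed.

(** Parameters are later composed with changes of variable defined on the whole line, so they are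
    made measurable there; values off [[0, 1)] do not affect the law. *)
Lemma parameter_total X (q : R -> X) : parameter q -> exists q' : R -> X,
  [/\ measurable_fun setT (q' : measurableTypeR R -> borel X), parameter q' &
      forall t, `[0, 1[%classic t -> q' t = q t].
Proof.
move=> [mq qE]; pose q' t := if `[< `[0, 1[%classic t >] then q t else point.
have qq' t : `[0, 1[%classic t -> q' t = q t by move=> ?; rewrite /q'; case: asboolP.
have m01 : measurable (`[0, 1[ : set (measurableTypeR R)) by exact: measurable_itv.
have mq' : measurable_fun setT (q' : measurableTypeR R -> borel X).
  by apply: (measurable_if_set_in m01 mq); exact: measurable_cst.
exists q'; split => //; split; first exact: measurable_funTS.
move=> B mB; rewrite qE//; congr (leb _).
by apply/seteqP; split => t [t01 Bt]; split => //; move: Bt; rewrite /preimage /= qq'.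
Qed.

Lemma box_rep_lt X Y e : box_rep X Y < e ->
  exists (qX : R -> X) (qY : R -> Y) (e' : R),
  [/\ measurable_fun setT (qX : measurableTypeR R -> borel X) /\
      measurable_fun setT (qY : measurableTypeR R -> borel Y),
      parameter qX, parameter qY, 0 <= e' < e &
      box_witness (fun t s => mdist (qX t) (qX s)) (fun t s => mdist (qY t) (qY s)) e'].
Proof.
move=> /inf_lt[|b [qX [qY [pX pY ->]]]].
  have [qX pX] := parameter_exists X; have [qY pY] := parameter_exists Y.
  by eexists; exists qX, qY; split.
move=> /box_pseudo_lt[e' e'e [I [mI I1 Ie Id]]].
have [qX' [mX pX' XE]] := parameter_total pX.
have [qY' [mY pY' YE]] := parameter_total pY.
exists qX', qY', e'; split => //; exists I; split => // t s It Is.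
by rewrite !XE ?YE; [exact: Id|exact: I1..].
Qed.

Lemma box_rep_triangle X Y Z : box_rep X Z <= box_rep X Y + box_rep Y Z.
Proof.
suff H (a b e : R) : box_rep X Y < a -> box_rep Y Z < b -> 0 < e ->
    box_rep X Z <= a + b + 8 * e.
  apply/ler_addgt0Pr => e e0.
  (* The three contributions [e / 4], [e / 4] and [8 * (e / 16)] add up to [e]. *)
  have := @H (box_rep X Y + e / 4) (box_rep Y Z + e / 4) (e / 16).
  by rewrite !ltrDl; lra.
move=> /box_rep_lt[qX [qY [a' [[mX mY] pX pY /andP[a0 a'a] [I [mI I1 Ia Id]]]]]].
move=> /box_rep_lt[rY [rZ [b' [[mrY mrZ] prY prZ /andP[b0 b'b] [K [mK K1 Kb Kd]]]]]] e0.
have [u du] := separable_seq (mms_separable Y).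
have m01 : measurable (`[0, 1[ : set (measurableTypeR R)) by exact: measurable_itv.
pose P := mrestr leb m01.
have P1 : P setT = 1%E.
  by rewrite /P /= /mrestr setTI lebesgue_itv01.
pose phi i := @partition_fun R Y u e i.
have mphi i : measurable_fun setT (phi i : borel Y -> R).
  apply: continuous_borel_measurable; exact: continuous_partition_fun.
have phi_int i : (\int[mms_measure Y]_x (phi i x)%:E \is a fin_num)%E.
  rewrite ge0_fin_numE; last by apply: integral_ge0 => x _; rewrite lee_fin partition_fun_ge0.
  apply: (@le_lt_trans _ _ (\int[mms_measure Y]_x 1)%E); last first.
    by rewrite integral_cst// mul1e nmms_mass1 ltry.
  apply: ge0_le_integral => //.
  - by move=> x _; rewrite lee_fin partition_fun_ge0.
  - exact/measurable_EFinP.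
  - by move=> x _; rewrite lee_fin partition_fun_le1.
pose a_ i := fine (\int[mms_measure Y]_x (phi i x)%:E)%E.
have aE i : (\int[mms_measure Y]_x (phi i x)%:E)%E = (a_ i)%:E by rewrite fineK.
have intP (q : R -> Y) i : measurable_fun setT (q : measurableTypeR R -> borel Y) ->
    parameter q -> (\int[P]_t ((phi i \o q) t)%:E)%E = (a_ i)%:E.
  move=> mq [_ qE]; rewrite -aE.
  rewrite (@eq_measure_integral _ _ _ setT (push_measure P mq)); last first.
    by move=> B mB _; rewrite qE// /= /pushforward /mrestr setIC.
  rewrite ge0_integral_pushforward//; first exact/measurable_EFinP.
  by move=> y _; rewrite lee_fin partition_fun_ge0.
have [n na] := partition_fun_exhaust du e0 (nmms_mass1 Y) aE e0.
have sum1 (q : R -> Y) t : \sum_(i < n) (phi i \o q) t <= 1.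
  by rewrite /= sum_partition_fun bump_max_le1.
(* [s] and [r] preserve Lebesgue measure on [[0, 1)], so [qX \o s] and [rZ \o r] are again
   parameters. On [J] the two images [qY (s t)] and [rY (r t)] in the middle space lie in one small
   piece; equality cannot be expected. *)
have [s [r [J [[ms mr] sE rE [mJ J1 Ja] Jphi]]]] :=
  @aligned_parameters R _ _ (measurableTypeR R) (measurableTypeR R) P P
  (fun i => phi i \o qY) (fun i => phi i \o rY) a_ a_ n
  (@parametrizable_real R) (@parametrizable_real R) P1 P1
  (fun i => measurableT_comp (mphi i) mY) (fun i => measurableT_comp (mphi i) mrY)
  (fun i x => partition_fun_ge0 _ _ _ _) (fun i x => partition_fun_ge0 _ _ _ _)
  (sum1 qY) (sum1 rY) (fun i => intP qY i mY pY) (fun i => intP rY i mrY prY).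
have comp_par (W : nmms R) (q : R -> W) (v : measurableTypeR R -> measurableTypeR R) :
    measurable_fun setT (q : measurableTypeR R -> borel W) -> parameter q ->
    measurable_fun setT v ->
    (forall B, measurable B -> P B = leb (`[0, 1[ `&` v @^-1` B)) ->
    parameter (q \o v : R -> W).
  move=> mq [_ qE] mv vE; split.
    by apply: measurable_funTS; exact: measurableT_comp.
  move=> B mB; have mqB : measurable (q @^-1` B : set (measurableTypeR R)).
    exact: measurable_preimage mq mB.
  transitivity (P (q @^-1` B)); last exact: vE.
  by rewrite qE// /P /= /mrestr setIC.
apply: (@le_trans _ _ (a' + b' + 8 * e)); last by lra.
apply: (box_rep_ub (comp_par _ _ _ mX pX ms sE) (comp_par _ _ _ mrZ prZ mr rE)).
  by lra.
have mA : measurable (J `&` (s @^-1` I `&` r @^-1` K)).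
  by apply: measurableI => //; apply: measurableI; exact: measurable_preimage.
exists (J `&` (s @^-1` I `&` r @^-1` K)); split => //.
- by move=> t [/J1].
- have mes (v : measurableTypeR R -> measurableTypeR R) (L : set (measurableTypeR R)) c :
    measurable_fun setT v -> measurable L -> L `<=` `[0, 1[ ->
    (forall B, measurable B -> P B = leb (`[0, 1[ `&` v @^-1` B)) ->
    ((1 - c)%:E <= leb L)%E -> (leb (`[0%R, 1%R[ `&` v @^-1` (~` L)) <= c%:E)%E.
    move=> mv mL L1 vE cL; have mCL : measurable (~` L) by exact: measurableC.
    rewrite -[leLHS](vE _ mCL).
    by rewrite /P /= /mrestr setIC -setDE; exact: lebesgue_compl01.
  have bs := mes s I a' ms mI I1 sE Ia; have br := mes r K b' mr mK K1 rE Kb.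
  have mvs : measurable (`[0, 1[ `&` s @^-1` (~` I)).
    by apply: measurableI => //; apply: measurable_preimage => //; exact: measurableC.
  have mvr : measurable (`[0, 1[ `&` r @^-1` (~` K)).
    by apply: measurableI => //; apply: measurable_preimage => //; exact: measurableC.
  set A := J `&` _ in mA *.
  (* The measure lost is at most [a'] where [s] leaves [I] and [b'] where [r] leaves [K], besides
     the [e] already lost outside [J]. *)
  have JA : (leb J <= leb A + a'%:E + b'%:E)%E.
    apply: (@le_trans _ _ (leb (A `|` (`[0%R, 1%R[ `&` s @^-1` (~` I)) `|`
        (`[0%R, 1%R[ `&` r @^-1` (~` K))))).
      apply: le_measure; rewrite ?inE//.
        by apply: measurableU => //; exact: measurableU.
      move=> t Jt; have t1 := J1 _ Jt.
      have [It|It] := pselect (I (s t)); last by left; right.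
      by have [Kt|Kt] := pselect (K (r t)); [left; left|right].
    apply: (le_trans (measureU2 _ _ _)) => //; first exact: measurableU.
    apply: leeD => //; apply: (le_trans (measureU2 _ _ _)) => //.
    exact: leeD.
  rewrite -leeBlDr// -leeBlDr// in JA; apply: le_trans JA.
  apply: (@le_trans _ _ ((1 - e)%:E - b'%:E - a'%:E)%E); first by rewrite -!EFinB lee_fin; lra.
  apply: leeB => //; apply: leeB => //; apply: le_trans Ja; rewrite lee_fin ltW//.
  by under eq_bigr do rewrite minxx.
- move=> t t' [/Jphi[i [si ri]] [/= It Kt]] [/Jphi[i' [si' ri']] [/= It' Kt']].
  (* Both points are within [2 * e] of the same [u j]. Each of the two pairs thus costs [4 * e],
     whence the [8 * e] in the bound. *)
  have close j x y : 0 < phi j x -> 0 < phi j y -> mdist x y <= 4 * e.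
    move=> /(partition_fun_near e0) hx /(partition_fun_near e0) hy.
    have := metric_triangle x (u j) y; rewrite (metric_sym x (u j)); lra.
  have h1 := close _ _ _ si ri; have h2 := close _ _ _ si' ri'.
  have := Id _ _ It It'; have := Kd _ _ Kt Kt'.
  rewrite !ler_distl => /andP[k1 k2] /andP[l1 l2].
  have t1 := metric_triangle (qY (s t)) (rY (r t)) (qY (s t')).
  have t2 := metric_triangle (rY (r t)) (rY (r t')) (qY (s t')).
  have t3 := metric_triangle (rY (r t)) (qY (s t)) (rY (r t')).
  have t4 := metric_triangle (qY (s t)) (qY (s t')) (rY (r t')).
  rewrite (metric_sym (rY (r t')) (qY (s t'))) in t2.
  rewrite (metric_sym (rY (r t)) (qY (s t))) in t3.
  by rewrite /=; apply/andP; split; lra.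
Qed.
End box_facts.

(** * From pmG convergence to box convergence *)

Section integral_bounds.
Context d (T : measurableType d) (R : realType) (m : {measure set T -> \bar R}).

Lemma ge0_EFin_Rintegral (f : T -> R) : (forall x, 0 <= f x) ->
  (\int[m]_x (f x)%:E < +oo)%E -> (\int[m]_x (f x)%:E)%E = (\int[m]_x f x)%:E.
Proof.
move=> f0 fin; rewrite /Rintegral fineK// ge0_fin_numE//.
by apply: integral_ge0 => x _; rewrite lee_fin.
Qed.

Lemma ge0_integral_fin_le (f g : T -> R) (c : R) : measurable_fun setT f ->
  measurable_fun setT g -> (forall x, 0 <= f x) -> (forall x, 0 <= g x) -> 0 <= c ->
  (forall x, f x <= c * g x) -> (\int[m]_x (g x)%:E < +oo)%E ->
  (\int[m]_x (f x)%:E < +oo)%E.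
Proof.
move=> mf mg f0 g0 c0 fg gfin.
apply: (@le_lt_trans _ _ (\int[m]_x (c%:E * (g x)%:E))%E).
  apply: ge0_le_integral => //.
  - by move=> x _; rewrite lee_fin.
  - exact/measurable_EFinP.
  - by apply/measurable_EFinP; exact: measurable_funM.
  - by move=> x _; rewrite -EFinM lee_fin.
rewrite ge0_integralZl//.
- by rewrite ge0_EFin_Rintegral// -EFinM ltry.
- exact/measurable_EFinP.
- by move=> x _; rewrite lee_fin.
Qed.

Lemma Rintegral_close (f g h : T -> R) (c : R) : measurable_fun setT f ->
  measurable_fun setT g -> measurable_fun setT h ->
  (forall x, 0 <= f x) -> (forall x, 0 <= g x) -> (forall x, 0 <= h x) -> 0 <= c ->
  (forall x, `|f x - g x| <= c * h x) ->
  (\int[m]_x (f x)%:E < +oo)%E -> (\int[m]_x (g x)%:E < +oo)%E ->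
  (\int[m]_x (h x)%:E < +oo)%E ->
  `|\int[m]_x f x - \int[m]_x g x| <= c * \int[m]_x h x.
Proof.
move=> mf mg mh f0 g0 h0 c0 fg ff gf hf.
have key (a b : T -> R) : measurable_fun setT a -> measurable_fun setT b ->
    (forall x, 0 <= a x) -> (forall x, 0 <= b x) ->
    (forall x, a x <= b x + c * h x) -> (\int[m]_x (a x)%:E < +oo)%E ->
    (\int[m]_x (b x)%:E < +oo)%E -> \int[m]_x a x <= \int[m]_x b x + c * \int[m]_x h x.
  move=> ma mb a0 b0 ab af bf; rewrite -lee_fin EFinD EFinM -!ge0_EFin_Rintegral//.
  rewrite -ge0_integralZl//; last 2 first.
  - exact/measurable_EFinP.
  - by move=> x _; rewrite lee_fin.
  rewrite -ge0_integralD//; last 4 first.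
  - by move=> x _; rewrite lee_fin.
  - exact/measurable_EFinP.
  - by move=> x _; rewrite mule_ge0 ?lee_fin.
  - by apply/measurable_EFinP; exact: measurable_funM.
  apply: ge0_le_integral => //.
  - by move=> x _; rewrite lee_fin.
  - exact/measurable_EFinP.
  - apply/measurable_EFinP; apply: measurable_funD => //; exact: measurable_funM.
  - by move=> x _; rewrite lee_fin.
have fg1 x : f x <= g x + c * h x by have := fg x; rewrite ler_distl; lra.
have gf1 x : g x <= f x + c * h x by have := fg x; rewrite ler_distl; lra.
have := key f g mf mg f0 g0 fg1 ff gf; have := key g f mg mf g0 f0 gf1 gf ff.
by move=> h1 h2; rewrite ler_distl; apply/andP; split; lra.
Qed.

End integral_bounds.

Section cut_integrals.
Context {R : realType}.

Lemma bounded_support_fin (X : mms R) (p : X) (r M : R) (f : X -> R) :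
  measurable_fun setT (f : borel X -> R) -> (forall x, 0 <= f x <= M) ->
  (forall x, f x != 0 -> mdist p x < r) ->
  (\int[mms_measure X]_x (f x)%:E < +oo)%E.
Proof.
move=> mf fM fr; pose B : set (borel X) := ball p r.
have mB : measurable B by apply: borel_open; exact: open_mball.
have M0 : 0 <= M by have /andP[h1 h2] := fM p; exact: le_trans h2.
apply: (@ge0_integral_fin_le _ (borel X) R (mms_measure X) f (\1_B) M) => //.
- by move=> x; have /andP[] := fM x.
- move=> x; rewrite indicE; have [fx|fx] := eqVneq (f x) 0; first by rewrite fx mulr_ge0.
  rewrite mem_set; first by rewrite mulr1; have /andP[] := fM x.
  by rewrite /B ballEmdist /=; exact: fr.
- by rewrite integral_indic// setIT; exact: mms_ball_finite.
Qed.

Lemma eta_dist_support (X : pmms R) k (x : X) :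
  eta_dist k x != 0 -> mdist (pmms_pt X) x < 2 * 2 ^ k.
Proof. by rewrite ltNge; apply: contra => /eta_far/eqP. Qed.

Lemma mul_eta_dist_fin (X : pmms R) k (M : R) (f : X -> R) :
  measurable_fun setT (f : borel X -> R) -> (forall x, 0 <= f x <= M) ->
  (\int[mms_measure X]_x (f x * eta_dist k x)%:E < +oo)%E.
Proof.
move=> mf fM; apply: (@bounded_support_fin X (pmms_pt X) (2 * 2 ^ k) M).
- by apply: measurable_funM => //; exact: measurable_eta_dist.
- move=> x; have /andP[h1 h2] := fM x.
  by rewrite mulr_ge0 ?eta_ge0//= (le_trans _ h2)// ler_piMr// eta_le1.
- by move=> x; rewrite mulf_eq0 negb_or => /andP[_]; exact: eta_dist_support.
Qed.

Lemma integral_j_cut (X : pmms R) k (M : R) (f : X -> R) :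
  measurable_fun setT (f : borel X -> R) -> (forall x, 0 <= f x <= M) ->
  (\int[j_measure (cut_pmms X k)]_x (f x)%:E)%E =
  (3^-1 * ((eta_mass X k)^-1 * \int[mms_measure X]_x (f x * eta_dist k x)
           + 2 * f (pmms_pt X)))%:E.
Proof.
move=> mf fM; have f0 x : 0 <= f x by have /andP[] := fM x.
have mfE : measurable_fun setT ((fun x => (f x)%:E) : borel X -> \bar R).
  exact/measurable_EFinP.
rewrite /j_measure ge0_integral_mscale//=; last by move=> x _; rewrite lee_fin.
rewrite ge0_integral_measure_add//; last by move=> x _; rewrite lee_fin.
rewrite ge0_integral_mscale//=; last by move=> x _; rewrite lee_fin.
rewrite ge0_integral_mscale//=; last by move=> x _; rewrite lee_fin.
rewrite integral_dirac// diracT mul1e.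
rewrite (@ge0_integral_density _ _ _ (mms_measure X) _ (@eta_dist R X k))//; first last.
- by move=> x; rewrite eta_ge0.
- exact: measurable_eta_dist.
rewrite ge0_EFin_Rintegral ?(mul_eta_dist_fin k mf fM)//.
by move=> x; rewrite mulr_ge0 ?eta_ge0.
Qed.

End cut_integrals.

Lemma eta_lipschitz (R : realType) k (a b : R) :
  `|eta k a - eta k b| <= 2 ^ (- k) * `|a - b|.
Proof.
have k0 : 0 < 2 ^ (- k) :> R by exact: exprz_gt0.
wlog ab : a b / a <= b.
  move=> H; have [/H//|/ltW /H h] := leP a b.
  by rewrite distrC (distrC a).
rewrite [`|a - b|]distrC [`|b - a|]ger0_norm ?subr_ge0// mulrBr /eta.
have : 2 ^ (- k) * a <= 2 ^ (- k) * b by rewrite ler_pM2l.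
move: (2 ^ (- k) * a) (2 ^ (- k) * b) => x y xy.
pose v z : R := Num.min (Num.max (2 - z) 0) 1.
have E z : [\/ z <= 1 /\ v z = 1, 1 <= z <= 2 /\ v z = 2 - z | 2 <= z /\ v z = 0].
  rewrite /v; have [z2|z2] := leP 2 z.
    by apply: Or33; split=> //; rewrite max_r ?min_l//; lra.
  rewrite max_l; last by lra.
  have [z1|z1] := leP z 1; first by apply: Or31; split=> //; rewrite min_r//; lra.
  by apply: Or32; split; [lra|rewrite min_l//; lra].
change (`|v x - v y| <= y - x); rewrite ler_distl.
by case: (E x) => -[? ->]; case: (E y) => -[? ->]; apply/andP; split; lra.
Qed.

Lemma measurable_isometry (R : realType) (X Y : completeMetricType R) (f : X -> Y) :
  isometry f -> measurable_fun setT (f : borel X -> borel Y).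
Proof.
move=> fi; apply: measurable_isometry_on; first exact: closedT.
by move=> x y _ _; exact: fi.
Qed.

Lemma closed_mdist_le (R : realType) (X : completeMetricType R) (p : X) (r : R) :
  closed [set y | mdist p y <= r].
Proof.
have -> : [set y | mdist p y <= r] = mdist p @^-1` [set x | x <= r] by [].
by apply: closed_comp; [move=> x _; exact: continuous_mdist|exact: closed_le].
Qed.

Lemma bounded_closure (R : realType) (X : completeMetricType R) (p : X) (r : R)
    (S : set X) : (forall y, S y -> mdist p y <= r) -> bounded_subset (closure S).
Proof.
move=> Sr; exists (r + r) => x y Sx Sy.
have cl z : closure S z -> mdist p z <= r.
  move=> /(closure_subset (Sr : S `<=` [set y | mdist p y <= r])).
  by rewrite -(closure_id _).1//; exact: closed_mdist_le.
apply: (le_trans (metric_triangle x p y)); rewrite (metric_sym x p).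
by apply: lerD; exact: cl.
Qed.

Lemma continuous_eta_dist (R : realType) (X : completeMetricType R) (p : X) (k : int) :
  continuous ((fun y => eta k (mdist p y)) : X -> R).
Proof.
rewrite /eta; apply: continuous_minr; last by move=> x; exact: cvg_cst.
apply: continuous_maxr; last by move=> x; exact: cvg_cst.
move=> x; apply: cvgB; first exact: cvg_cst.
by apply: cvgMr; exact: continuous_mdist.
Qed.

Section pmG_to_box.
Context {R : realType} (X : nat -> pmms R) (Xo : pmms R) (Y : completeMetricType R).
Variables (io : forall n, X n -> Y) (ioo : Xo -> Y).
Hypotheses (sY : separable Y) (isoX : forall n, isometry (@io n)) (isoXo : isometry ioo).
Hypothesis ptcvg : (fun n => io (pmms_pt (X n))) @ \oo --> ioo (pmms_pt Xo).
Hypothesis test : forall f : Y -> R, continuous f ->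
  (exists M, forall y, `|f y| <= M) ->
  bounded_subset (closure [set y | f y != 0]) ->
  (fun n => (\int[pushforward (mms_measure (X n))
      (@io n : borel (X n) -> borel Y)]_y (f y)%:E)%E) @ \oo -->
  (\int[pushforward (mms_measure Xo) (ioo : borel Xo -> borel Y)]_y (f y)%:E)%E.

Let P := ioo (pmms_pt Xo).

Let mio n : measurable_fun setT (@io n : borel (X n) -> borel Y).
Proof. exact: measurable_isometry. Qed.
Let mioo : measurable_fun setT (ioo : borel Xo -> borel Y).
Proof. exact: measurable_isometry. Qed.

Let mcomp n (f : Y -> R) : continuous f -> measurable_fun setT (f \o @io n : borel (X n) -> R).
Proof. by move=> cf; exact: (measurableT_comp (continuous_borel_measurable cf) (@mio n)). Qed.
Let mcompo (f : Y -> R) : continuous f -> measurable_fun setT (f \o ioo : borel Xo -> R).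
Proof. by move=> cf; exact: (measurableT_comp (continuous_borel_measurable cf) mioo). Qed.

Let fin n (f : Y -> R) M r : continuous f -> (forall y, 0 <= f y <= M) ->
  (forall y, f y != 0 -> mdist P y < r) ->
  (\int[mms_measure (X n)]_x ((f \o @io n) x)%:E < +oo)%E.
Proof.
move=> cf fM fr.
apply: (@bounded_support_fin _ (X n) (pmms_pt (X n)) (r + mdist P (io (pmms_pt (X n)))) M).
- exact: mcomp.
- by move=> x; exact: fM.
- move=> x /fr /= Px; rewrite -(isoX (pmms_pt (X n)) x).
  have := metric_triangle (io (pmms_pt (X n))) P (io x).
  by rewrite (metric_sym (io (pmms_pt (X n))) P); lra.
Qed.

Let fino (f : Y -> R) M r : continuous f -> (forall y, 0 <= f y <= M) ->
  (forall y, f y != 0 -> mdist P y < r) ->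
  (\int[mms_measure Xo]_x ((f \o ioo) x)%:E < +oo)%E.
Proof.
move=> cf fM fr; apply: (@bounded_support_fin _ Xo (pmms_pt Xo) r M).
- exact: mcompo.
- by move=> x; exact: fM.
- by move=> x /fr /= Px; rewrite -(isoXo (pmms_pt Xo) x).
Qed.

Let test_real (f : Y -> R) M r : continuous f -> (forall y, 0 <= f y <= M) ->
  (forall y, f y != 0 -> mdist P y < r) ->
  (fun n => \int[mms_measure (X n)]_x (f \o @io n) x) @ \oo -->
  \int[mms_measure Xo]_x (f \o ioo) x.
Proof.
move=> cf fM fr; have f0 y : 0 <= f y by have /andP[] := fM y.
have mf : measurable_fun setT ((fun y => (f y)%:E) : borel Y -> \bar R).
  by apply/measurable_EFinP; exact: continuous_borel_measurable.
have h : (\int[mms_measure (X n)]_x ((f \o @io n) x)%:E)%E @[n --> \oo] -->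
    (\int[mms_measure Xo]_x ((f \o ioo) x)%:E)%E.
  have bf : exists M, forall y, `|f y| <= M.
    by exists M => y; have /andP[h1 h2] := fM y; rewrite ger0_norm.
  have sf : bounded_subset (closure [set y | f y != 0]).
    by apply: (@bounded_closure _ _ P r) => y /fr; exact: ltW.
  have := test cf bf sf.
  rewrite [X in _ --> X -> _](ge0_integral_pushforward mioo _ measurableT mf); last first.
    by move=> y _; rewrite lee_fin.
  rewrite (_ : (fun n => _) = (fun n => (\int[mms_measure (X n)]_x ((f \o @io n) x)%:E)%E))//.
  apply/funext => n; rewrite (ge0_integral_pushforward (@mio n) _ measurableT mf)//.
  by move=> y _; rewrite lee_fin.
rewrite (ge0_EFin_Rintegral _ (fino cf fM fr)) in h; last by move=> x; exact: f0.
exact: fine_cvg h.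
Qed.

(** A test function is fixed in [Y], whereas the cut-off follows the base point of [X n]. Recentring
    it at [P] costs, by the Lipschitz bound on [eta], a multiple of the displacement of the base
    points times an integral that converges and so stays bounded. *)
Lemma pmG_eta_integral (k : int) (phi : Y -> R) M : continuous phi ->
  (forall y, 0 <= phi y <= M) ->
  (fun n => \int[mms_measure (X n)]_x (phi (io x) * eta_dist k x)) @ \oo -->
  \int[mms_measure Xo]_x (phi (ioo x) * eta_dist k x).
Proof.
move=> cphi phiM.
have phi0 y : 0 <= phi y by have /andP[] := phiM y.
have M0 : 0 <= M by have /andP[h1 h2] := phiM P; exact: le_trans h2.
pose f y : R := phi y * eta k (mdist P y).
(* [chi] dominates the difference of the two cut-offs. It is 1 up to radius [4 * 2 ^ k], and beyond
   that both cut-offs vanish once the base points are closer than [2 ^ k]; radius [2 * 2 ^ k] would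
   leave no room for the displacement. *)
pose chi y : R := eta (k + 2) (mdist P y).
have cf : continuous f.
  by move=> y; apply: cvgM; [exact: cphi|exact: continuous_eta_dist].
have cchi : continuous chi by exact: continuous_eta_dist.
have fM y : 0 <= f y <= M.
  have /andP[h1 h2] := phiM y; rewrite mulr_ge0 ?eta_ge0//=.
  by rewrite (le_trans _ h2)// ler_piMr// eta_le1.
have chi1 y : 0 <= chi y <= 1 by rewrite eta_ge0 eta_le1.
have supp l y : eta l (mdist P y) != 0 -> mdist P y < 2 * 2 ^ l.
  by rewrite ltNge; apply: contra => /eta_far/eqP.
have fr y : f y != 0 -> mdist P y < 2 * 2 ^ k.
  by rewrite mulf_eq0 negb_or => /andP[_]; exact: supp.
have fcvg := test_real cf fM fr.
have chicvg := test_real cchi chi1 (supp (k + 2)).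
have -> : \int[mms_measure Xo]_x (phi (ioo x) * eta_dist k x) =
    \int[mms_measure Xo]_x (f \o ioo) x.
  by congr fine; apply: eq_integral => x _; rewrite /= /f /P isoXo.
pose del n := mdist P (io (pmms_pt (X n))).
have del0 : del @ \oo --> (0 : R).
  have -> : (0 : R) = mdist P P by rewrite mdistxx.
  exact: (continuous_cvg _ (@continuous_mdist _ _ P P) ptcvg).
pose c n := M * (2 ^ (- k) * del n).
have c_ge0 n : 0 <= c n by rewrite !mulr_ge0// ?mdist_ge0// ltW// exprz_gt0.
have k0 : 0 < 2 ^ k :> R by exact: exprz_gt0.
have close : \forall n \near \oo,
    `|\int[mms_measure (X n)]_x (phi (io x) * eta_dist k x) -
      \int[mms_measure (X n)]_x (f \o @io n) x| <=
    c n * \int[mms_measure (X n)]_x (chi \o @io n) x.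
  have /cvgrPdist_lt/(_ _ k0) := del0; apply: filterS => n.
  rewrite sub0r normrN (ger0_norm (mdist_ge0 _ _)) -/(del n) => deln.
  apply: Rintegral_close.
  - by apply: measurable_funM; [exact: mcomp|exact: measurable_eta_dist].
  - exact: mcomp.
  - exact: mcomp.
  - by move=> x; rewrite mulr_ge0 ?eta_ge0.
  - by move=> x; have /andP[] := fM (io x).
  - by move=> x; exact: eta_ge0.
  - exact: c_ge0.
  - move=> x; rewrite /= /f -mulrBr normrM ger0_norm//.
    have tri : `|mdist (pmms_pt (X n)) x - mdist P (io x)| <= del n.
      rewrite -(isoX (pmms_pt (X n)) x) (metric_sym _ (io x)) (metric_sym P).
      by rewrite (le_trans (ler_dist_mdist _ _ _))// metric_sym.
    have [far|near] := leP (2 ^ (k + 2)) (mdist P (io x)); last first.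
      rewrite [chi _]eta_near// mulr1 /c; apply: ler_pM => //.
        by have /andP[] := phiM (io x).
      apply: (le_trans (eta_lipschitz _ _ _)); apply: ler_pM => //.
      by rewrite ltW// exprz_gt0.
    have kk : 2 ^ (k + 2) = 4 * 2 ^ k :> R.
      by rewrite expfzDr// mulrC; congr (_ * _); rewrite -exprnP -natrX.
    rewrite kk in far; move: tri; rewrite ler_distl => /andP[t1 t2].
    have f1 : 2 * 2 ^ k <= mdist P (io x).
      by move: far k0; move: (2 ^ k) => K; lra.
    have f2 : 2 * 2 ^ k <= mdist (pmms_pt (X n)) x.
      by move: far deln t1 t2; move: (2 ^ k) (del n) => K D; lra.
    rewrite /eta_dist !eta_far// subrr normr0 mulr0.
    by rewrite mulr_ge0 ?eta_ge0.
  - exact: (mul_eta_dist_fin k (mcomp cphi) (fun x => phiM (io x))).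
  - exact: fin cf fM fr.
  - exact: fin cchi chi1 (supp (k + 2)).
have ccvg : (fun n => c n * \int[mms_measure (X n)]_x (chi \o @io n) x) @ \oo --> (0 : R).
  rewrite -[X in _ --> X](mul0r (\int[mms_measure Xo]_x (chi \o ioo) x)).
  apply: cvgM => //; rewrite -[X in _ --> X](mulr0 M).
  apply: cvgMr; rewrite -[X in _ --> X](mulr0 (2 ^ (- k))).
  exact: cvgMr.
have dcvg : (fun n => \int[mms_measure (X n)]_x (phi (io x) * eta_dist k x) -
      \int[mms_measure (X n)]_x (f \o @io n) x) @ \oo --> (0 : R).
  apply/cvgrPdist_le => e e0; have /cvgrPdist_le/(_ _ e0) := ccvg.
  move: close; apply: filterS2 => n h1; rewrite !sub0r !normrN => h2.
  exact: le_trans (le_trans h1 (ler_norm _)) h2.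
rewrite -[X in _ --> X]add0r.
pose A n := \int[mms_measure (X n)]_x (phi (io x) * eta_dist k x).
pose B n := \int[mms_measure (X n)]_x (f \o @io n) x.
have -> : (fun n => A n) = (fun n => A n - B n + B n).
  by apply/funext => n; rewrite subrK.
exact: cvgD.
Qed.

Lemma pmG_eta_mass (k : int) : (fun n => eta_mass (X n) k) @ \oo --> eta_mass Xo k.
Proof.
have c1 : continuous (cst 1 : Y -> R) by move=> x; exact: cvg_cst.
have c1M y : 0 <= (cst 1 : Y -> R) y <= 1 by rewrite ler01 lexx.
have h := @pmG_eta_integral k _ _ c1 c1M.
have E (Z : pmms R) (g : Z -> Y) :
    \int[mms_measure Z]_x ((cst 1 : Y -> R) (g x) * eta_dist k x) = eta_mass Z k.
  by congr fine; apply: eq_integral => x _; rewrite /= mul1r.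
by rewrite E in h; under eq_fun do rewrite -(E _ (@io _)).
Qed.

Let jn n k := @j_nmms R (cut_pmms (X n) k) (cut_measure_setT (X n) k).
Let jo k := @j_nmms R (cut_pmms Xo k) (cut_measure_setT Xo k).

Lemma pmG_box (k : int) : (fun n => box_rep (jn n k) (jo k)) @ \oo --> (0 : R).
Proof.
(* The factor 8 is the distortion: two pairs of points, each within [4 * e] in [Y]. The loss of
   measure is only [e]. *)
apply/cvgrPdist_le => e' e'0; have [e [e0 ee']] : exists e, 0 < e /\ 8 * e <= e'.
  by exists (e' / 8); split; [rewrite divr_gt0|lra].
have [u du] := separable_seq sY.
pose phi i := @partition_fun R Y u e i.
have cphi i : continuous (phi i) by exact: continuous_partition_fun.
have phiM i y : 0 <= phi i y <= 1 by rewrite partition_fun_ge0 partition_fun_le1.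
pose I (Z : pmms R) (g : Z -> Y) i : R :=
  3^-1 * ((eta_mass Z k)^-1 * \int[mms_measure Z]_x (phi i (g x) * eta_dist k x)
           + 2 * phi i (g (pmms_pt Z))).
have IE n i : (\int[mms_measure (jn n k)]_x ((phi i \o @io n) x)%:E)%E = (I (X n) (@io n) i)%:E.
  by apply: (integral_j_cut k (mcomp (cphi i))) => x; exact: phiM.
have IEo i : (\int[mms_measure (jo k)]_x ((phi i \o ioo) x)%:E)%E = (I Xo ioo i)%:E.
  by apply: (integral_j_cut k (mcompo (cphi i))) => x; exact: phiM.
have Icvg i : (fun n => I (X n) (@io n) i) @ \oo --> I Xo ioo i.
  apply: cvgMr; apply: cvgD.
    apply: cvgM; last exact: (pmG_eta_integral (cphi i) (phiM i)).
    by apply: cvgV; [rewrite gt_eqF// eta_mass_gt0|exact: pmG_eta_mass].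
  apply: cvgMr; exact: (continuous_cvg _ (cphi i P) ptcvg).
have mj : measurable_fun setT (ioo : borel (jo k) -> borel Y) by exact: mioo.
(* Keeping [N] pieces turns the convergence of each integral into a uniform one; in the limit these
   pieces carry mass above [1 - e]. *)
have [N Na] : exists n, 1 - e < \sum_(i < n) I Xo ioo i.
  apply: (@partition_fun_exhaust R Y u e du e0 (push_measure (mms_measure (jo k)) mj)) => //.
    by rewrite /= /pushforward preimage_setT; exact: (nmms_mass1 (jo k)).
  move=> i; rewrite ge0_integral_pushforward//; first exact: IEo.
    by apply/measurable_EFinP; exact: continuous_borel_measurable.
  by move=> y _; rewrite lee_fin partition_fun_ge0.
have mincvg : (fun n => \sum_(i < N) Num.min (I (X n) (@io n) i) (I Xo ioo i)) @ \oo -->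
    \sum_(i < N) I Xo ioo i.
  apply: cvg_big => [|i _]; first exact: add_continuous.
  rewrite [X in _ --> X](_ : _ = (I Xo ioo i + I Xo ioo i - `|I Xo ioo i - I Xo ioo i|) / 2);
    last by rewrite subrr normr0; lra.
  under eq_fun do rewrite minr_absE.
  apply: cvgMl; apply: cvgB; first by apply: cvgD => //; exact: cvg_cst.
  by apply: cvg_norm; apply: cvgB => //; exact: cvg_cst.
have : \forall n \near \oo, 1 - e < \sum_(i < N) Num.min (I (X n) (@io n) i) (I Xo ioo i).
  exact: (cvgr_gt _ mincvg).
apply: filterS => n sn; rewrite sub0r normrN ger0_norm ?box_rep_ge0//.
apply: le_trans ee'.
have sum1 (Z : Type) (g : Z -> Y) x : \sum_(i < N) (phi i \o g) x <= 1.
  by rewrite /= sum_partition_fun bump_max_le1.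
have [p [q [J [[mp mq] pE qE [mJ J1 Ja] Jphi]]]] :=
  @aligned_parameters R _ _ (borel (jn n k)) (borel (jo k))
  (mms_measure (jn n k)) (mms_measure (jo k))
  (fun i => phi i \o @io n) (fun i => phi i \o ioo) _ _ N
  (parametrizable_polish (mms_separable (jn n k)))
  (parametrizable_polish (mms_separable (jo k)))
  (nmms_mass1 (jn n k)) (nmms_mass1 (jo k))
  (fun i => mcomp (cphi i)) (fun i => mcompo (cphi i))
  (fun i x => partition_fun_ge0 _ _ _ _) (fun i x => partition_fun_ge0 _ _ _ _)
  (sum1 _ _) (sum1 _ _) (IE n) IEo.
apply: (@box_rep_ub _ (jn n k) (jo k) p q).
- by split => //; exact: measurable_funTS.
- by split => //; exact: measurable_funTS.
- by lra.
exists J; split => //.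
  by apply: le_trans Ja; rewrite lee_fin; lra.
move=> t t' /Jphi[i [pi qi]] /Jphi[i' [pi' qi']].
have close j x y : 0 < phi j x -> 0 < phi j y -> mdist x y <= 4 * e.
  move=> /(partition_fun_near e0) hx /(partition_fun_near e0) hy.
  have := metric_triangle x (u j) y; rewrite (metric_sym x (u j)); lra.
have h1 := close _ _ _ pi qi; have h2 := close _ _ _ pi' qi'.
rewrite -(isoX (p t) (p t')) -(isoXo (q t) (q t')).
have t1 := ler_dist_mdist (io (p t)) (io (p t')) (ioo (q t')).
have t2 := ler_dist_mdist (ioo (q t')) (io (p t)) (ioo (q t)).
rewrite !(metric_sym (ioo (q t'))) in t2.
move: t1 t2; rewrite !ler_distl => /andP[a1 a2] /andP[b1 b2].
by apply/andP; split; lra.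
Qed.

End pmG_to_box.

(** * Gluing metric spaces along a common hub *)

(* The spaces [leaf n] are glued along the distances [bridge] to the hub [leaf 0]. *)
Record bridges (R : realType) := Bridges {
  leaf : nat -> completeMetricType R;
  bridge : forall n, leaf n -> leaf 0 -> R;
  bridge0 : forall x y : leaf 0, bridge x y = mdist x y;
  bridge_leaf : forall n (x x' : leaf n) y, mdist x x' <= bridge x y + bridge x' y;
  bridge_hub : forall n (x : leaf n) y y', mdist y y' <= bridge x y + bridge x y';
  bridge_leafL : forall n (x x' : leaf n) y, bridge x y <= mdist x x' + bridge x' y;
  bridge_hubR : forall n (x : leaf n) y y', bridge x y <= bridge x y' + mdist y' y;
  bridge_gap : forall n, n != 0%N -> exists2 e : R, 0 < e &
    forall (x : leaf n) y, e <= bridge x y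
}.

Section glue.
Context {R : realType} (G : bridges R).

Definition glued : Type := {n : nat & leaf G n}.
HB.instance Definition _ := Choice.copy glued {n : nat & leaf G n}.

Definition via (u v : glued) : R :=
  inf [set r | exists y, r = bridge (tagged u) y + bridge (tagged v) y].

(** By [bridge_leaf] a detour through the hub never shortens a distance inside a leaf, so leaves
    embed isometrically. Between different leaves the gap of a bridge keeps points apart. *)
Definition gdist (u v : glued) : R :=
  if tag u == tag v then mdist (tagged u) (tagged_as u v) else via u v.

Lemma bridge_ge0 n (x : leaf G n) y : 0 <= bridge x y.
Proof. by have := bridge_leaf x x y; rewrite mdistxx; lra. Qed.

Lemma via_le u v y : via u v <= bridge (tagged u) y + bridge (tagged v) y.
Proof.
apply: ge_inf; last by exists y.
by exists 0 => _ [z ->]; rewrite addr_ge0// bridge_ge0.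
Qed.

Lemma le_via u v r :
  (forall y, r <= bridge (tagged u) y + bridge (tagged v) y) -> r <= via u v.
Proof.
move=> h; apply: lb_le_inf; last by move=> _ [y ->]; exact: h.
by exists (bridge (tagged u) point + bridge (tagged v) point), point.
Qed.

Lemma viaC u v : via u v = via v u.
Proof.
by rewrite /via; congr inf; apply/seteqP; split => _ [y ->]; exists y; rewrite addrC.
Qed.

Lemma gdist_same n (x y : leaf G n) :
  gdist (Tagged (leaf G) x) (Tagged (leaf G) y) = mdist x y.
Proof. by rewrite /gdist /= eqxx tagged_asE. Qed.

Lemma gdist_diff u v : tag u != tag v -> gdist u v = via u v.
Proof. by rewrite /gdist => /negbTE ->. Qed.

Lemma gdistC u v : gdist u v = gdist v u.
Proof.
have [|uv] := eqVneq (tag u) (tag v); last first.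
  by rewrite (gdist_diff uv) gdist_diff 1?eq_sym// viaC.
case: u v => [n x] [m y] /= nm; case: m / nm y => y.
by rewrite !gdist_same metric_sym.
Qed.

Lemma gdistxx u : gdist u u = 0.
Proof. by case: u => n x; rewrite gdist_same mdistxx. Qed.

Lemma gdist_le_via u v : gdist u v <= via u v.
Proof.
have [|uv] := eqVneq (tag u) (tag v); last by rewrite gdist_diff.
case: u v => [n x] [m y] /= nm; case: m / nm y => y.
by rewrite gdist_same; apply: le_via => z; exact: bridge_leaf.
Qed.

Lemma via_gt0 u v : tag u != tag v -> 0 < via u v.
Proof.
wlog u0 : u v / tag u != 0%N.
  move=> H uv; have [u0|u0] := eqVneq (tag u) 0%N; last exact: H.
  by rewrite viaC; apply: H; rewrite eq_sym ?u0 // -u0.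
have [e e0 ge] := @bridge_gap _ G _ u0 => uv.
apply: (lt_le_trans e0); apply: le_via => y.
by rewrite (le_trans (ge (tagged u) y))// lerDl bridge_ge0.
Qed.

Lemma gdist_eq0 u v : gdist u v = 0 -> u = v.
Proof.
have [|uv] := eqVneq (tag u) (tag v); last first.
  by rewrite gdist_diff// => uv0; have := via_gt0 uv; rewrite uv0 ltxx.
case: u v => [n x] [m y] /= nm; case: m / nm y => y.
by rewrite gdist_same => /mdist_positivity ->.
Qed.

(** The hub points used on the two sides of [v] are, by [bridge_hub], no farther apart than the cost
    of going up to [v] and back, so [v] can be bypassed inside the hub. *)
Lemma via_triangle u v w : via u w <= via u v + via v w.
Proof.
rewrite -lerBlDl; apply: le_via => y; rewrite lerBlDl -lerBlDr; apply: le_via => y'.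
have := via_le u w y'; have := bridge_hub (tagged v) y y'.
have := bridge_hubR (tagged w) y' y; lra.
Qed.

Lemma gdist_via u v w : via u w <= gdist u v + via v w.
Proof.
have [|uv] := eqVneq (tag u) (tag v); last by rewrite gdist_diff// via_triangle.
case: u v => [n x] [m y] /= nm; case: m / nm y => y; rewrite gdist_same.
rewrite -lerBlDl; apply: le_via => z; rewrite lerBlDl.
apply: (le_trans (via_le _ _ z)) => /=; rewrite addrA lerD2r.
exact: bridge_leafL.
Qed.

Lemma gdist_triangle v u w : gdist u w <= gdist u v + gdist v w.
Proof.
have [vw|vw] := eqVneq (tag v) (tag w); last first.
  by rewrite (gdist_diff vw); apply: le_trans (gdist_le_via _ _) (gdist_via _ _ _).
have [uv|uv] := eqVneq (tag u) (tag v); last first.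
  rewrite (gdist_diff uv) (gdistC v w) addrC viaC gdistC.
  exact: le_trans (gdist_le_via _ _) (gdist_via _ _ _).
case: u v w uv vw => [n x] [m y] [l z] /= nm ml.
case: m / nm y ml => y ml; case: l / ml z => z.
by rewrite !gdist_same metric_triangle.
Qed.

HB.instance Definition _ := isMetric.Build R glued gdistxx gdist_eq0 gdistC gdist_triangle.

Definition glued_in n (x : leaf G n) : glued := Tagged (leaf G) x.

Lemma glued_in_isometry n (x y : leaf G n) :
  mdist (glued_in x) (glued_in y) = mdist x y.
Proof. exact: gdist_same. Qed.

Lemma mdist_gluedE (u v : glued) : mdist u v = gdist u v.
Proof. by []. Qed.

Lemma hub_le_bridge n (x : leaf G n) y : mdist (glued_in x) (glued_in y) <= bridge x y.
Proof.
rewrite mdist_gluedE (le_trans (gdist_le_via _ _))//.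
by apply: (le_trans (via_le _ _ y)); rewrite /= bridge0 mdistxx addr0.
Qed.

(** Either the sequence stays in one leaf from some index on, and that leaf is complete, or after
    every index it still changes leaf. A short step between leaves passes near the hub, so in the
    second case hub points shadow the sequence and form a Cauchy sequence in the complete hub. *)
Let glued_seq_cvg (a : nat -> glued) :
  (forall k l, (k <= l)%N -> mdist (a k) (a l) <= 2 / k.+1%:R) ->
  exists x : glued, a @ \oo --> x.
Proof.
move=> ca; have [[N sameN]|diff] :=
    pselect (exists N, forall n, (N <= n)%N -> tag (a n) = tag (a N)).
  have /choice[b bE] : forall n, exists y : leaf G (tag (a N)), a (N + n)%N = glued_in y.
    move=> n; have := sameN _ (leq_addr n N).
    by case: (a (N + n)%N) => m y /= mN; case: _ / mN; exists y.
  have [y by_] : exists y : leaf G (tag (a N)), b @ \oo --> y.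
    apply: (@mdist_cauchy_cvg _ _ _ 2) => k l kl.
    rewrite -glued_in_isometry -!bE (le_trans (ca _ _ _)) ?leq_add2l//.
    by rewrite ler_pM2l// lef_pV2 ?posrE// ler_nat ltnS leq_addl.
  exists (glued_in y); apply/mdist_cvgP => e e0.
  have /mdist_cvgP/(_ _ e0)[M My] := by_; exists (N + M)%N => n NMn.
  have Nn : (N <= n)%N by exact: leq_trans (leq_addr _ _) NMn.
  by rewrite -(subnKC Nn) bE glued_in_isometry My// leq_subRL.
have /choice[y yP] : forall k, exists y : leaf G 0,
    mdist (a k) (glued_in y) <= 3 / k.+1%:R.
  move=> k; have [n kn tn] : exists2 n, (k <= n)%N & tag (a k) != tag (a n).
    apply: contrapT => h; apply: diff; exists k => n kn; apply/eqP.
    by rewrite eq_sym; apply/negPn/negP => tn; apply: h; exists n.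
  (* The 2 of the Cauchy rate is raised to 3 for a strict inequality, which the choice of a nearly
     optimal hub point requires. *)
  have : via (a k) (a n) < 3 / k.+1%:R.
    rewrite -gdist_diff// -mdist_gluedE (le_lt_trans (ca _ _ kn))//.
    by rewrite ltr_pM2r ?invr_gt0// ltr_nat.
  move=> /inf_lt[|_ [y ->] yk]; first by eexists; exists point.
  exists y; have := hub_le_bridge (tagged (a k)) y.
  rewrite /glued_in taggedK => /le_trans; apply; apply: le_trans (ltW yk).
  by rewrite lerDl bridge_ge0.
have [z yz] : exists z : leaf G 0, y @ \oo --> z.
  apply: (@mdist_cauchy_cvg _ _ _ 8) => k l kl.
  rewrite -glued_in_isometry (le_trans (metric_triangle _ (a k) _))//.
  have -> : 8 = 3 + (2 + 3) :> R by lra.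
  rewrite (mulrDl 3 (2 + 3)) (mulrDl 2 3) lerD//; first by rewrite metric_sym; exact: yP.
  rewrite (le_trans (metric_triangle _ (a l) _))// lerD ?ca//.
  by rewrite (le_trans (yP l))// ler_pM2l// lef_pV2 ?posrE// ler_nat.
exists (glued_in z); apply/mdist_cvgP => e e0.
have e2 : 0 < e / 2 by lra.
have e6 : 0 < e / 6 by lra.
have /mdist_cvgP/(_ _ e2)[M My] := yz; have [K Ke] := natSinv_lt e6.
exists (maxn M K) => n; rewrite geq_max => /andP[Mn Kn].
apply: (le_lt_trans (metric_triangle _ (glued_in (y n)) _)).
rewrite glued_in_isometry [e]splitr ltrD ?My// metric_sym (le_lt_trans (yP n))//.
apply: (@le_lt_trans _ _ (3 / K.+1%:R)).
  by rewrite ler_pM2l// lef_pV2 ?posrE// ler_nat.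
by rewrite mulrC -ltr_pdivlMr//; move: Ke; congr (_ < _); lra.
Qed.

HB.instance Definition _ := isPointed.Build glued (glued_in (point : leaf G 0)).

Let glued_complete (F : set_system glued) : ProperFilter F -> cauchy F -> cvg F.
Proof.
move=> FF /cauchyP cF.
have /choice[a aF] : forall k, exists x : glued, F (ball x (k.+1%:R^-1 : R)).
  by move=> k; apply: cF; rewrite invr_gt0.
have [k l kl|x ax] := glued_seq_cvg (a := a).
  have [z [] ] := filter_ex (filterI (aF k) (aF l)).
  rewrite !ballEmdist /= => kz lz; rewrite (le_trans (metric_triangle _ z _))//.
  rewrite mulrDl mul1r lerD//; first exact: ltW.
  by rewrite metric_sym (le_trans (ltW lz))// lef_pV2 ?posrE// ler_nat.
apply/cvg_ex; exists x; move=> A; rewrite -nbhs_ballE => -[e /= e0 eA].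
have e2 : 0 < e / 2 by lra.
have /mdist_cvgP/(_ _ e2)[M Mx] := ax; have [K Ke] := natSinv_lt e2.
apply: filterS (aF (maxn M K)) => z; rewrite ballEmdist /= => az; apply: eA.
rewrite ballEmdist /= (le_lt_trans (metric_triangle _ (a (maxn M K)) _))//.
rewrite [e]splitr ltrD ?Mx ?leq_maxl// (lt_trans az)// (le_lt_trans _ Ke)//.
by rewrite lef_pV2 ?posrE// ler_nat ltnS leq_maxr.
Qed.

HB.instance Definition _ := Uniform_isComplete.Build glued glued_complete.

Lemma glued_separable : (forall n, separable (leaf G n)) ->
  separable (glued : completeMetricType R).
Proof.
move=> sG; pose D n := s2val (cid2 (sG n)).
have cD n : countable (D n) by exact: (s2valP (cid2 (sG n))).
have dD n : dense (D n) by exact: (s2valP' (cid2 (sG n))).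
exists (\bigcup_n (@glued_in n @` D n)).
  apply: bigcup_countable => // n _; apply: sub_countable (cD n).
  exact: card_image_le.
move=> O [u Ou] oO; case: u Ou => n x Ox.
have : nbhs (glued_in x) O by exact: open_nbhs_nbhs.
rewrite -nbhs_ballE => -[e /= e0 eO].
have [] := dD n (ball x e) _ (open_mball x e).
  by exists x; exact: ballxx.
move=> y [xy Dy]; exists (glued_in y); split; last by exists n => //; exists y.
by apply: eO; rewrite ballEmdist /= glued_in_isometry; move: xy; rewrite ballEmdist.
Qed.

End glue.

(** * Lipschitz test functions suffice *)

Definition lipschitz_by (R : realType) (Y : completeMetricType R) (L : R) (f : Y -> R) :=
  forall x y, `|f x - f y| <= L * mdist x y.

Lemma lipschitz_by_continuous (R : realType) (Y : completeMetricType R) (L : R) (f : Y -> R) :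
  lipschitz_by L f -> continuous f.
Proof.
move=> Lf x; apply/cvgrPdist_lt => e e0.
have L0 : 0 < `|L| + 1 by rewrite ltr_wpDl.
near=> z; apply: (le_lt_trans (Lf x z)).
have : mdist x z < e / (`|L| + 1).
  by near: z; apply: metricType_numDomainType.cvgr_dist_lt; [exact: cvg_id|rewrite divr_gt0].
rewrite ltr_pdivlMr// mulrC; apply: le_lt_trans; rewrite ler_wpM2r ?mdist_ge0//.
by rewrite (le_trans (ler_norm L))// lerDl.
Unshelve. all: by end_near. Qed.

Section inf_convolution.
Context {R : realType} (Y : completeMetricType R) (g : Y -> R) (C : R).
Hypotheses (cg : continuous g) (g0C : forall y, 0 <= g y <= C).

(** The Pasch-Hausdorff envelope: the largest [j]-Lipschitz function below [g]. *)
Definition inf_conv (j : nat) (y : Y) : R :=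
  inf [set r | exists z, r = g z + j%:R * mdist y z].

Let g0 y : 0 <= g y. Proof. by have /andP[] := g0C y. Qed.

Lemma inf_conv_le j y z : inf_conv j y <= g z + j%:R * mdist y z.
Proof.
apply: ge_inf; last by exists z.
by exists 0 => _ [w ->]; rewrite addr_ge0// mulr_ge0// mdist_ge0.
Qed.

Lemma le_inf_conv j y r : (forall z, r <= g z + j%:R * mdist y z) -> r <= inf_conv j y.
Proof.
move=> h; apply: lb_le_inf; last by move=> _ [z ->]; exact: h.
by exists (g y + j%:R * mdist y y), y.
Qed.

Lemma inf_conv_ge0 j y : 0 <= inf_conv j y.
Proof. by apply: le_inf_conv => z; rewrite addr_ge0// mulr_ge0// mdist_ge0. Qed.

Lemma inf_conv_le_fun j y : inf_conv j y <= g y.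
Proof. by have := inf_conv_le j y y; rewrite mdistxx mulr0 addr0. Qed.

Lemma inf_conv_lipschitz j : lipschitz_by j%:R (inf_conv j).
Proof.
have h x y : inf_conv j x <= inf_conv j y + j%:R * mdist x y.
  rewrite -lerBlDr; apply: le_inf_conv => z; rewrite lerBlDr -addrA -mulrDr.
  apply: (le_trans (inf_conv_le j x z)); rewrite lerD2l ler_wpM2l//.
  by rewrite addrC metric_triangle.
move=> x y; have h1 := h x y; have := h y x; rewrite (metric_sym y x) => h2.
by rewrite ler_distl; apply/andP; split; lra.
Qed.

Lemma inf_conv_nd y : {homo inf_conv^~ y : i j / (i <= j)%N >-> i <= j}.
Proof.
move=> i j ij; apply: le_inf_conv => z; apply: (le_trans (inf_conv_le i y z)).
by rewrite lerD2l ler_wpM2r ?mdist_ge0// ler_nat.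
Qed.

Lemma inf_conv_cvg y : inf_conv^~ y @ \oo --> g y.
Proof.
have C0 : 0 <= C by have /andP[h1 h2] := g0C y; exact: le_trans h2.
apply/cvgrPdist_le => e e0; have /cvgrPdist_lt/(_ _ e0) := @cg y.
rewrite -nbhs_ballE => -[d /= d0 dg].
(* Once [j * d > C], points at distance [d] or more cost at least [C], hence at least [g y], so only
   nearby points can lower the infimum. *)
exists (Num.truncn (C / d)).+1 => // j /= jC.
rewrite ger0_norm ?subr_ge0 ?inf_conv_le_fun// lerBlDr -lerBlDl.
apply: le_inf_conv => z; have [yz|yz] := ltP (mdist y z) d.
  have := dg z; rewrite ballEmdist => /(_ yz); rewrite /= ltr_distl => /andP[h1 h2].
  have : 0 <= j%:R * mdist y z by rewrite mulr_ge0// mdist_ge0.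
  by lra.
have /andP[_ gC] := g0C y; have := g0 z.
suff : C <= j%:R * mdist y z by lra.
have : C / d < j%:R by rewrite (lt_le_trans (Num.Theory.truncnS_gt _))// ler_nat.
rewrite ltr_pdivrMr// => /ltW/le_trans; apply.
by rewrite ler_wpM2l.
Qed.

End inf_convolution.

Section portmanteau.
Context {R : realType} (Y : completeMetricType R) (P : Y).
Variables (mu : nat -> {measure set (borel Y) -> \bar R}) (nu : {measure set (borel Y) -> \bar R}).
Hypothesis mufin : forall n r, (mu n (ball P r) < +oo)%E.
Hypothesis nufin : forall r, (nu (ball P r) < +oo)%E.
Hypothesis lip_test : forall (f : Y -> R) L M r, lipschitz_by L f ->
  (forall y, 0 <= f y <= M) -> (forall y, f y != 0 -> mdist P y < r) ->
  (fun n => \int[mu n]_y f y) @ \oo --> \int[nu]_y f y.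

Let supp_fin (m : {measure set (borel Y) -> \bar R}) (f : Y -> R) (M r : R) :
  (forall r, (m (ball P r) < +oo)%E) -> measurable_fun setT (f : borel Y -> R) ->
  (forall y, 0 <= f y <= M) -> (forall y, f y != 0 -> mdist P y < r) ->
  (\int[m]_y (f y)%:E < +oo)%E.
Proof.
move=> mfin mf fM fr.
have mB : measurable (ball P r : set (borel Y)) by apply: borel_open; exact: open_mball.
have M0 : 0 <= M by have /andP[h1 h2] := fM P; exact: le_trans h2.
apply: (@ge0_integral_fin_le _ (borel Y) R m f (\1_(ball P r)) M) => //.
- by move=> x; have /andP[] := fM x.
- move=> x; rewrite indicE; have [fx|fx] := eqVneq (f x) 0; first by rewrite fx mulr_ge0.
  rewrite mem_set; first by rewrite mulr1; have /andP[] := fM x.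
  by rewrite ballEmdist /=; exact: fr.
- by rewrite integral_indic// setIT; exact: mfin.
Qed.

(** Approximation from below by the envelopes yields a one-sided bound. The envelopes lie between 0
    and [g], so they vanish where [g] does and are admissible in [lip_test]. *)
Let lower_nonneg (g : Y -> R) (C r e : R) : continuous g -> (forall y, 0 <= g y <= C) ->
  (forall y, g y != 0 -> mdist P y < r) -> 0 < e ->
  \forall n \near \oo, \int[nu]_y g y - e < \int[mu n]_y g y.
Proof.
move=> cg gC gr e0.
have g0 y : 0 <= g y by have /andP[] := gC y.
have mg := continuous_borel_measurable cg.
have mh j : measurable_fun setT (inf_conv g j : borel Y -> R).
  by apply: continuous_borel_measurable; exact: lipschitz_by_continuous (inf_conv_lipschitz gC j).
have hC j y : 0 <= inf_conv g j y <= C.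
  rewrite (inf_conv_ge0 gC) (le_trans (inf_conv_le_fun gC j y))//.
  by have /andP[] := gC y.
have hr j y : inf_conv g j y != 0 -> mdist P y < r.
  move=> h; apply: gr; apply: contra h => /eqP gy; rewrite eq_le.
  by rewrite (inf_conv_ge0 gC) andbT -gy (inf_conv_le_fun gC).
have gfin (m : {measure set (borel Y) -> \bar R}) : (forall r, (m (ball P r) < +oo)%E) ->
    (\int[m]_y (g y)%:E < +oo)%E.
  by move=> mfin; exact: (supp_fin mfin mg gC gr).
have : (fun j => \int[nu]_y inf_conv g j y) @ \oo --> \int[nu]_y g y.
  have : (\int[nu]_y (inf_conv g j y)%:E)%E @[j --> \oo] --> (\int[nu]_y (g y)%:E)%E.
    have lim_g y : (inf_conv g j y)%:E @[j --> \oo] --> (g y)%:E.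
      by apply: cvg_EFin; [exact: nearW|exact: (inf_conv_cvg cg gC)].
    have -> : (\int[nu]_y (g y)%:E = \int[nu]_y (lim ((inf_conv g j y)%:E @[j --> \oo])))%E.
      by apply: eq_integral => y _; rewrite (cvg_lim _ (lim_g y)).
    apply: cvg_monotone_convergence => //.
    - by move=> j; exact/measurable_EFinP.
    - by move=> j y _; rewrite lee_fin (inf_conv_ge0 gC).
    - by move=> y _ i j ij; rewrite lee_fin (inf_conv_nd gC).
  rewrite (ge0_EFin_Rintegral _ (gfin nu nufin))// => h; exact: fine_cvg h.
have e2 : 0 < e / 2 by lra.
move=> /cvgrPdist_lt/(_ _ e2)[j _ /(_ j (leqnn j))] /=.
rewrite ltr_distl => /andP[_ hj].
have /cvgrPdist_lt/(_ _ e2) := lip_test (inf_conv_lipschitz gC j) (hC j) (@hr j).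
apply: filterS => n; rewrite ltr_distl => /andP[_ hn].
suff : \int[mu n]_y inf_conv g j y <= \int[mu n]_y g y by lra.
rewrite -lee_fin -!ge0_EFin_Rintegral//.
- apply: ge0_le_integral => //.
  + by move=> y _; rewrite lee_fin (inf_conv_ge0 gC).
  + exact/measurable_EFinP.
  + exact/measurable_EFinP.
  + by move=> y _; rewrite lee_fin (inf_conv_le_fun gC).
- exact: gfin (mufin n).
- by move=> y; rewrite (inf_conv_ge0 gC).
- exact: (supp_fin (mufin n) (mh j) (hC j) (@hr j)).
Qed.

Let cutoff (r : R) (y : Y) : R := Num.min 1 (Num.max 0 (r - mdist P y)).

Let cutoff_lip r : lipschitz_by 1 (cutoff r).
Proof.
move=> x y; rewrite mul1r; have := ler_dist_mdist P x y.
rewrite /cutoff; move: (mdist x y) (mdist P x) (mdist P y) => D a b.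
have E z : [\/ r - z <= 0 /\ Num.min 1 (Num.max 0 (r - z)) = 0,
    0 <= r - z <= 1 /\ Num.min 1 (Num.max 0 (r - z)) = r - z |
    1 <= r - z /\ Num.min 1 (Num.max 0 (r - z)) = 1].
  have [z0|z0] := leP (r - z) 0; first by apply: Or31; rewrite min_r.
  have [z1|z1] := leP 1 (r - z); first by apply: Or33.
  by apply: Or32; split => //; apply/andP; split; exact: ltW.
rewrite !ler_distl => /andP[h1 h2].
by case: (E a) => -[? ->]; case: (E b) => -[? ->]; apply/andP; split; lra.
Qed.

Let cutoff01 r y : 0 <= cutoff r y <= 1.
Proof. by rewrite /cutoff le_min ler01 le_max lexx ge_min lexx. Qed.

Let cutoff_supp r y : cutoff r y != 0 -> mdist P y < r.
Proof.
rewrite ltNge; apply: contra => h; rewrite /cutoff (@max_l _ _ (0 : R)) ?subr_le0//.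
by rewrite min_r.
Qed.

Let cutoff1 r y : mdist P y < r -> cutoff (r + 1) y = 1.
Proof.
move=> h; rewrite /cutoff min_l// le_max; apply/orP; right; lra.
Qed.

Lemma signed_integrable (m : {measure set (borel Y) -> \bar R}) (f : Y -> R) (M r : R) :
  (forall r, (m (ball P r) < +oo)%E) -> continuous f -> (forall y, `|f y| <= M) ->
  (forall y, f y != 0 -> mdist P y < r) -> m.-integrable setT (EFin \o f : borel Y -> \bar R).
Proof.
move=> mfin cf fM fr; have mf := continuous_borel_measurable cf.
apply/integrableP; split; first exact/measurable_EFinP.
have -> : (\int[m]_y `|(EFin \o f) y| = \int[m]_y (`|f y|)%:E)%E by apply: eq_integral.
apply: (@supp_fin m (fun y => `|f y|) M r) => //.
- exact: measurableT_comp mf.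
- by move=> y; rewrite normr_ge0 fM.
- by move=> y; rewrite normr_eq0; exact: fr.
Qed.

Let lower (f : Y -> R) (M r e : R) : continuous f -> (forall y, `|f y| <= M) ->
  (forall y, f y != 0 -> mdist P y < r) -> 0 < e ->
  \forall n \near \oo, \int[nu]_y f y - e < \int[mu n]_y f y.
Proof.
move=> cf fM fr e0.
have M0 : 0 <= M by exact: le_trans (fM P).
pose chi := cutoff (r + 1).
have cchi : continuous chi by exact: lipschitz_by_continuous (cutoff_lip (r + 1)).
(* Adding [M * chi] makes the function nonnegative, since [chi] is 1 wherever [f] is nonzero. As
   [chi] is itself Lipschitz, its integrals converge and can be subtracted again. *)
pose g y := f y + M * chi y.
have cg : continuous g by move=> y; apply: cvgD; [exact: cf|apply: cvgMr; exact: cchi].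
have gC y : 0 <= g y <= M + M.
  have /andP[c0 c1] := cutoff01 (r + 1) y; rewrite /g.
  have [fy|fy] := eqVneq (f y) 0.
    rewrite fy add0r mulr_ge0//= (@le_trans _ _ M)// ?ler_piMr// lerDl//.
  rewrite /chi cutoff1 ?fr// mulr1; have := fM y; rewrite ler_norml => /andP[h1 h2].
  by apply/andP; split; lra.
have gr y : g y != 0 -> mdist P y < r + 1.
  apply: contraNT; rewrite -leNgt => h; rewrite /g.
  have -> : f y = 0 by apply/eqP/negPn/negP => /fr; lra.
  rewrite /chi; have [->|/cutoff_supp] := eqVneq (cutoff (r + 1) y) 0; last by lra.
  by rewrite mulr0 addr0.
have chi_abs y : `|chi y| <= 1.
  by have /andP[c0 c1] := cutoff01 (r + 1) y; rewrite ger0_norm.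
have decomp (m : {measure set (borel Y) -> \bar R}) : (forall r, (m (ball P r) < +oo)%E) ->
    \int[m]_y g y = \int[m]_y f y + M * \int[m]_y chi y.
  move=> mfin; have ichi := signed_integrable mfin cchi chi_abs (@cutoff_supp (r + 1)).
  rewrite RintegralD//; last 2 first.
  - exact: signed_integrable mfin cf fM fr.
  - have -> : EFin \o (fun y => M * chi y) = (fun y => M%:E * (EFin \o chi) y)%E by [].
    exact: integrableZl.
  by rewrite RintegralZl.
have e2 : 0 < e / 2 by lra.
have M1 : 0 < M + 1 by lra.
have eM : 0 < e / 2 / (M + 1) by rewrite divr_gt0.
have h1 := lower_nonneg cg gC gr e2.
have /cvgrPdist_lt/(_ _ eM) :=
  lip_test (cutoff_lip (r + 1)) (cutoff01 (r + 1)) (@cutoff_supp (r + 1)).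
move: h1; apply: filterS2 => n; rewrite !decomp// => h1 h2.
have : M * `|\int[nu]_y chi y - \int[mu n]_y chi y| <= e / 2.
  apply: (@le_trans _ _ ((M + 1) * (e / 2 / (M + 1)))); last first.
    by rewrite mulrC divfK// gt_eqF.
  by rewrite ler_pM// ?ltW// ltrDl.
have := ler_norm (- (\int[nu]_y chi y - \int[mu n]_y chi y)); rewrite normrN.
move=> /(ler_wpM2l M0) h3 h4; have := le_trans h3 h4; rewrite mulrN mulrBr; lra.
Qed.

(** The one-sided bounds for [f] and for [- f] together give convergence. *)
Lemma portmanteau_lipschitz (f : Y -> R) (M r : R) : continuous f ->
  (forall y, `|f y| <= M) -> (forall y, f y != 0 -> mdist P y < r) ->
  (fun n => (\int[mu n]_y (f y)%:E)%E) @ \oo --> (\int[nu]_y (f y)%:E)%E.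
Proof.
move=> cf fM fr.
have E (m : {measure set (borel Y) -> \bar R}) : (forall r, (m (ball P r) < +oo)%E) ->
    (\int[m]_y (f y)%:E)%E = (\int[m]_y f y)%:E.
  move=> mfin; rewrite /Rintegral fineK//.
  exact: (integrable_fin_num _ (signed_integrable mfin cf fM fr)).
rewrite E//; under eq_fun do rewrite E//.
apply: cvg_EFin; first exact: nearW.
apply/cvgrPdist_lt => e e0.
have cNf : continuous (fun y => - f y) by move=> y; apply: cvgN; exact: cf.
have NfM y : `|- f y| <= M by rewrite normrN.
have Nfr y : - f y != 0 -> mdist P y < r by rewrite oppr_eq0; exact: fr.
have := lower cNf NfM Nfr e0; have := lower cf fM fr e0.
apply: filterS2 => n h1 h2; rewrite ltr_distl.
have N (m : {measure set (borel Y) -> \bar R}) : (forall r, (m (ball P r) < +oo)%E) ->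
    \int[m]_y (- f y) = - \int[m]_y f y.
  move=> mfin; rewrite -mulN1r -RintegralZl//; last exact: signed_integrable mfin cf fM fr.
  by apply: eq_Rintegral => y _; rewrite mulN1r.
rewrite !N// in h2; apply/andP; split; rewrite /=; lra.
Qed.

End portmanteau.

(** * From box convergence to pmG convergence *)

Section relation_bridge.
Context {R : realType}.

Definition is_bridge (A B : completeMetricType R) (D : A -> B -> R) :=
  [/\ forall (x x' : A) (y : B), mdist x x' <= D x y + D x' y,
      forall (x : A) (y y' : B), mdist y y' <= D x y + D x y',
      forall (x x' : A) (y : B), D x y <= mdist x x' + D x' y,
      forall (x : A) (y y' : B), D x y <= D x y' + mdist y' y &
      exists2 e : R, 0 < e & forall x y, e <= D x y].

Variables (A B : completeMetricType R) (T : Type) (I : set T).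
Variables (qA : T -> A) (qB : T -> B) (e : R).

(** A path from [x] to [qA t], a jump of length [e], and a path from [qB t] to [y]. Two jumps cost
    [2 * e], which exceeds the distortion [e], so a shortcut through the other space never beats an
    original distance; a single jump supplies the gap. *)
Definition relation_bridge (x : A) (y : B) : R :=
  inf [set r | exists2 t, I t & r = mdist x (qA t) + e + mdist (qB t) y].

Hypotheses (e0 : 0 < e) (I0 : I !=set0).
Hypothesis dist : forall t s, I t -> I s ->
  `|mdist (qA t) (qA s) - mdist (qB t) (qB s)| <= e.

Lemma relation_bridge_le x y t : I t ->
  relation_bridge x y <= mdist x (qA t) + e + mdist (qB t) y.
Proof.
move=> It; apply: ge_inf; last by exists t.
by exists 0 => _ [s _ ->]; rewrite !addr_ge0 ?mdist_ge0// ltW.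
Qed.

Lemma le_relation_bridge x y r :
  (forall t, I t -> r <= mdist x (qA t) + e + mdist (qB t) y) -> r <= relation_bridge x y.
Proof.
move=> h; apply: lb_le_inf; last by move=> _ [t It ->]; exact: h.
by case: I0 => t It; exists (mdist x (qA t) + e + mdist (qB t) y), t.
Qed.

Lemma relation_bridge_near t : I t -> relation_bridge (qA t) (qB t) <= e.
Proof.
move=> It; apply: (le_trans (relation_bridge_le _ _ It)).
by rewrite !mdistxx add0r addr0.
Qed.

Lemma relation_bridgeP : is_bridge relation_bridge.
Proof.
split.
- move=> x x' y; rewrite -lerBlDr; apply: le_relation_bridge => t It.
  rewrite lerBlDr -lerBlDl; apply: le_relation_bridge => s Is; rewrite lerBlDl.
  have := dist It Is; rewrite ler_distl => /andP[_ h].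
  have := metric_triangle x (qA t) x'; have := metric_triangle (qA t) (qA s) x'.
  have := metric_triangle (qB t) y (qB s).
  rewrite (metric_sym y (qB s)) (metric_sym (qA s) x'); move: h e0.
  move: (mdist (qB t) (qB s)) (mdist (qA t) (qA s)) (mdist (qB t) y) (mdist (qB s) y).
  move: (mdist (qA t) x') (mdist x' (qA s)) (mdist x (qA t)) (mdist x x') e; clear.
  by move=> *; lra.
- move=> x y y'; rewrite -lerBlDr; apply: le_relation_bridge => t It.
  rewrite lerBlDr -lerBlDl; apply: le_relation_bridge => s Is; rewrite lerBlDl.
  have := dist It Is; rewrite ler_distl => /andP[h _].
  have := metric_triangle y (qB t) y'; have := metric_triangle (qB t) (qB s) y'.
  have := metric_triangle (qA t) x (qA s).
  rewrite (metric_sym y (qB t)) (metric_sym (qA t) x); move: h e0.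
  move: (mdist (qB t) (qB s)) (mdist (qA t) (qA s)) (mdist (qB t) y) (mdist (qB s) y').
  move: (mdist (qB t) y') (mdist x (qA s)) (mdist x (qA t)) (mdist y y') e; clear.
  by move=> *; lra.
- move=> x x' y; rewrite -lerBlDl; apply: le_relation_bridge => t It; rewrite lerBlDl.
  apply: (le_trans (relation_bridge_le x y It)).
  by have := metric_triangle x x' (qA t); lra.
- move=> x y y'; rewrite -lerBlDr; apply: le_relation_bridge => t It; rewrite lerBlDr.
  apply: (le_trans (relation_bridge_le x y It)).
  by have := metric_triangle (qB t) y' y; lra.
- exists e => // x y; apply: le_relation_bridge => t It.
  have := mdist_ge0 x (qA t); have := mdist_ge0 (qB t) y; lra.
Qed.

End relation_bridge.

Section box_to_bridge.
Context {R : realType}.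
Notation leb := (@lebesgue_measure R).

Definition j_cut (X : pmms R) (k : int) : nmms R :=
  @j_nmms R (cut_pmms X k) (cut_measure_setT X k).

Lemma j_cut_pt (X : pmms R) (k : int) (S : set (borel X)) : measurable S ->
  S (pmms_pt X) -> ((1 - 3^-1)%:E <= mms_measure (j_cut X k) S)%E.
Proof.
move=> mS Sp; rewrite /= (j_measureE (X := cut_pmms X k)) diracE mem_set//= mule1.
apply: (@le_trans _ _ (3^-1%:E * (0 + 2%:E))%E).
  by rewrite add0e -EFinM lee_fin; lra.
by apply: lee_wpmul2l; rewrite ?lee_fin ?invr_ge0// leeD2r.
Qed.

(* In each parametrization at least 2/3 of [0, 1) goes to the base point, so
   two base points are matched by some good parameter. *)
Lemma box_bridge (X Y : pmms R) (k : int) (e : R) : e <= 4^-1 ->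
  box_rep (j_cut X k) (j_cut Y k) < e ->
  exists D : X -> Y -> R, [/\ is_bridge D, D (pmms_pt X) (pmms_pt Y) <= e &
    exists (qX : R -> X) (qY : R -> Y) (I : set (measurableTypeR R)),
    [/\ measurable_fun setT (qX : measurableTypeR R -> borel X) /\
        measurable_fun setT (qY : measurableTypeR R -> borel Y),
        @parameter R (j_cut X k) qX, @parameter R (j_cut Y k) qY,
        measurable I /\ (leb (`[0%R, 1%R[ `\` I) <= e%:E)%E &
        forall t, I t -> D (qX t) (qY t) <= e]].
Proof.
move=> e4 /box_rep_lt[qX [qY [e' [[mX mY] pX pY /andP[e'0 e'e] [I [mI I1 Ie dist]]]]]].
have e0 : 0 < e by exact: le_lt_trans e'e.
have Ibad : (leb (`[0%R, 1%R[ `\` I) <= e%:E)%E.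
  by apply: (le_trans (lebesgue_compl01 mI I1 Ie)); rewrite lee_fin ltW.
have single (Z : pmms R) : [set y : Z | mdist (pmms_pt Z) y <= 0] = [set pmms_pt Z].
  apply/seteqP; split => y /=; last by move=> ->; rewrite mdistxx.
  by move=> h; apply/esym/mdist_positivity/eqP; rewrite eq_le h mdist_ge0.
have mpt (Z : pmms R) : measurable ([set pmms_pt Z] : set (borel Z)).
  by rewrite -single; apply: borel_closed; exact: closed_mdist_le.
have m01 : measurable (`[0, 1[ : set (measurableTypeR R)) by exact: measurable_itv.
have bad (Z : pmms R) (q : R -> Z) : measurable_fun setT (q : measurableTypeR R -> borel Z) ->
    @parameter R (j_cut Z k) q ->
    (leb (`[0%R, 1%R[ `\` (`[0%R, 1%R[ `&` q @^-1` [set pmms_pt Z])) <= (3^-1)%:E)%E.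
  move=> mq [_ qE]; apply: lebesgue_compl01.
  - apply: measurableI => //; exact: (measurable_preimage mq (mpt Z)).
  - by move=> t [].
  - by rewrite -qE; [exact: j_cut_pt|exact: mpt].
(* Otherwise three exceptional sets of measure at most [e], [1/3] and [1/3] would cover [[0, 1)],
   whereas [1/4 + 2/3 < 1]. *)
have [t0 [It0 t0X t0Y]] : exists t, [/\ I t, qX t = pmms_pt X & qY t = pmms_pt Y].
  apply: contrapT => h.
  have bX := bad X qX mX pX; have bY := bad Y qY mY pY.
  set BI := _ `\` I in Ibad; set BX := _ `\` _ in bX; set BY := _ `\` _ in bY.
  have mBI : measurable BI by exact: measurableD.
  have mBX : measurable BX.
    apply: measurableD => //; apply: measurableI => //.
    exact: (measurable_preimage mX (mpt X)).
  have mBY : measurable BY.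
    apply: measurableD => //; apply: measurableI => //.
    exact: (measurable_preimage mY (mpt Y)).
  have : (leb `[0%R, 1%R[ <= e%:E + (3^-1)%:E + (3^-1)%:E)%E.
    apply: (@le_trans _ _ (leb (BI `|` BX `|` BY))).
      apply: le_measure; rewrite ?inE//.
        by apply: measurableU => //; exact: measurableU.
      move=> t t01; have [It|It] := pselect (I t); last by left; left.
      have [Xt|Xt] := pselect (qX t = pmms_pt X); last by left; right; split=> // -[].
      right; split=> // -[_ Yt]; apply: h; exists t; split => //.
    apply: (le_trans (measureU2 _ _ _)) => //; first exact: measurableU.
    apply: leeD => //; apply: (le_trans (measureU2 _ _ _)) => //.
    exact: leeD.
  by rewrite lebesgue_itv01 -!EFinD lee_fin; lra.
have I0 : I !=set0 by exists t0.
have distI t s : I t -> I s -> `|mdist (qX t) (qX s) - mdist (qY t) (qY s)| <= e.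
  by move=> It Is; apply: (le_trans (dist _ _ It Is)); exact: ltW.
exists (@relation_bridge R X Y R I qX qY e); split.
- exact: relation_bridgeP.
- by rewrite -t0X -t0Y; exact: relation_bridge_near.
- by exists qX, qY, I; split => // t; exact: relation_bridge_near.
Qed.

(* Any two spaces are bridged through a single pair of points; this fills in
   the finitely many indices where no good coupling is available. *)
Lemma trivial_bridge (A B : completeMetricType R) : exists D : A -> B -> R, is_bridge D.
Proof.
exists (relation_bridge [set: unit] (fun=> point) (fun=> point) 1).
apply: relation_bridgeP => //; first by exists tt.
by move=> t s _ _; rewrite !mdistxx subrr normr0.
Qed.

End box_to_bridge.

(** [kappa n] is the largest [k <= n] such that [A k] holds from [n] on. Each fixed [K] is
    eventually a candidate, so [kappa] tends to infinity; the candidate 0 ensures that for large [n]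
    the maximum is attained. *)
Lemma diagonal_index (A : nat -> nat -> Prop) :
  (forall k, \forall n \near \oo, A k n) ->
  exists kappa : nat -> nat, (forall K, \forall n \near \oo, (K <= kappa n)%N) /\
    \forall n \near \oo, A (kappa n) n.
Proof.
move=> hA; pose Q n k := `[< forall m, (n <= m)%N -> A k m >].
exists (fun n => \max_(k < n.+1 | Q n k) k)%N; split.
  move=> K; have [N _ NA] := hA K; exists (maxn N K) => // n /=.
  rewrite geq_max => /andP[Nn Kn]; have Kn' : (K < n.+1)%N by [].
  apply: (@leq_bigmax_cond _ (fun k : 'I_n.+1 => Q n k) (fun k => k : nat) (Ordinal Kn')).
  by apply/asboolP => m nm; apply: NA; exact: leq_trans nm.
have [N _ NA] := hA 0%N; exists N => // n /= Nn.
have card0 : (0 < #|[pred k : 'I_n.+1 | Q n k]|)%N.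
  have Q0 : Q n 0%N by apply/asboolP => m nm; apply: NA; exact: leq_trans nm.
  by apply/card_gt0P; exists ord0; exact: Q0.
have [k + ->] := eq_bigmax_cond (fun k : 'I_n.+1 => k : nat) card0.
by move=> /asboolP/(_ n (leqnn n)).
Qed.

(** * Comparison of integrals over coupled spaces *)

Section coupled_integrals.
Context {R : realType}.
Notation leb := (@lebesgue_measure R).

Let m01 : measurable (`[0, 1[ : set (measurableTypeR R)).
Proof. exact: measurable_itv. Qed.
Let P := mrestr leb m01.

Let P1 : P setT = 1%E.
Proof. by rewrite /P /= /mrestr setTI lebesgue_itv01. Qed.

Lemma parameter_Rintegral (W : nmms R) (q : R -> W) (h : W -> R) :
  measurable_fun setT (q : measurableTypeR R -> borel W) -> parameter q ->
  measurable_fun setT (h : borel W -> R) -> (forall x, 0 <= h x) ->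
  \int[mms_measure W]_x h x = \int[P]_t (h \o q) t.
Proof.
move=> mq [_ qE] mh h0; congr fine.
rewrite (@eq_measure_integral _ _ _ setT (push_measure P mq)); last first.
  by move=> B mB _; rewrite qE// /= /pushforward /mrestr setIC.
rewrite ge0_integral_pushforward//; first exact/measurable_EFinP.
by move=> y _; rewrite lee_fin.
Qed.

Lemma prob_integral_fin d (T : measurableType d) (m : {measure set T -> \bar R})
    (f : T -> R) (M : R) :
  m setT = 1%E -> measurable_fun setT f -> (forall x, 0 <= f x <= M) ->
  (\int[m]_x (f x)%:E < +oo)%E.
Proof.
move=> m1 mf fM; apply: (@ge0_integral_fin_le _ T R m f (cst 1) `|M|) => //.
- by move=> x; have /andP[] := fM x.
- by move=> x; have /andP[_ h] := fM x; rewrite mulr1 (le_trans h)// ler_norm.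
- by rewrite /= integral_cst// mul1e m1 ltry.
Qed.

(** Pulled back to [[0, 1)], the integrands differ by at most [del] on [I] and, both lying in
    [[0, M]], by at most [M] on the rest. *)
Lemma coupled_Rintegral_close (A B : nmms R) (qA : R -> A) (qB : R -> B)
    (I : set (measurableTypeR R)) (f : A -> R) (g : B -> R) (M del e : R) :
  measurable_fun setT (qA : measurableTypeR R -> borel A) -> parameter qA ->
  measurable_fun setT (qB : measurableTypeR R -> borel B) -> parameter qB ->
  measurable I -> (leb (`[0%R, 1%R[ `\` I) <= e%:E)%E ->
  measurable_fun setT (f : borel A -> R) -> (forall x, 0 <= f x <= M) ->
  measurable_fun setT (g : borel B -> R) -> (forall x, 0 <= g x <= M) ->
  0 <= del -> (forall t, I t -> `|f (qA t) - g (qB t)| <= del) ->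
  `|\int[mms_measure A]_x f x - \int[mms_measure B]_x g x| <= del + M * e.
Proof.
move=> mqA pA mqB pB mI Ie mf fM mg gM del0 fg.
have f0 x : 0 <= f x by have /andP[] := fM x.
have g0 x : 0 <= g x by have /andP[] := gM x.
have M0 : 0 <= M by have /andP[h1 h2] := fM point; exact: le_trans h2.
have mCI : measurable (~` I) by exact: measurableC.
rewrite (parameter_Rintegral mqA pA mf f0) (parameter_Rintegral mqB pB mg g0).
pose h (t : measurableTypeR R) : R := del + M * \1_(~` I) t.
have mh : measurable_fun setT h.
  by apply: measurable_funD => //; apply: measurable_funM => //; exact: measurable_indic.
have h0 t : 0 <= h t by rewrite addr_ge0// mulr_ge0.
have hM t : 0 <= h t <= del + M.
  by rewrite h0 lerD2l ler_piMr// indicE; case: (_ \in _); rewrite ?ler01 ?lexx.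
have := @Rintegral_close _ _ R P (f \o qA) (g \o qB) h 1 (measurableT_comp mf mqA)
  (measurableT_comp mg mqB) mh (fun t => f0 _) (fun t => g0 _) h0 ler01.
rewrite mul1r => close; apply: (le_trans (close _ _ _ _)).
- move=> t; rewrite mul1r /h indicE; have [It|It] := pselect (I t).
    by rewrite (memNset (_ : ~ (~` I) t)) ?mulr0 ?addr0; [exact: fg|exact].
  rewrite mem_set// mulr1; have /andP[a1 a2] := fM (qA t); have /andP[b1 b2] := gM (qB t).
  by rewrite ler_distl /=; apply/andP; split; lra.
- exact: (prob_integral_fin P1 (measurableT_comp mf mqA) (fun t => fM (qA t))).
- exact: (prob_integral_fin P1 (measurableT_comp mg mqB) (fun t => gM (qB t))).
- exact: prob_integral_fin P1 mh hM.
rewrite -lee_fin -ge0_EFin_Rintegral//; last exact: prob_integral_fin P1 mh hM.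
under eq_integral do rewrite EFinD EFinM.
rewrite ge0_integralD//; last 2 first.
- by move=> t _; rewrite mule_ge0 ?lee_fin.
- by apply/measurable_EFinP; apply: measurable_funM => //; exact: measurable_indic.
rewrite integral_cst// ge0_integralZl//; last first.
  by apply/measurable_EFinP; exact: measurable_indic.
rewrite [X in (_ * X + _)%E]P1 mule1 integral_indic// setIT EFinD EFinM.
rewrite leeD2l// lee_wpmul2l ?lee_fin//.
by rewrite /P /= /mrestr setIC -setDE.
Qed.

End coupled_integrals.

Section bridged_integrals.
Context {R : realType}.
Notation leb := (@lebesgue_measure R).

(* For a function vanishing outside the ball where [eta k] is 1, the cut-off and
   the normalisation can be undone. *)
Lemma Rintegral_of_j_cut (X : pmms R) (k : int) (f : X -> R) (M : R) :
  measurable_fun setT (f : borel X -> R) -> (forall x, 0 <= f x <= M) ->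
  (forall x, f x != 0 -> mdist (pmms_pt X) x < 2 ^ k) ->
  \int[mms_measure X]_x f x = eta_mass X k *
    (3 * \int[mms_measure (j_cut X k)]_x f x - 2 * f (pmms_pt X)).
Proof.
move=> mf fM supp.
have -> : \int[mms_measure X]_x f x = \int[mms_measure X]_x (f x * eta_dist k x).
  congr fine; apply: eq_integral => x _; have [->|fx] := eqVneq (f x) 0; first by rewrite mul0r.
  by rewrite /eta_dist eta_near ?mulr1// supp.
rewrite [in RHS]/Rintegral (integral_j_cut k mf fM) /=.
have /lt0r_neq0 c0 := eta_mass_gt0 X k.
rewrite mulrA mulfV ?mul1r; last by rewrite pnatr_eq0.
by rewrite addrK mulrA divff// mul1r.
Qed.

Lemma bridged_Rintegral_close (X Y : pmms R) (Z : completeMetricType R)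
    (iX : X -> Z) (iY : Y -> Z) (D : X -> Y -> R) (k : int) (f : Z -> R) (L M e : R)
    (qX : R -> X) (qY : R -> Y) (I : set (measurableTypeR R)) :
  isometry iX -> isometry iY -> (forall x y, mdist (iX x) (iY y) <= D x y) ->
  D (pmms_pt X) (pmms_pt Y) <= e -> 0 <= e -> 0 <= L ->
  measurable_fun setT (qX : measurableTypeR R -> borel X) ->
  measurable_fun setT (qY : measurableTypeR R -> borel Y) ->
  @parameter R (j_cut X k) qX -> @parameter R (j_cut Y k) qY ->
  measurable I -> (leb (`[0%R, 1%R[ `\` I) <= e%:E)%E ->
  (forall t, I t -> D (qX t) (qY t) <= e) ->
  lipschitz_by L f -> (forall z, 0 <= f z <= M) ->
  (forall x, f (iX x) != 0 -> mdist (pmms_pt X) x < 2 ^ k) ->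
  (forall y, f (iY y) != 0 -> mdist (pmms_pt Y) y < 2 ^ k) ->
  `|\int[mms_measure X]_x f (iX x) - \int[mms_measure Y]_y f (iY y)| <=
  `|eta_mass X k - eta_mass Y k| * (5 * M) + eta_mass Y k * ((5 * L + 3 * M) * e).
Proof.
move=> isoX isoY iD De e0 L0 mqX mqY pX pY mI Ie Dq Lf fM suppX suppY.
have mf : measurable_fun setT (f : borel Z -> R).
  by apply: continuous_borel_measurable; exact: lipschitz_by_continuous Lf.
have mfX : measurable_fun setT ((f \o iX) : borel X -> R).
  exact: (measurableT_comp mf (measurable_isometry isoX)).
have mfY : measurable_fun setT ((f \o iY) : borel Y -> R).
  exact: (measurableT_comp mf (measurable_isometry isoY)).
have near x y : D x y <= e -> `|f (iX x) - f (iY y)| <= L * e.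
  move=> Dxy; apply: (le_trans (Lf _ _)); rewrite ler_wpM2l//.
  exact: le_trans (iD x y) Dxy.
have pt_close := near _ _ De.
have J_close : `|\int[mms_measure (j_cut X k)]_x (f \o iX) x -
    \int[mms_measure (j_cut Y k)]_y (f \o iY) y| <= L * e + M * e.
  apply: (@coupled_Rintegral_close R (j_cut X k) (j_cut Y k) qX qY I (f \o iX) (f \o iY)
    M (L * e) e mqX pX mqY pY mI Ie mfX (fun x => fM _) mfY (fun y => fM _)).
  - by rewrite mulr_ge0.
  - by move=> t /Dq; exact: near.
have JXM : 0 <= \int[mms_measure (j_cut X k)]_x (f \o iX) x <= M.
  rewrite Rintegral_ge0//=; last by move=> x _; have /andP[] := fM (iX x).
  have ifin := prob_integral_fin (nmms_mass1 (j_cut X k)) mfX (fun x => fM (iX x)).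
  rewrite -lee_fin -ge0_EFin_Rintegral//; last by move=> x; have /andP[] := fM (iX x).
  apply: (@le_trans _ _ (\int[mms_measure (j_cut X k)]_x (M%:E))%E).
    apply: ge0_le_integral => //.
    - by move=> x _; rewrite lee_fin; have /andP[] := fM (iX x).
    - exact/measurable_EFinP.
    - by move=> x _; rewrite lee_fin; have /andP[] := fM (iX x).
  by rewrite integral_cst// (nmms_mass1 (j_cut X k)) mule1.
rewrite (Rintegral_of_j_cut mfX (fun x => fM (iX x)) suppX).
rewrite (Rintegral_of_j_cut mfY (fun y => fM (iY y)) suppY).
have /= := fM (iX (pmms_pt X)).
have c0 := eta_mass_gt0 Y k; move: pt_close J_close JXM.
move: (Rintegral _ _ _) (Rintegral _ _ _) => JY JX /=.
move: (f (iX _)) (f (iY _)) (eta_mass X k) (eta_mass Y k) c0 => a b c c' c0.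
move=> ab JJ /andP[JX0 JXM] /andP[a0 aM].
(* The masses and the normalised integrals are varied separately: [5 * M] bounds [3 * JX - 2 * a] in
   absolute value, and [3 * (L + M) + 2 * L = 5 * L + 3 * M]. *)
have -> : c * (3 * JX - 2 * a) - c' * (3 * JY - 2 * b) =
    (c - c') * (3 * JX - 2 * a) + c' * (3 * (JX - JY) - 2 * (a - b)) by lra.
apply: (le_trans (ler_normD _ _)); rewrite !normrM (ger0_norm (ltW c0)).
apply: lerD.
  apply: ler_wpM2l => //; rewrite ler_norml; apply/andP; split; lra.
apply: ler_wpM2l; first exact: ltW.
apply: (le_trans (ler_normB _ _)); rewrite !normrM (ger0_norm (ler0n R 3)) (ger0_norm (ler0n R 2)).
lra.
Qed.

End bridged_integrals.

(** * Countably many spaces bridged to one limit space *)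

Section fan.
Context {R : realType} (X : nat -> completeMetricType R) (Xo : completeMetricType R).
Variable D : forall n, X n -> Xo -> R.
Hypothesis DP : forall n, is_bridge (@D n).

Definition fan_leaf (n : nat) : completeMetricType R := if n is m.+1 then X m else Xo.

Definition fan_bridge (n : nat) : fan_leaf n -> fan_leaf 0 -> R :=
  match n with 0 => fun x y => mdist x y | m.+1 => @D m end.

Lemma fan_bridge0 (x y : fan_leaf 0) : @fan_bridge 0 x y = mdist x y.
Proof. by []. Qed.

Lemma fan_bridge_leaf n (x x' : fan_leaf n) y :
  mdist x x' <= fan_bridge x y + fan_bridge x' y.
Proof.
case: n x x' => [|n] x x' /=; last by have [] := DP n.
by rewrite (metric_sym x' y) metric_triangle.
Qed.

Lemma fan_bridge_hub n (x : fan_leaf n) y y' :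
  mdist y y' <= fan_bridge x y + fan_bridge x y'.
Proof.
case: n x => [|n] x /=; last by have [] := DP n.
by rewrite (metric_sym x y) metric_triangle.
Qed.

Lemma fan_bridge_leafL n (x x' : fan_leaf n) y :
  fan_bridge x y <= mdist x x' + fan_bridge x' y.
Proof. by case: n x x' => [|n] x x' /=; [rewrite metric_triangle|have [] := DP n]. Qed.

Lemma fan_bridge_hubR n (x : fan_leaf n) y y' :
  fan_bridge x y <= fan_bridge x y' + mdist y' y.
Proof. by case: n x => [|n] x /=; [rewrite metric_triangle|have [] := DP n]. Qed.

Lemma fan_bridge_gap n : n != 0%N -> exists2 e : R, 0 < e &
  forall (x : fan_leaf n) y, e <= fan_bridge x y.
Proof. by case: n => // n _; have [] := DP n. Qed.

Definition fan : bridges R := Bridges fan_bridge0 fan_bridge_leaf fan_bridge_hub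
  fan_bridge_leafL fan_bridge_hubR fan_bridge_gap.

Definition fan_in n (x : X n) : glued fan := @glued_in R fan n.+1 x.
Definition fan_hub (y : Xo) : glued fan := @glued_in R fan 0 y.

Lemma fan_in_isometry n : isometry (@fan_in n : X n -> glued fan).
Proof. by move=> x y; exact: glued_in_isometry. Qed.

Lemma fan_hub_isometry : isometry (fan_hub : Xo -> glued fan).
Proof. by move=> x y; exact: glued_in_isometry. Qed.

Lemma fan_separable : (forall n, separable (X n)) -> separable Xo ->
  separable (glued fan : completeMetricType R).
Proof. by move=> sX sXo; apply: glued_separable; case. Qed.

Lemma fan_in_hub n (x : X n) (y : Xo) : mdist (fan_in x) (fan_hub y) <= D x y.
Proof. exact: (@hub_le_bridge R fan n.+1 x y). Qed.

End fan.

Section box_to_pmG.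
Context {R : realType} (X : nat -> pmms R) (Xo : pmms R).
Hypothesis box_cvg : forall k : nat,
  (fun n => box_rep (j_cut (X n) k%:Z) (j_cut Xo k%:Z)) @ \oo --> (0 : R).
Hypothesis mass_cvg : forall k : nat,
  (fun n => eta_mass (X n) k%:Z) @ \oo --> eta_mass Xo k%:Z.
Notation leb := (@lebesgue_measure R).

Let c (k : nat) : R := eta_mass Xo k%:Z.
Let c_gt0 k : 0 < c k. Proof. exact: eta_mass_gt0. Qed.

(* The tolerance compensates the total masses of the cut-offs, which may grow
   without bound in [k]. *)
Let eps (k : nat) : R := (k + 4)%:R^-1 * (1 + c k)^-1.

Let eps_gt0 k : 0 < eps k.
Proof. by rewrite mulr_gt0// invr_gt0 ?addr_gt0// ltr0n addn4. Qed.

Let eps_le k : eps k <= (k + 4)%:R^-1.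
Proof. by rewrite ler_piMr// invf_le1 ?addr_gt0// lerDl ltW. Qed.

Let eps_c k : c k * eps k <= (k + 4)%:R^-1.
Proof.
rewrite mulrCA ler_piMr//.
by rewrite ler_pdivrMr ?addr_gt0// mul1r lerDr.
Qed.

Let A (k n : nat) := box_rep (j_cut (X n) k%:Z) (j_cut Xo k%:Z) < eps k /\
  `|eta_mass (X n) k%:Z - c k| < eps k.

Let package n (D : X n -> Xo -> R) (k : nat) (e : R) :=
  D (pmms_pt (X n)) (pmms_pt Xo) <= e /\
  exists (qX : R -> X n) (qY : R -> Xo) (I : set (measurableTypeR R)),
    [/\ measurable_fun setT (qX : measurableTypeR R -> borel (X n)) /\
        measurable_fun setT (qY : measurableTypeR R -> borel Xo),
        @parameter R (j_cut (X n) k%:Z) qX, @parameter R (j_cut Xo k%:Z) qY,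
        measurable I /\ (leb (`[0%R, 1%R[ `\` I) <= e%:E)%E &
        forall t, I t -> D (qX t) (qY t) <= e].

Lemma box_to_pmG : pmG_cvg_rep X Xo.
Proof.
have [kappa [kappa_oo kappaA]] : exists kappa : nat -> nat,
    (forall K, \forall n \near \oo, (K <= kappa n)%N) /\
    \forall n \near \oo, A (kappa n) n.
  apply: diagonal_index => k.
  have /cvgrPdist_lt/(_ _ (eps_gt0 k)) := @box_cvg k.
  have /cvgrPdist_lt/(_ _ (eps_gt0 k)) := @mass_cvg k.
  apply: filterS2 => n h1 h2; split; last by rewrite distrC.
  by move: h2; rewrite sub0r normrN ger0_norm// box_rep_ge0.
have H n : exists D : X n -> Xo -> R, is_bridge D /\
    (A (kappa n) n -> package D (kappa n) (eps (kappa n))).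
  have [[h1 h2]|nA] := pselect (A (kappa n) n); last first.
    by have [D bD] := trivial_bridge (X n) Xo; exists D; split.
  (* The shift by 4 in [eps] serves to reach the threshold [1/4] of [box_bridge]. *)
  have e4 : eps (kappa n) <= 4^-1.
    by rewrite (le_trans (eps_le _))// lef_pV2 ?posrE ?ltr0n ?addn_gt0 ?orbT// ler_nat leq_addl.
  have [D [bD Dp Dq]] := box_bridge e4 h1.
  by exists D; split.
pose D n := sval (cid (H n)).
have DP n : is_bridge (D n) by have [] := svalP (cid (H n)).
have DA n : A (kappa n) n -> package (D n) (kappa n) (eps (kappa n)).
  by have [_] := svalP (cid (H n)).
pose Y : completeMetricType R := glued (fan DP).
pose io n : X n -> Y := @fan_in R X Xo D DP n.
pose ioo : Xo -> Y := @fan_hub R X Xo D DP.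
pose P : Y := ioo (pmms_pt Xo).
have iso_in n : isometry (io n) by exact: fan_in_isometry.
have iso_hub : isometry ioo by exact: fan_hub_isometry.
have pt_close n : A (kappa n) n -> mdist (io n (pmms_pt (X n))) P <= eps (kappa n).
  by move=> /DA[Dp _]; apply: le_trans Dp; exact: fan_in_hub.
have kappa_inv (e : R) : 0 < e -> \forall n \near \oo, (kappa n + 4)%:R^-1 <= e.
  move=> e0; have [K Ke] := natSinv_lt e0; apply: filterS (kappa_oo K) => n Kn.
  rewrite (le_trans _ (ltW Ke))// lef_pV2 ?posrE ?ltr0n ?addn_gt0 ?orbT// ler_nat.
  by rewrite addnS ltnS (leq_trans Kn)// leq_addr.
exists Y, io, ioo; split => //.
- by apply: fan_separable => [n|]; exact: mms_separable.
- apply/metricType_numDomainType.cvgrPdist_le => e /kappa_inv; move: kappaA.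
  apply: filterS2 => n /pt_close h1 h2; rewrite metric_sym.
  exact: le_trans (le_trans h1 (eps_le _)) h2.
move=> f cf [M fM] [B fB].
have mio n : measurable_fun setT (io n : borel (X n) -> borel Y).
  exact: measurable_isometry.
have mioo : measurable_fun setT (ioo : borel Xo -> borel Y).
  exact: measurable_isometry.
have cl y : f y != 0 -> closure [set z | f z != 0] y.
  by move=> fy; apply: subset_closure.
have [r fr] : exists r, forall y, f y != 0 -> mdist P y < r.
  have [[y0 fy0]|none] := pselect (exists y, f y != 0); last first.
    by exists 0 => y fy; exfalso; apply: none; exists y.
  exists (mdist P y0 + B + 1) => y fy.
  have := metric_triangle P y0 y.
  have := fB y0 y (cl _ fy0) (cl _ fy); lra.
have ball_fin (W : mms R) (i : W -> Y) (mi : measurable_fun setT (i : borel W -> borel Y)) r' :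
    isometry i -> (push_measure (mms_measure W) mi (ball P r') < +oo)%E.
  move=> isoi; apply: mms_finite_bounded.
    by apply: measurable_preimage => //; apply: borel_open; exact: open_mball.
  exists (r' + r') => x y; rewrite /preimage /= !ballEmdist /= -(isoi x y) => hx hy.
  apply: (le_trans (metric_triangle _ P _)); rewrite (metric_sym _ P) lerD//; exact: ltW.
apply: (@portmanteau_lipschitz R Y P (fun n => push_measure (mms_measure (X n)) (mio n))
    (push_measure (mms_measure Xo) mioo) _ _ _ f M r) => //.
- by move=> n r'; exact: ball_fin.
- by move=> r'; exact: ball_fin.
move=> {cl cf M fM B fB r fr} {}f L M r Lf fM fr.
have Lf' : lipschitz_by `|L| f.
  move=> x y; apply: (le_trans (Lf x y)); rewrite ler_wpM2r ?mdist_ge0//; exact: ler_norm.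
have mf : measurable_fun setT ((fun y => (f y)%:E) : borel Y -> \bar R).
  apply/measurable_EFinP; apply: continuous_borel_measurable.
  exact: lipschitz_by_continuous Lf.
have pushE (W : mms R) (i : W -> Y) (mi : measurable_fun setT (i : borel W -> borel Y)) :
    \int[push_measure (mms_measure W) mi]_y f y = \int[mms_measure W]_x f (i x).
  congr fine; rewrite ge0_integral_pushforward//.
  by move=> y _; rewrite lee_fin; have /andP[] := fM y.
rewrite pushE; under eq_fun do rewrite pushE.
have M0 : 0 <= M by have /andP[h1 h2] := fM P; exact: le_trans h2.
(* [5 * M] comes from the masses and [5 * |L| + 3 * M] from the integrals; the last 1 makes [C]
   positive. *)
pose C : R := 8 * M + 5 * `|L| + 1.
have C0 : 0 < C by rewrite /C; have := normr_ge0 L; lra.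
apply/cvgrPdist_le => e e0.
have eC : 0 < e / C by rewrite divr_gt0.
near=> n.
have An : A (kappa n) n by near: n.
have ke : (kappa n + 4)%:R^-1 <= e / C by near: n; exact: kappa_inv.
(* [f] is supported within [r] of [P]; the extra 1 covers the displacement of the base point of
   [X n], which is at most [eps (kappa n)]. *)
have kr : r + 1 <= 2 ^ (kappa n)%:Z.
  have : ((Num.truncn (r + 1)).+1 <= kappa n)%N by near: n; exact: kappa_oo.
  move=> h; rewrite (le_trans (ltW (Num.Theory.truncnS_gt _)))//.
  rewrite -exprnP -natrX ler_nat (leq_trans h)// ltnW//.
  exact: ltn_expl.
have [Dp [qX [qY [I [[mX mY] pX pY [mI Ie] Dq]]]]] := DA n An.
have eps1 : eps (kappa n) <= 1.
  by rewrite (le_trans (eps_le _))// invf_le1 ?ltr0n ?ler1n addn_gt0 orbT.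
rewrite distrC.
have := bridged_Rintegral_close (k := (kappa n)%:Z) (iso_in n) iso_hub (@fan_in_hub _ _ _ _ DP n)
  Dp (ltW (eps_gt0 _)) (normr_ge0 L) mX mY pX pY mI Ie Dq Lf' fM.
move=> /(_ _ _)/le_trans; apply.
- move=> x /fr fx; rewrite -(iso_in n (pmms_pt (X n)) x).
  have := metric_triangle (io n (pmms_pt (X n))) P (io n x).
  have := pt_close n An; lra.
- move=> x /fr; rewrite /P iso_hub => fx; lra.
have [_ /ltW cn] := An.
apply: (@le_trans _ _ (eps (kappa n) * (5 * M) +
    (c (kappa n) * eps (kappa n)) * (5 * `|L| + 3 * M))).
  apply: lerD; first by apply: ler_wpM2r => //; lra.
  by rewrite -[leRHS]mulrA [X in _ <= _ * X]mulrC.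
apply: (@le_trans _ _ ((kappa n + 4)%:R^-1 * C)).
  have h1 := eps_le (kappa n); have h2 := eps_c (kappa n).
  have k0 : 0 <= (kappa n + 4)%:R^-1 :> R by rewrite invr_ge0.
  have L0 := normr_ge0 L.
  apply: (@le_trans _ _ ((kappa n + 4)%:R^-1 * (5 * M) + (kappa n + 4)%:R^-1 * (5 * `|L| + 3 * M))).
    by apply: lerD; apply: ler_wpM2r => //; lra.
  by rewrite -mulrDr ler_wpM2l// /C; lra.
by rewrite -ler_pdivlMr.
Unshelve. all: by end_near. Qed.

End box_to_pmG.

(** * The embedding *)

Section box_topology.
Context {R : realType}.

Lemma box_rep_refl (A : nmms R) : box_rep A A = 0.
Proof.
apply/eqP; rewrite eq_le box_rep_ge0 andbT.
have [q pq] := parameter_exists A; apply: (box_rep_ub pq pq (lexx 0)).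
exists (`[0, 1[%classic : set (measurableTypeR R)); split => //.
- by rewrite lebesgue_itv01 subr0.
- by move=> t s _ _; rewrite subrr normr0.
Qed.

Lemma box_ge0 (x y : X1 R) : 0 <= box x y.
Proof. exact: box_rep_ge0. Qed.

Lemma box_sym (x y : X1 R) : box x y = box y x.
Proof. exact: box_rep_sym. Qed.

Lemma box_refl (x : X1 R) : box x x = 0.
Proof. exact: box_rep_refl. Qed.

Lemma box_triangle (x y z : X1 R) : box x z <= box x y + box y z.
Proof. exact: box_rep_triangle. Qed.

Lemma nbhs_box_ball (x : X1 R) (e : R) : 0 < e -> nbhs x [set y | box x y < e].
Proof.
move=> e0; apply: open_nbhs_nbhs; split; last by rewrite /= box_refl.
move=> y /= xy; exists (e - box x y); first by rewrite subr_gt0.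
by move=> z yz; rewrite (le_lt_trans (box_triangle x y z))//= addrC -ltrBrDr.
Qed.

Lemma box_cvg (y : nat -> X1 R) (x : X1 R) :
  (fun n => box x (y n)) @ \oo --> (0 : R) -> y @ \oo --> x.
Proof.
move=> yx U; rewrite nbhsE => -[V [oV Vx] VU].
have [e e0 eV] := oV x Vx.
have /cvgrPdist_lt/(_ _ e0) := yx; apply: filterS => n.
by rewrite sub0r normrN ger0_norm ?box_ge0// => /eV/VU.
Qed.

Lemma j_cutE (X : pmms R) k : j (cut k (class_pt X)) = class1 (j_cut X k).
Proof. by apply: jE; exact: cutE. Qed.

End box_topology.

Section metrizable_topology.
Context {R : realType} (T : topologicalType) (d : T -> T -> R).
Hypotheses (dm : is_metric d) (openE : forall U : set T, open U <-> metric_open d U).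

Lemma metrizable_nbhsP (x : T) (U : set T) :
  nbhs x U <-> exists2 e : R, 0 < e & forall y, d x y < e -> U y.
Proof.
have [d0 d_eq dC dtri] := dm; split.
  rewrite nbhsE => -[V [/openE oV Vx] VU]; have [e e0 eV] := oV x Vx.
  by exists e => // y /eV /VU.
move=> [e e0 eU]; rewrite nbhsE; exists [set y | d x y < e]; last by move=> y /eU.
split; last by rewrite /= (d_eq x x).2.
apply/openE => y /= xy; exists (e - d x y); first by rewrite subr_gt0.
by move=> z yz; rewrite (le_lt_trans (dtri x y z))//= addrC -ltrBrDr.
Qed.

Lemma metrizable_cvgP (y : nat -> T) (x : T) :
  y @ \oo --> x <-> (fun n => d x (y n)) @ \oo --> (0 : R).
Proof.
have [d0 _ _ _] := dm; split=> [yx|yx].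
  apply/cvgrPdist_lt => e e0; have xe : nbhs x [set z | d x z < e].
    by apply/metrizable_nbhsP; exists e.
  have [N _ Ny] := yx _ xe; exists N => // n /Ny /=.
  by rewrite sub0r normrN ger0_norm.
move=> U /metrizable_nbhsP[e e0 eU].
have /cvgrPdist_lt/(_ _ e0) := yx; apply: filterS => n.
by rewrite sub0r normrN ger0_norm// => /eU.
Qed.

Lemma metrizable_seq_limit_unique (x y : T) : (fun=> y) @ \oo --> x -> y = x.
Proof.
have [d0 d_eq _ _] := dm; move=> /metrizable_cvgP h; apply/esym/d_eq.
have h2 : (fun=> d x y) @ \oo --> d x y by exact: cvg_cst.
exact: (cvg_unique (@Rhausdorff R) h2 h).
Qed.

Lemma metrizable_seq_continuous (V : topologicalType) (f : T -> V) :
  (forall (y : nat -> T) x, y @ \oo --> x -> (f \o y) @ \oo --> f x) -> continuous f.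
Proof.
move=> seqf x U Ufx; apply: contrapT => nU.
have /choice[y yP] : forall n, exists y, d x y < n.+1%:R^-1 /\ ~ U (f y).
  move=> n; apply: contrapT => h; apply: nU; apply/metrizable_nbhsP.
  exists n.+1%:R^-1; first by rewrite invr_gt0.
  by move=> y xy; apply: contrapT => Uy; apply: h; exists y.
have [d0 _ _ _] := dm.
have yx : y @ \oo --> x.
  apply/metrizable_cvgP/cvgrPdist_lt => e /natSinv_lt[K Ke].
  exists K => // n /= Kn; rewrite sub0r normrN ger0_norm//.
  apply: (lt_trans (yP n).1); apply: le_lt_trans Ke.
  by rewrite lef_pV2 ?posrE// ler_nat.
have [N _ /(_ N (leqnn N))] := seqf _ _ yx _ Ufx.
exact: (yP N).2.
Qed.

End metrizable_topology.

Lemma continuous_ptws (T : topologicalType) (I : Type) (V : topologicalType)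
    (f : T -> {ptws I -> V}) : (forall i, continuous (fun x => f x i)) -> continuous f.
Proof.
move=> cf x; apply/cvg_sup => i.
exact: (@continuous_comp_initial _ _ _ (fun g : I -> V => g i) f (cf i) x).
Qed.

Section embedding.
Context {R : realType} (tau : topology (Xpt R)).
Hypothesis tauP : is_pmG_topology tau.
Notation T := (topologized tau).
Notation psi := (Psi : T -> ({ptws int -> X1 R} * {ptws int -> R})%type).

Lemma pmG_cvg_coord (y : nat -> T) (x : T) (k : int) : y @ \oo --> x ->
  (fun n => j (cut k (y n : Xpt R))) @ \oo --> j (cut k (x : Xpt R)) /\
  (fun n => log_mass k (y n : Xpt R)) @ \oo --> log_mass k (x : Xpt R).
Proof.
move=> /(tauP.2 _ _).1[X [Xo [yE xE [Y [io [ioo [sY isoX isoXo ptc test]]]]]]].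
rewrite -xE; split.
  under eq_fun do rewrite -yE j_cutE.
  rewrite j_cutE; apply: box_cvg; under eq_fun do rewrite boxE box_rep_sym.
  exact: (pmG_box sY isoX isoXo ptc test).
under eq_fun do rewrite -yE log_massE.
rewrite log_massE.
exact: (continuous_cvg _ (continuous_ln (eta_mass_gt0 Xo k))
  (pmG_eta_mass (k:=k) isoX isoXo ptc test)).
Qed.

(** Stated with box distances because both uses supply them: zero for injectivity, explicit bounds
    for the inverse. The exponential recovers the masses from their logarithms. *)
Lemma coord_cvg_pmG (y : nat -> T) (x : T) :
  (forall k : nat, (fun n => box (j (cut k%:Z (y n : Xpt R)))
    (j (cut k%:Z (x : Xpt R)))) @ \oo --> (0 : R)) ->
  (forall k : nat, (fun n => log_mass k%:Z (y n : Xpt R)) @ \oo --> log_mass k%:Z (x : Xpt R)) ->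
  y @ \oo --> x.
Proof.
move=> boxc massc; apply/(tauP.2 _ _); exists (fun n => repr (y n : Xpt R)), (repr (x : Xpt R)).
split=> [n||]; [exact: class_pt_repr|exact: class_pt_repr|].
apply: box_to_pmG => k.
  have := boxc k; rewrite -{1}(class_pt_repr x) j_cutE.
  by under eq_fun do rewrite -{1}(class_pt_repr (y _)) j_cutE boxE.
have E (z : Xpt R) : eta_mass (repr z) k%:Z = expR (log_mass k%:Z z).
  by rewrite /log_mass lnK// posrE eta_mass_gt0.
rewrite E; under eq_fun do rewrite E.
exact: (continuous_cvg _ (@continuous_expR R _) (massc k)).
Qed.

Lemma continuous_Psi : continuous psi.
Proof.
have [[d dm dE] _] := tauP => x.
have c1 : continuous ((fun x k => j (cut k (x : Xpt R))) : T -> {ptws int -> X1 R}).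
  apply: continuous_ptws => k; apply: (metrizable_seq_continuous dm dE) => y z yz.
  exact: (pmG_cvg_coord k yz).1.
have c2 : continuous ((fun x k => log_mass k (x : Xpt R)) : T -> {ptws int -> R}).
  apply: continuous_ptws => k; apply: (metrizable_seq_continuous dm dE) => y z yz.
  exact: (pmG_cvg_coord k yz).2.
exact: (cvg_pair (c1 x) (c2 x)).
Qed.

(** If two classes have the same image, the constant sequence at one converges to the other, and
    limits are unique in a metrizable topology. *)
Lemma Psi_inj : injective psi.
Proof.
have [[d dm dE] _] := tauP => x y xy.
apply/(metrizable_seq_limit_unique dm dE)/coord_cvg_pmG => k.
  have -> : j (cut k%:Z (x : Xpt R)) = j (cut k%:Z (y : Xpt R)).
    exact: (congr1 (fun p => p.1 k%:Z) xy).
  by rewrite box_refl; exact: cvg_cst.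
have -> : log_mass k%:Z (x : Xpt R) = log_mass k%:Z (y : Xpt R).
  exact: (congr1 (fun p => p.2 k%:Z) xy).
exact: cvg_cst.
Qed.

Notation psi_image := (set_type (range psi)).

Let coord1_continuous (k : int) : continuous ((fun z => (\val z).1 k) : psi_image -> X1 R).
Proof.
move=> z; apply: (@continuous_comp _ _ _ (fun z : psi_image => (\val z).1 : {ptws int -> X1 R})
  (fun p : {ptws int -> X1 R} => p k)); last exact: proj_continuous.
apply: (@continuous_comp _ _ _ (fun z : psi_image => \val z) fst); last exact: cvg_fst.
exact: initial_continuous.
Qed.

Let coord2_continuous (k : int) : continuous ((fun z => (\val z).2 k) : psi_image -> R).
Proof.
move=> z; apply: (@continuous_comp _ _ _ (fun z : psi_image => (\val z).2 : {ptws int -> R})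
  (fun p : {ptws int -> R} => p k)); last exact: proj_continuous.
apply: (@continuous_comp _ _ _ (fun z : psi_image => \val z) snd); last exact: cvg_snd.
exact: initial_continuous.
Qed.

(** One index bounds both the number of coordinates and their accuracy. Each set constrains finitely
    many coordinates, so it is a neighbourhood, and a point chosen in each gives a sequence
    converging in all these coordinates; this reduces continuity of the inverse to sequences. *)
Let close (n : nat) (z : psi_image) : set psi_image := [set z' | forall k : 'I_n,
  box ((\val z).1 (k : nat)%:Z) ((\val z').1 (k : nat)%:Z) < n.+1%:R^-1 /\
  `|(\val z).2 (k : nat)%:Z - (\val z').2 (k : nat)%:Z| < n.+1%:R^-1].

Let nbhs_close n z : nbhs z (close n z).
Proof.
have n0 : 0 < n.+1%:R^-1 :> R by rewrite invr_gt0.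
apply: (@filter_forall _ _ (fun (k : 'I_n) z' => _ /\ _) (nbhs z) _) => k; apply: filterI.
  exact: (@coord1_continuous _ z _ (nbhs_box_ball _ n0)).
by have /cvgrPdist_lt/(_ _ n0) := @coord2_continuous (k : nat)%:Z z.
Qed.

Lemma Psi_embedding : topological_embedding psi.
Proof.
have rangeP x : range psi (psi x) by exists x.
pose h x : psi_image := SigSub (mem_set (rangeP x)).
have ch : continuous h by apply: continuous_comp_initial; exact: continuous_Psi.
pose g (z : psi_image) : T := s2val (cid2 (set_valP z)).
have gP z : psi (g z) = \val z by exact: (s2valP' (cid2 (set_valP z))).
exists h => //; split => //; exists g; split; first last.
- by move=> z; apply: val_inj; rewrite /= gP.
- by move=> x; apply: Psi_inj; rewrite gP.
move=> z U Uz; apply: contrapT => nU.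
have /choice[y yP] : forall n, exists y : psi_image, close n z y /\ ~ U (g y).
  move=> n; apply: contrapT => none; apply: nU.
  apply: filterS (nbhs_close n z) => y zy; apply: contrapT => Uy.
  by apply: none; exists y.
have small (a : nat -> R) (k : nat) : (forall n, (k < n)%N -> `|a n| < n.+1%:R^-1) ->
    a @ \oo --> (0 : R).
  move=> an; apply/cvgrPdist_lt => e /natSinv_lt[K Ke].
  exists (maxn k.+1 K) => // n /=; rewrite geq_max => /andP[kn Kn].
  rewrite sub0r normrN (lt_trans (an n kn))// (le_lt_trans _ Ke)//.
  by rewrite lef_pV2 ?posrE// ler_nat.
have gy : (g \o y) @ \oo --> g z.
  apply: coord_cvg_pmG => k.
    apply: (small _ k) => n kn; have [+ _] := (yP n).1 (Ordinal kn).
    rewrite -!gP /= box_sym ger0_norm ?box_ge0//.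
  rewrite -[X in _ --> X]subr0.
  have -> : (fun n => log_mass k%:Z ((g \o y) n : Xpt R)) = (fun n =>
      log_mass k%:Z (g z : Xpt R) -
      (log_mass k%:Z (g z : Xpt R) - log_mass k%:Z (g (y n) : Xpt R))).
    by apply/funext => n /=; rewrite subKr.
  apply: cvgB; first exact: cvg_cst.
  apply: (small _ k) => n kn.
  by have [_] := (yP n).1 (Ordinal kn); rewrite -!gP.
have [N _ /(_ N (leqnn N))] := gy _ Uz.
exact: (yP N).2.
Qed.

End embedding.

Theorem theorem6p2 (R : realType) (tau : topology (Xpt R)) :
  is_pmG_topology tau ->
  topological_embedding
    (Psi : topologized tau -> ({ptws int -> X1 R} * {ptws int -> R})%type).
Proof. exact: Psi_embedding. Qed.
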